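(* Let $d\ge1$ and let $E\subset\mathbb R^d$ be compact with $\dim_{\mathcal H}(E)>\frac d2+\frac14$. Then the set $$\left\{(x-y)\cdot(z-w) : x,y,z,w\in E\right\}\subset\mathbb R$$ has nonempty interior.
   Context: $\dim_{\mathcal H}$ denotes Hausdorff dimension and $\cdot$ the Euclidean inner product on $\mathbb R^d$. *)

(* Defs.v *)
From HB Require Import structures.
From mathcomp Require Import all_boot all_order all_algebra.
From mathcomp Require Import all_classical all_reals all_analysis.
Set Implicit Arguments. Unset Strict Implicit. Unset Printing Implicit Defensive.
Import Order.TTheory GRing.Theory Num.Theory.
Import numFieldNormedType.Exports.
Local Open Scope classical_set_scope.
Local Open Scope ring_scope.

Definition edot (R : realType) (d : nat) (x y : 'rV[R]_d) : R :=
  \sum_(i < d) x ord0 i * y ord0 i.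

Definition edist (R : realType) (d : nat) (x y : 'rV[R]_d) : R :=
  Num.sqrt (edot (x - y) (x - y)).

(* Euclidean diameter, in the extended reals (-oo for the empty set). *)
Definition ediam (R : realType) (d : nat) (U : set 'rV[R]_d) : \bar R :=
  ereal_sup [set (edist x y)%:E | x in U & y in U].

Definition hcontrib (R : realType) (d : nat) (s : R) (U : set 'rV[R]_d) : \bar R :=
  if asbool (U = set0) then 0%E else ((fine (ediam U)) `^ s)%:E.

Definition hausdorff_delta (R : realType) (d : nat) (s delta : R)
  (E : set 'rV[R]_d) : \bar R :=
  ereal_inf [set (\sum_(0 <= i <oo) hcontrib s (U i))%E |
             U in [set U : nat -> set 'rV[R]_d |
                   E `<=` \bigcup_i U i /\ (forall i, (ediam (U i) <= delta%:E)%E)]].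

Definition hausdorff (R : realType) (d : nat) (s : R) (E : set 'rV[R]_d) : \bar R :=
  ereal_sup [set hausdorff_delta s delta E | delta in [set delta : R | 0 < delta]].

Definition dimH (R : realType) (d : nat) (E : set 'rV[R]_d) : \bar R :=
  ereal_inf [set s%:E | s in [set s : R | 0 <= s /\ hausdorff s E = 0%E]].

(* Main.v *)
(** Mattila-Sjolin argument in [R^(2d)].  With X = (x, z) and Y = (y, w) the quantity
    (x - y).(z - w) is Q(X - Y) for the nondegenerate quadratic form Q(a, b) = a.b, and
    E x E has dimension > d + 1/2 = (2d + 1)/2, the threshold at which the density of
    Q(X - Y) becomes continuous on (0, +oo).

    All measures are discrete: Frostman's lemma is used at a finite scale, uniformly in
    the scale.  The density of Q(X - Y) at p, tested at frequency T, is
    sum_(X, Y) M(X) M(Y) e^(-|X - Y|^2 / 2) * (band-limited kernel)(Q(X - Y) - p).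
    Each damped chirp e^(i tau Q) e^(-|.|^2 / 2) has the Fourier transform
    (1 + tau^2)^(-d/2) e^(-|zeta|^2 / 2(1 + tau^2)) e^(-i tau Q(zeta) / (1 + tau^2)),
    so van der Corput's second derivative test, applied in tau ~ T for fixed zeta, bounds
    the multiplier of the kernel by T^(1/2 - d) e^(-c |zeta|^2 / T^2).  Transforming
    back and using the Frostman condition, consecutive dyadic scales differ by
    O(T^(d + 1/2 - 2s)), which is summable for s > d/2 + 1/4.

    If the (compact) set of values had empty interior, then at points p outside of it the
    density would vanish at very fine scales, hence would be small at a fixed coarse
    scale; as such p are dense, this contradicts that a fixed proportion of the
    quadruples (x, z near one point of E and y, w near another one) has
    Q(X - Y) in a compact subset of (0, +oo). *)
Require Import Defs.
From HB Require Import structures.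
From mathcomp Require Import all_boot all_order all_algebra.
From mathcomp Require Import all_classical all_reals all_analysis.
From mathcomp Require Import measurable_realfun ring lra zify.
Import Order.TTheory GRing.Theory Num.Theory.
Import numFieldNormedType.Exports.
Local Open Scope classical_set_scope.
Local Open Scope ring_scope.

Set Implicit Arguments.
Unset Strict Implicit.
Unset Printing Implicit Defensive.

(** * Gaussian integrals *)

Section GaussianIntegral.
Variable R : realType.
Local Notation mu := (@lebesgue_measure R).
Implicit Types v m b c x : R.

(** The kernels are unnormalised Fejer kernels in a discrete frequency [k / L]: frequency integrals
    in [tau] become finite sums, and only one-dimensional Gaussian integrals remain. These kernels
    are nonnegative, of size [n ^ 2] for [|n x| <= 1], and bounded independently of [n] away from
    [0]; so they give both the lower bound by the mass near [p] and the smallness at fine scales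
    when [p] is avoided. At [n = 2 ^ j * L] the energy [U j] behaves like [2 ^ j] times a density.
    Combining only two scales always leaves low frequencies in, whereas
    [U j.+2 - 3 * U j.+1 + 2 * U j] has coefficients supported on frequencies of size [2 ^ j], where
    van der Corput's test applies. This recurrence is run from the fine scale back to the coarse
    one. The Fourier transform in [2 d] variables is taken by induction, trading one pair of
    coordinates for one pair of frequencies at a time. The order of choices is essential: the coarse
    scale, the points [p], their gap to the set of values, the fine scale, and only then the
    measure. *)

Definition has_integral (f : R -> R) (I : R) :=
  mu.-integrable setT (EFin \o f) /\ \int[mu]_x f x = I.

Lemma has_integral_ext (f g : R -> R) I :
  (forall x, f x = g x) -> has_integral f I -> has_integral g I.
Proof. by move=> /funext ->. Qed.

Lemma has_integralZ (f : R -> R) I r :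
  has_integral f I -> has_integral (fun x => r * f x) (r * I).
Proof.
move=> [fi <-]; split; last by rewrite RintegralZl.
rewrite (_ : _ \o _ = (fun x => r%:E * (EFin \o f) x)%E); last first.
  by apply/funext => x /=; rewrite EFinM.
exact: integrableZl.
Qed.

Lemma has_integralD (f g : R -> R) I J :
  has_integral f I -> has_integral g J ->
  has_integral (fun x => f x + g x) (I + J).
Proof.
move=> [fi <-] [gi <-]; split; last by rewrite RintegralD.
rewrite (_ : _ \o _ = (EFin \o f) \+ (EFin \o g))%E; last first.
  by apply/funext => x /=; rewrite EFinD.
exact: integrableD.
Qed.

Lemma has_integral0 : has_integral (fun=> 0) 0.
Proof.
split; last by rewrite Rintegral_cst// mul0r.
exact: integrable0.
Qed.

Lemma has_integral_sum (I : Type) (s : seq I) (f : I -> R -> R) (J : I -> R) :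
  (forall i, has_integral (f i) (J i)) ->
  has_integral (fun x => \sum_(i <- s) f i x) (\sum_(i <- s) J i).
Proof.
move=> fJ; elim: s => [|i s IH].
  rewrite big_nil; apply: (has_integral_ext _ has_integral0) => x.
  by rewrite big_nil.
rewrite big_cons; apply: (has_integral_ext _ (has_integralD (fJ i) IH)) => x.
by rewrite big_cons.
Qed.

Lemma has_integral_le_norm (f g : R -> R) I J :
  has_integral f I -> has_integral g J -> (forall x, `|f x| <= g x) ->
  `|I| <= J.
Proof.
move=> [fi <-] [gi <-] fg; apply: le_trans (le_normr_Rintegral _ _) _ => //.
apply: le_Rintegral => //; first exact: (integrable_abse fi).
Qed.

(** [v] is the inverse variance; its sign is left free because a negative [v] gives the integrating
    factor in [cos_gauss_has_integral]. *)
Definition gauss (v m x : R) := expR (- (v * (x - m) ^+ 2) / 2).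

Lemma gauss_gt0 v m x : 0 < gauss v m x. Proof. exact: expR_gt0. Qed.

Lemma continuous_affine (b c m : R) : continuous (fun x : R => c + b * (x - m)).
Proof.
move=> x; apply: cvgD; first exact: cvg_cst.
apply: cvgM; first exact: cvg_cst.
by apply: cvgB; [exact: cvg_id|exact: cvg_cst].
Qed.

Lemma continuous_gauss v m : continuous (gauss v m).
Proof.
move=> x; rewrite /gauss.
apply: (@continuous_comp _ _ _ (fun x : R => - (v * (x - m) ^+ 2) / 2) expR); last exact: continuous_expR.
apply: cvgM; last exact: cvg_cst.
apply: cvgN; apply: cvgM; first exact: cvg_cst.
apply: (@continuous_comp _ _ _ (fun x => x - m) (fun x => x ^+ 2)).
  by apply: cvgB; [exact: cvg_id|exact: cvg_cst].
exact: exprn_continuous.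
Qed.

Lemma gauss_has_integral v m : 0 < v ->
  has_integral (gauss v m) (Num.sqrt (2 * pi / v)).
Proof.
move=> v0.
pose s := Num.sqrt v^-1.
have s0 : s != 0 by rewrite gt_eqF// sqrtr_gt0 invr_gt0.
have sE : s ^+ 2 = v^-1 by rewrite sqr_sqrtr// invr_ge0 ltW.
have pk0 := normal_peak_gt0 s0.
have hp : has_integral (normal_pdf m s) 1.
  split; first exact: integrable_normal_pdf.
  by rewrite /Rintegral integral_normal_pdf.
have := has_integralZ (normal_peak s)^-1 hp.
rewrite mulr1 /normal_peak invrK sE.
rewrite (_ : v^-1 * pi *+ 2 = 2 * pi / v); last by rewrite -mulr_natr; ring.
apply: has_integral_ext => x; rewrite normal_pdfE// mulrA.
have -> : Num.sqrt (2 * pi / v) = (normal_peak s)^-1.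
  by rewrite /normal_peak invrK sE; congr Num.sqrt; rewrite -mulr_natr; ring.
rewrite mulVf ?mul1r ?gt_eqF//.
rewrite /normal_fun /gauss sE; congr expR.
by rewrite -mulr_natr; field; rewrite gt_eqF.
Qed.

Lemma integrable_bounded_gauss v m C (f : R -> R) : 0 < v ->
  continuous f -> (forall x, `|f x| <= C * gauss v m x) ->
  mu.-integrable setT (EFin \o f).
Proof.
move=> v0 cf fC.
apply: (le_integrable measurableT _ _ (has_integralZ C (gauss_has_integral m v0)).1).
  apply/measurable_EFinP; exact: continuous_measurable_fun.
move=> x _ /=; rewrite lee_fin (le_trans (fC x))//.
exact: ler_norm.
Qed.

(** Follows from [1 + y <= expR y]; decay like [1 / n] is enough for the boundary terms in
    [integral_derivative_eq0]. *)
Lemma gauss_at v m n : 0 < v ->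
  (forall x, (x - m) ^+ 2 = (n.+1%:R : R) ^+ 2 -> gauss v m x <= (2 / v) * n.+1%:R^-1).
Proof.
move=> v0 x xm; rewrite /gauss xm mulNr expRN -[leRHS]invrK lef_pV2 ?posrE ?expR_gt0//; last first.
  by rewrite invr_gt0 mulr_gt0 ?divr_gt0 ?invr_gt0.
apply: le_trans (expR_ge1Dx _).
rewrite invfM invrK invf_div.
have n1 : (1 : R) <= n.+1%:R by rewrite ler1n.
have := ler_wpM2l (ltW v0) n1.
nra.
Qed.

(** Fundamental theorem of calculus on growing intervals: the Gaussian bound on [f] kills the
    boundary terms, and dominated convergence with bound [|g|] passes to the whole line. *)
Lemma integral_derivative_eq0 v m (f g : R -> R) : 0 < v ->
  (forall x : R, is_derive x (1 : R) f (g x)) -> continuous g ->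
  mu.-integrable setT (EFin \o g) ->
  (forall x, `|f x| <= gauss v m x) -> \int[mu]_x g x = 0.
Proof.
move=> v0 fg cg ig fb.
pose A n : set R := `[m - n.+1%:R, m + n.+1%:R]%classic.
have mA n : measurable (A n) by exact: measurable_itv.
have ltA n : m - n.+1%:R < m + n.+1%:R :> R.
  have : (0 : R) < n.+1%:R by []. lra.
have FTC n : (\int[mu]_(x in A n) (g x)%:E = (f (m + n.+1%:R))%:E - (f (m - n.+1%:R))%:E)%E.
  have cf : continuous f.
    move=> x; apply/differentiable_continuous/derivable1_diffP.
    exact: (@ex_derive _ _ _ _ _ _ _ (fg x)).
  apply: continuous_FTC2 => //.
  - by apply: continuous_subspaceT => x; exact: cg.
  - split => [x _||].
    + exact: (@ex_derive _ _ _ _ _ _ _ (fg x)).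
    + by apply/cvg_at_right_filter/cf.
    + by apply/cvg_at_left_filter/cf.
  - by move=> x _; rewrite derive1E; exact: (@derive_val _ _ _ _ _ _ _ (fg x)).
have mg : measurable_fun setT g by exact: continuous_measurable_fun.
pose F n : R -> \bar R := (EFin \o g) \_ (A n).
have [] := @dominated_convergence _ _ _ mu setT measurableT F (EFin \o g) (fun x => `|g x|%:E).
- move=> n; apply: (measurable_restrictT (EFin \o g) (mA n)).1.
  by apply/measurable_EFinP; exact: measurable_funTS.
- exact/measurable_EFinP.
- apply: aeW => x _.
  apply: cvg_near_cst.
  near=> n; rewrite /F patchE mem_set// /A /= in_itv/=.
  have : `|x - m| <= n.+1%:R.
    near: n; exists (Num.truncn `|x - m|).+1 => // n /= hn.
    apply: le_trans (ltW (truncnS_gt _)) _.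
    by rewrite ler_nat ltnW.
  rewrite ler_norml; lra.
- exact: (integrable_norm ig).
- apply: aeW => x n _; rewrite /F patchE.
  by case: ifP => _ /=; rewrite ?lexx// normr0 lee_fin.
move=> _ _ h.
have {}h : (f (m + n.+1%:R) - f (m - n.+1%:R))%:E @[n --> \oo] --> (\int[mu]_x (g x)%:E)%E.
  rewrite (_ : (fun n => _) = (fun n => \int[mu]_x F n x)%E); first exact: h.
  by apply/funext => n; rewrite /F -integral_mkcond FTC EFinB.
have h0 : (f (m + n.+1%:R) - f (m - n.+1%:R)) @[n --> \oo] --> (0 : R).
  apply: (@squeeze_cvgr _ _ _ _ (fun n => - (4 / v * n.+1%:R^-1)) (fun n => 4 / v * n.+1%:R^-1)).
  - near=> n.
    have h1 : `|f (m + n.+1%:R)| <= 2 / v * n.+1%:R^-1.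
      by apply: le_trans (fb _) (gauss_at v0 _); rewrite addrAC subrr add0r.
    have h2 : `|f (m - n.+1%:R)| <= 2 / v * n.+1%:R^-1.
      by apply: le_trans (fb _) (gauss_at v0 _); rewrite addrAC subrr add0r sqrrN.
    move: h1 h2; rewrite !ler_norml.
    rewrite (_ : 4 / v * n.+1%:R^-1 = 2 / v * n.+1%:R^-1 + 2 / v * n.+1%:R^-1); last by ring.
    set q := 2 / v * _; lra.
  - rewrite -oppr0; apply: cvgN; rewrite -[0](mulr0 (4 / v)).
    by apply: cvgM; [exact: cvg_cst|exact: cvg_harmonic].
  - rewrite -[X in _ --> X](mulr0 (4 / v)).
    by apply: cvgM; [exact: cvg_cst|exact: cvg_harmonic].
have h1 : (f (m + n.+1%:R) - f (m - n.+1%:R))%:E @[n --> \oo] --> (0%R : R)%:E.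
  apply: cvg_EFin; first exact: nearW.
  exact: h0.
by rewrite /Rintegral (cvg_unique _ h h1).
Unshelve. all: by end_near. Qed.

(** Half of the exponent is given up to absorb the linear factor. *)
Lemma norm_mul_gauss_le v m x : 0 < v ->
  `|x - m| * gauss v m x <= (1 + v^-1) * gauss (v / 2) m x.
Proof.
move=> v0.
have -> : gauss v m x = gauss (v / 2) m x * expR (- (v / 4 * (x - m) ^+ 2)).
  by rewrite /gauss -expRD; congr expR; field.
rewrite mulrCA mulrC ler_wpM2r ?(ltW (gauss_gt0 _ _ _))//.
rewrite expRN ler_pdivrMr ?expR_gt0//.
have h : 1 + v / 4 * (x - m) ^+ 2 <= expR (v / 4 * (x - m) ^+ 2).
  exact: expR_ge1Dx.
have vi : 0 < v^-1 by rewrite invr_gt0.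
have c0 : 0 <= 1 + v^-1 by lra.
apply: le_trans (ler_wpM2l c0 h).
rewrite -real_normK ?num_real//.
set t := `|x - m|.
have -> : (1 + v^-1) * (1 + v / 4 * t ^+ 2) = 1 + v^-1 + v / 4 * t ^+ 2 + t ^+ 2 / 4.
  by field; rewrite gt_eqF.
have : 0 <= v / 4 * t ^+ 2 by rewrite mulr_ge0 ?sqr_ge0// divr_ge0 ?ltW.
have : 0 <= (t / 2 - 1) ^+ 2 by exact: sqr_ge0.
nra.
Qed.

Lemma is_derive_affine (b c m x : R) :
  is_derive x (1 : R) (fun x : R => c + b * (x - m)) b.
Proof.
apply: is_derive_eq.
rewrite /GRing.scale/=; ring.
Qed.

Lemma is_derive_gauss v m x :
  is_derive x (1 : R) (gauss v m) (- (v * (x - m)) * gauss v m x).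
Proof.
rewrite /gauss.
have h : is_derive x (1 : R) (fun x : R => - (v * (x - m) ^+ 2) / 2) (- (v * (x - m))).
  apply: is_derive_eq; rewrite /GRing.scale/=; by field.
have := @is_derive1_comp _ expR _ x _ _ (is_derive_expR _) h.
by rewrite mulrC.
Qed.

Lemma is_derive_cos_affine (b c m x : R) :
  is_derive x (1 : R) (fun x : R => cos (c + b * (x - m))) (- (b * sin (c + b * (x - m)))).
Proof.
have := @is_derive1_comp _ cos _ x _ _ (is_derive_cos _) (is_derive_affine b c m x).
by rewrite mulNr mulrC.
Qed.

Lemma is_derive_sin_affine (b c m x : R) :
  is_derive x (1 : R) (fun x : R => sin (c + b * (x - m))) (b * cos (c + b * (x - m))).
Proof.
have := @is_derive1_comp _ sin _ x _ _ (is_derive_sin _) (is_derive_affine b c m x).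
by rewrite mulrC.
Qed.

Lemma continuous_cos_affine (b c m : R) : continuous (fun x : R => cos (c + b * (x - m))).
Proof.
move=> x; apply: (@continuous_comp _ _ _ (fun x : R => c + b * (x - m)) cos).
  exact: continuous_affine.
exact: continuous_cos.
Qed.

Lemma continuous_sin_affine (b c m : R) : continuous (fun x : R => sin (c + b * (x - m))).
Proof.
move=> x; apply: (@continuous_comp _ _ _ (fun x : R => c + b * (x - m)) sin).
  exact: continuous_affine.
exact: continuous_sin.
Qed.

Lemma integrable_cos_gauss v m b c : 0 < v ->
  mu.-integrable setT (EFin \o (fun x : R => cos (c + b * (x - m)) * gauss v m x)).
Proof.
move=> v0; apply: (@integrable_bounded_gauss v m 1) => //.
  move=> x; apply: cvgM; first exact: continuous_cos_affine.
  exact: continuous_gauss.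
move=> x; rewrite normrM (gtr0_norm (gauss_gt0 _ _ _)).
by rewrite ler_wpM2r ?(ltW (gauss_gt0 _ _ _))// cos_max.
Qed.

Lemma continuous_mul_sin_gauss v m b c :
  continuous (fun x : R => (x - m) * (sin (c + b * (x - m)) * gauss v m x)).
Proof.
move=> x; apply: cvgM.
  by apply: cvgB; [exact: cvg_id|exact: cvg_cst].
apply: cvgM; first exact: continuous_sin_affine.
exact: continuous_gauss.
Qed.

Lemma norm_mul_sin_gauss v m b c x : 0 < v ->
  `|(x - m) * (sin (c + b * (x - m)) * gauss v m x)| <= (1 + v^-1) * gauss (v / 2) m x.
Proof.
move=> v0; apply: le_trans (norm_mul_gauss_le m x v0).
rewrite !normrM (gtr0_norm (gauss_gt0 _ _ _)) ler_wpM2l//.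
by rewrite ler_piMl ?(ltW (gauss_gt0 _ _ _))// sin_max.
Qed.

Lemma integrable_mul_sin_gauss v m b c : 0 < v ->
  mu.-integrable setT
    (EFin \o (fun x : R => (x - m) * (sin (c + b * (x - m)) * gauss v m x))).
Proof.
move=> v0; apply: (@integrable_bounded_gauss (v / 2) m (1 + v^-1)).
- by rewrite divr_gt0.
- exact: continuous_mul_sin_gauss.
- by move=> x; exact: norm_mul_sin_gauss.
Qed.

(** Integration by parts: the derivative of the sine times the Gaussian integrates to zero. *)
Lemma integral_mul_sin_gauss v m b c : 0 < v ->
  \int[mu]_x ((x - m) * (sin (c + b * (x - m)) * gauss v m x)) =
  b / v * \int[mu]_x (cos (c + b * (x - m)) * gauss v m x).
Proof.
move=> v0.
have hc := conj (integrable_cos_gauss m b c v0) erefl : has_integral _ _.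
have hs := conj (integrable_mul_sin_gauss m b c v0) erefl : has_integral _ _.
have hg := has_integralD (has_integralZ b hc) (has_integralZ (- v) hs).
set g := (fun x => _ + _) in hg.
have := @integral_derivative_eq0 v m (fun x => sin (c + b * (x - m)) * gauss v m x) g v0.
rewrite hg.2 => h; suff : b * \int[mu]_x (cos (c + b * (x - m)) * gauss v m x) +
    - v * \int[mu]_x ((x - m) * (sin (c + b * (x - m)) * gauss v m x)) = 0.
  set Q := \int[mu]_x _; set P := \int[mu]_x _ => e.
  have e2 : b * Q = v * P by lra.
  by rewrite mulrAC e2; field; rewrite gt_eqF.
apply: h.
- move=> x; have h1 := is_derive_sin_affine b c m x.
  have h2 := is_derive_gauss v m x.
  apply: is_derive_eq; rewrite /g /GRing.scale/=; ring.
- move=> x; apply: cvgD; apply: cvgM; try exact: cvg_cst.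
    by apply: cvgM; [exact: continuous_cos_affine|exact: continuous_gauss].
  exact: continuous_mul_sin_gauss.
- exact: hg.1.
- move=> x; rewrite normrM (gtr0_norm (gauss_gt0 _ _ _)).
  by rewrite ler_piMl ?(ltW (gauss_gt0 _ _ _))// sin_max.
Qed.

(** Differentiation under the integral sign shows that the cosine transform solves
    [J' = - (b / v) J]. *)
Lemma is_derive_integral_cos_gauss v m c b : 0 < v ->
  is_derive b (1 : R) (fun b => \int[mu]_x (cos (c + b * (x - m)) * gauss v m x))
   (- (b / v) * \int[mu]_x (cos (c + b * (x - m)) * gauss v m x)).
Proof.
move=> v0.
pose f b x := cos (c + b * (x - m)) * gauss v m x.
have fd b' x : is_derive b' (1 : R) (f ^~ x) (- ((x - m) * (sin (c + b' * (x - m)) * gauss v m x))).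
  have h1 : is_derive b' (1 : R) (fun b : R => cos (c + b * (x - m))) (- ((x - m) * sin (c + b' * (x - m)))).
    rewrite (_ : (fun b : R => cos (c + b * (x - m))) =
                 (fun b : R => cos (c + (x - m) * (b - 0)))); last first.
      by apply/funext => y; rewrite subr0 mulrC.
    have := is_derive_cos_affine (x - m) c 0 b'.
    by rewrite subr0 (mulrC (x - m) b').
  rewrite /f; apply: is_derive_eq; rewrite /GRing.scale/=; ring.
have pE b' x : partial1of2 f b' x = - ((x - m) * (sin (c + b' * (x - m)) * gauss v m x)).
  by rewrite /partial1of2 derive1E; exact: (@derive_val _ _ _ _ _ _ _ (fd b' x)).
have bI : `](b - 1), (b + 1)[%classic b by rewrite /= in_itv/=; lra.
have inf x : `](b - 1), (b + 1)[%classic x -> mu.-integrable setT (EFin \o f x).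
  by move=> _; exact: integrable_cos_gauss.
have df x y : `](b - 1), (b + 1)[%classic x -> setT y -> derivable (f^~ y) x 1.
  by move=> _ _; exact: (@ex_derive _ _ _ _ _ _ _ (fd x y)).
have v20 : 0 < v / 2 by rewrite divr_gt0.
have G0 y : 0 <= (1 + v^-1) * gauss (v / 2) m y.
  rewrite mulr_ge0 ?(ltW (gauss_gt0 _ _ _))// addr_ge0// invr_ge0 ltW//.
have Gi := (has_integralZ (1 + v^-1) (gauss_has_integral m v20)).1.
have Gb x y : `](b - 1), (b + 1)[%classic x -> setT y ->
    `|partial1of2 f x y| <= (1 + v^-1) * gauss (v / 2) m y.
  by move=> _ _; rewrite pE normrN; exact: norm_mul_sin_gauss.
apply: DeriveDef.
  exact: (derivable_under_integral measurableT bI inf df G0 Gi Gb).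
rewrite -derive1E (differentiation_under_integral measurableT bI inf df G0 Gi Gb).
under eq_Rintegral do rewrite pE -mulN1r.
rewrite RintegralZl//; last exact: integrable_mul_sin_gauss.
by rewrite integral_mul_sin_gauss//; ring.
Qed.

Lemma cos_gauss_has_integral v m b c : 0 < v ->
  has_integral (fun x : R => cos (c + b * (x - m)) * gauss v m x)
    (Num.sqrt (2 * pi / v) * cos c * gauss v^-1 0 b).
Proof.
move=> v0; split; first exact: integrable_cos_gauss.
pose J b := \int[mu]_x (cos (c + b * (x - m)) * gauss v m x).
(* Integrating factor: [gauss (- v^-1) 0 b] is [expR (b ^ 2 / (2 v))], so [H] has zero
   derivative. *)
pose H b := J b * gauss (- v^-1) 0 b.
have H' x : is_derive x (1 : R) H 0.
  have h1 := is_derive_integral_cos_gauss m c x v0.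
  have h2 := is_derive_gauss (- v^-1) 0 x.
  rewrite /H; apply: is_derive_eq; rewrite /GRing.scale/=.
  rewrite /J subr0; ring.
have HE : J b * gauss (- v^-1) 0 b = J 0 by
  rewrite -[LHS]/(H b) (is_derive_0_is_cst b 0 H') /H /gauss subr0 expr0n mulr0 oppr0 mul0r expR0 mulr1.
have J0 : J 0 = Num.sqrt (2 * pi / v) * cos c.
  rewrite mulrC -((has_integralZ (cos c) (gauss_has_integral m v0)).2).
  by apply: eq_Rintegral => x _; rewrite mul0r addr0.
rewrite -J0 -HE -mulrA /gauss -expRD (_ : _ + _ = 0) ?expR0 ?mulr1//.
by ring.
Qed.

End GaussianIntegral.

(** * Gaussian-damped chirps and their Fourier transforms *)

Section FourierTransfer.
Variable R : realType.

(** With [S = 1 + tau ^ 2], integrating in [xi] leaves the exponent [- eta ^ 2 / (2 S) - S (a - eta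
    tau / S) ^ 2 / 2]. It equals [- a ^ 2 / 2 - (eta - a tau) ^ 2 / 2], a Gaussian of unit variance
    in [eta], which is what [chirp_outer] integrates. *)
Lemma chirp_inner (be a b tau eta : R) :
  has_integral
    (fun xi => expR (- (xi ^+ 2 + eta ^+ 2) / (2 * (1 + tau ^+ 2))) *
       cos (be + a * xi + b * eta - xi * eta * tau / (1 + tau ^+ 2)))
    (Num.sqrt (2 * pi) * Num.sqrt (1 + tau ^+ 2) * expR (- a ^+ 2 / 2) *
       (cos (be + a * b * tau + b * (eta - a * tau)) * gauss 1 (a * tau) eta)).
Proof.
set S := 1 + tau ^+ 2.
have S0 : 0 < S by rewrite ltr_wpDr// sqr_ge0.
have S1 : S != 0 by rewrite gt_eqF.
have Si : 0 < S^-1 by rewrite invr_gt0.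
have h := has_integralZ (expR (- eta ^+ 2 / (2 * S)))
  (cos_gauss_has_integral 0 (a - eta * tau / S) (be + b * eta) Si).
have -> : Num.sqrt (2 * pi) * Num.sqrt S * expR (- a ^+ 2 / 2) *
       (cos (be + a * b * tau + b * (eta - a * tau)) * gauss 1 (a * tau) eta) =
    expR (- eta ^+ 2 / (2 * S)) * (Num.sqrt (2 * pi / S^-1) * cos (be + b * eta) *
       gauss S^-1^-1 0 (a - eta * tau / S)).
  rewrite invrK (@sqrtrM _ (2 * pi)); last by rewrite mulr_ge0// pi_ge0.
  have -> : be + a * b * tau + b * (eta - a * tau) = be + b * eta by ring.
  rewrite [LHS](_ : _ = Num.sqrt (2 * pi) * Num.sqrt S * cos (be + b * eta) *
    (expR (- a ^+ 2 / 2) * gauss 1 (a * tau) eta)); last by ring.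
  rewrite [RHS](_ : _ = Num.sqrt (2 * pi) * Num.sqrt S * cos (be + b * eta) *
    (expR (- eta ^+ 2 / (2 * S)) * gauss S 0 (a - eta * tau / S))); last by ring.
  congr (_ * _); rewrite /gauss -!expRD; congr expR.
  rewrite (_ : S = 1 + tau ^+ 2)//; field.
  by move: S1; rewrite /S.
apply: (has_integral_ext _ h) => xi.
rewrite mulrCA mulrC; congr (_ * _); last first.
  by congr cos; field.
rewrite /gauss subr0 -expRD; congr expR; field; exact: S1.
Qed.

Lemma chirp_outer (be a b tau : R) :
  has_integral
    (fun eta => cos (be + a * b * tau + b * (eta - a * tau)) * gauss 1 (a * tau) eta)
    (Num.sqrt (2 * pi) * (cos (be + a * b * tau) * expR (- b ^+ 2 / 2))).
Proof.
have := cos_gauss_has_integral (a * tau) b (be + a * b * tau) (@ltr01 R).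
rewrite invr1 mulr1 (_ : gauss 1 0 b = expR (- b ^+ 2 / 2)) ?mulrA//.
by rewrite /gauss subr0 mul1r.
Qed.

Lemma cos_gauss_fourier (c b be : R) : 0 < c ->
  has_integral (fun x => expR (- c * x ^+ 2) * cos (be + b * x))
    (Num.sqrt (pi / c) * expR (- b ^+ 2 / (4 * c)) * cos be).
Proof.
move=> c0.
have c2 : 0 < 2 * c by rewrite mulr_gt0.
have cn : c != 0 by rewrite gt_eqF.
have -> : Num.sqrt (pi / c) * expR (- b ^+ 2 / (4 * c)) * cos be =
  Num.sqrt (2 * pi / (2 * c)) * cos be * gauss (2 * c)^-1 0 b.
  rewrite /gauss subr0 mulrAC; congr (_ * _ * _).
    by congr Num.sqrt; field.
  by congr expR; field.
apply: (has_integral_ext _ (cos_gauss_has_integral 0 b be c2)) => x.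
rewrite subr0 mulrC /gauss subr0; congr (_ * _).
by congr expR; field.
Qed.

Variables (V : finType) (M : V -> R) (A B : nat -> V -> R).
Variables (T : Type) (s : seq T) (g th tau : T -> R).
Variables (c C : R).

Let S k := 1 + tau k ^+ 2.

Definition pair_prod n v v' :=
  \sum_(i < n) (A i v - A i v') * (B i v - B i v').
Definition pair_sq n v v' :=
  \sum_(i < n) ((A i v - A i v') ^+ 2 + (B i v - B i v') ^+ 2).

Lemma pair_prodS n v v' : pair_prod n.+1 v v' =
  pair_prod n v v' + (A n v - A n v') * (B n v - B n v').
Proof. by rewrite /pair_prod big_ord_recr. Qed.

Lemma pair_sqS n v v' : pair_sq n.+1 v v' =
  pair_sq n v v' + ((A n v - A n v') ^+ 2 + (B n v - B n v') ^+ 2).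
Proof. by rewrite /pair_sq big_ord_recr. Qed.

(** [n] pairs of coordinates are still on the physical side. Those already transformed survive
    through the phase [al], the squared length [N] of their frequency, and the value [om] of the
    quadratic form there. The power of [Num.sqrt (S k)] offsets the inverse square root of
    [1 + tau ^ 2] that each remaining pair will contribute. *)
Definition chirp_form n (al : V -> R) (N om : R) :=
  \sum_v \sum_v' M v * M v' * \sum_(k <- s)
    g k * Num.sqrt (S k) ^+ n * expR (- N / (2 * S k)) *
    cos (al v - al v' + th k - om * tau k / S k + tau k * pair_prod n v v') *
    expR (- pair_sq n v v' / 2).

Definition gauss_form n (al : V -> R) :=
  \sum_v \sum_v' M v * M v' * (cos (al v - al v') * expR (- pair_sq n v v' / (4 * c))).

(** Real part of [e^(i x) |sum_v M v e^(i al v)|^2]; the sine part vanishes by antisymmetry in [v]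
    and [v']. *)
Lemma sum_sum_cos (al : V -> R) (x : R) :
  \sum_v \sum_v' M v * M v' * cos (al v - al v' + x) =
  cos x * ((\sum_v M v * cos (al v)) ^+ 2 + (\sum_v M v * sin (al v)) ^+ 2).
Proof.
have sq (f : V -> R) : (\sum_v f v) ^+ 2 = \sum_v \sum_v' f v * f v'.
  by rewrite expr2 mulr_suml; apply: eq_bigr => v _; rewrite mulr_sumr.
have e : \sum_v \sum_v' M v * M v' * sin (al v - al v') = 0.
  set z := LHS; suff : z = - z by lra.
  rewrite {1}/z exchange_big /= /z -sumrN; apply: eq_bigr => v _.
  rewrite -sumrN; apply: eq_bigr => v' _.
  by rewrite -[al v' - al v]opprB sinN; ring.
rewrite !sq -big_split/=.
set Q := (X in _ = cos x * X).
have -> : cos x * Q = cos x * Q - sin x * \sum_v \sum_v' M v * M v' * sin (al v - al v').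
  by rewrite e mulr0 subr0.
rewrite /Q !mulr_sumr -sumrB.
apply: eq_bigr => v _; rewrite -big_split/= !mulr_sumr -sumrB.
by apply: eq_bigr => v' _; rewrite cosD cosB; ring.
Qed.

Hypothesis c0 : 0 < c.
(** The multiplier bound. The constraint on [om] holds for [N = |zeta| ^ 2] and [om = Q(zeta)], and
    adding a pair [(xi, eta)] preserves it because [|2 xi eta| <= xi ^ 2 + eta ^ 2]. *)
Hypothesis coeff_bound : forall N om : R, 0 <= N -> `|2 * om| <= N ->
  `|\sum_(k <- s) g k * expR (- N / (2 * S k)) * cos (th k - om * tau k / S k)|
     <= C * expR (- c * N).

Lemma chirp_form_le0 al N om : 0 <= N -> `|2 * om| <= N ->
  `|chirp_form 0 al N om| <= C * expR (- c * N) * gauss_form 0 al.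
Proof.
move=> N0 omN.
have e0 : pair_prod 0 = fun _ _ => 0.
  by apply/funext => v; apply/funext => v'; rewrite /pair_prod big_ord0.
have e1 : pair_sq 0 = fun _ _ => 0.
  by apply/funext => v; apply/funext => v'; rewrite /pair_sq big_ord0.
set Q := (\sum_v M v * cos (al v)) ^+ 2 + (\sum_v M v * sin (al v)) ^+ 2.
have -> : gauss_form 0 al = Q.
  rewrite /gauss_form e1; have := sum_sum_cos al 0; rewrite cos0 mul1r -/Q => <-.
  by apply: eq_bigr => v _; apply: eq_bigr => v' _; rewrite addr0 oppr0 mul0r expR0 mulr1.
have -> : chirp_form 0 al N om =
  (\sum_(k <- s) g k * expR (- N / (2 * S k)) * cos (th k - om * tau k / S k)) * Q.
  rewrite /chirp_form e0 e1 mulr_suml.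
  transitivity (\sum_(k <- s) \sum_v \sum_v' M v * M v' *
     (g k * expR (- N / (2 * S k))) * cos (al v - al v' + (th k - om * tau k / S k))).
    rewrite [RHS]exchange_big /=; apply: eq_bigr => v _.
    rewrite [RHS]exchange_big /=; apply: eq_bigr => v' _.
    rewrite mulr_sumr; apply: eq_bigr => k _.
    by rewrite mulr0 addr0 expr0 mulr1 oppr0 mul0r expR0 mulr1 !mulrA !addrA.
  apply: eq_bigr => k _; rewrite /Q -[RHS]mulrA -sum_sum_cos mulr_sumr.
  apply: eq_bigr => v _; rewrite mulr_sumr.
  by apply: eq_bigr => v' _; ring.
rewrite normrM (@ger0_norm _ Q) ?addr_ge0 ?sqr_ge0//.
by rewrite ler_wpM2r ?addr_ge0 ?sqr_ge0// coeff_bound.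
Qed.

(** Up to the factor [2 pi], both sides for [n.+1] are integrals over [(xi, eta)] of the sides for
    [n], so the inequality integrates. At [n = 0] the form is the multiplier times a squared
    modulus. Each pair of Gaussian integrals gives [pi / c], hence [(2 * c)^-1] after division by
    [2 pi]. *)
Lemma chirp_form_le n al N om : 0 <= N -> `|2 * om| <= N ->
  `|chirp_form n al N om| <=
    C * expR (- c * N) * (2 * c)^-1 ^+ n * gauss_form n al.
Proof.
elim: n => [|n IH] in al N om *; first by rewrite expr0 mulr1; exact: chirp_form_le0.
move=> N0 omN.
pose r := Num.sqrt (2 * pi : R).
have rr : r * r = 2 * pi by rewrite -expr2 sqr_sqrtr// mulr_ge0// pi_ge0.
pose q := Num.sqrt (pi / c).
have qq : q * q = pi / c by rewrite -expr2 sqr_sqrtr// divr_ge0// ?pi_ge0 ?ltW.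
pose F eta xi := chirp_form n (fun v => al v + A n v * xi + B n v * eta)
   (N + (xi ^+ 2 + eta ^+ 2)) (om + xi * eta).
pose G eta xi := C * expR (- c * (N + (xi ^+ 2 + eta ^+ 2))) * (2 * c)^-1 ^+ n *
   gauss_form n (fun v => al v + A n v * xi + B n v * eta).
have FG eta xi : `|F eta xi| <= G eta xi.
  apply: IH; first by rewrite addr_ge0// addr_ge0 ?sqr_ge0.
  rewrite mulrDr (le_trans (ler_normD _ _))// lerD// ler_norml.
  have := sqr_ge0 (xi + eta); have := sqr_ge0 (xi - eta); nra.
pose be v v' k := al v - al v' + th k - om * tau k / S k + tau k * pair_prod n v v'.
pose F1 eta := \sum_v \sum_v' M v * M v' * \sum_(k <- s)
    (g k * Num.sqrt (S k) ^+ n * expR (- N / (2 * S k)) * expR (- pair_sq n v v' / 2)) *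
    (r * Num.sqrt (S k) * expR (- (A n v - A n v') ^+ 2 / 2) *
      (cos (be v v' k + (A n v - A n v') * (B n v - B n v') * tau k +
         (B n v - B n v') * (eta - (A n v - A n v') * tau k)) *
       gauss 1 ((A n v - A n v') * tau k) eta)).
have IF1 eta : has_integral (F eta) (F1 eta).
  apply: has_integral_sum => v; apply: has_integral_sum => v'.
  apply: has_integralZ; apply: has_integral_sum => k.
  apply: (has_integral_ext _ (has_integralZ _ (chirp_inner (be v v' k) (A n v - A n v') (B n v - B n v') (tau k) eta))) => xi.
  rewrite (_ : expR (- (N + (xi ^+ 2 + eta ^+ 2)) / (2 * S k)) =
    expR (- N / (2 * S k)) * expR (- (xi ^+ 2 + eta ^+ 2) / (2 * (1 + tau k ^+ 2)))); last first.
    by rewrite -expRD; congr expR; rewrite opprD mulrDl.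
  set X := cos _; set Y := cos _.
  have -> : X = Y by rewrite /X /Y /be; congr cos; rewrite /S; ring.
  ring.
have IF : has_integral F1 (2 * pi * chirp_form n.+1 al N om).
  rewrite -rr /chirp_form mulr_sumr.
  apply: has_integral_sum => v; rewrite mulr_sumr.
  apply: has_integral_sum => v'; rewrite mulrCA.
  apply: has_integralZ; rewrite mulr_sumr; apply: has_integral_sum => k.
  have h := has_integralZ (g k * Num.sqrt (S k) ^+ n * expR (- N / (2 * S k)) * expR (- pair_sq n v v' / 2) * (r * Num.sqrt (S k) * expR (- (A n v - A n v') ^+ 2 / 2))) (chirp_outer (be v v' k) (A n v - A n v') (B n v - B n v') (tau k)).
  rewrite (_ : r * r * _ = (g k * Num.sqrt (S k) ^+ n * expR (- N / (2 * S k)) * expR (- pair_sq n v v' / 2) * (r * Num.sqrt (S k) * expR (- (A n v - A n v') ^+ 2 / 2))) *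
    (r * (cos (be v v' k + (A n v - A n v') * (B n v - B n v') * tau k) * expR (- (B n v - B n v') ^+ 2 / 2)))).
    apply: (has_integral_ext _ h) => eta; ring.
  rewrite pair_sqS pair_prodS.
  rewrite (_ : expR (- (pair_sq n v v' + ((A n v - A n v') ^+ 2 + (B n v - B n v') ^+ 2)) / 2) = expR (- pair_sq n v v' / 2) * (expR (- (A n v - A n v') ^+ 2 / 2) * expR (- (B n v - B n v') ^+ 2 / 2))); last first.
    by rewrite -!expRD; congr expR; ring.
  set X := cos _; set Y := cos _.
  have -> : X = Y by rewrite /X /Y /be; congr cos; ring.
  rewrite exprS; ring.
pose G1 eta := C * expR (- c * (N + eta ^+ 2)) * (2 * c)^-1 ^+ n * q *
   (\sum_v \sum_v' M v * M v' * (cos (al v - al v' + (B n v - B n v') * eta) *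
     (expR (- (A n v - A n v') ^+ 2 / (4 * c)) * expR (- pair_sq n v v' / (4 * c))))).
have IG1 eta : has_integral (G eta) (G1 eta).
  pose K := C * expR (- c * (N + eta ^+ 2)) * (2 * c)^-1 ^+ n.
  have h : has_integral (fun xi => \sum_v \sum_v' M v * M v' * expR (- pair_sq n v v' / (4 * c)) * (expR (- c * xi ^+ 2) * cos (al v - al v' + (B n v - B n v') * eta + (A n v - A n v') * xi)))
     (\sum_v \sum_v' M v * M v' * expR (- pair_sq n v v' / (4 * c)) * (q * expR (- (A n v - A n v') ^+ 2 / (4 * c)) * cos (al v - al v' + (B n v - B n v') * eta))).
    apply: has_integral_sum => v; apply: has_integral_sum => v'.
    by apply: has_integralZ; exact: cos_gauss_fourier.
  rewrite (_ : G1 eta = K * (\sum_v \sum_v' M v * M v' * expR (- pair_sq n v v' / (4 * c)) * (q * expR (- (A n v - A n v') ^+ 2 / (4 * c)) * cos (al v - al v' + (B n v - B n v') * eta)))); last first.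
    rewrite /G1 /K -[LHS]mulrA; congr (_ * _); rewrite mulr_sumr; apply: eq_bigr => v _.
    by rewrite mulr_sumr; apply: eq_bigr => v' _; ring.
  apply: (has_integral_ext _ (has_integralZ K h)) => xi.
  transitivity (K * (expR (- c * xi ^+ 2) * gauss_form n (fun v => al v + A n v * xi + B n v * eta))); last first.
    rewrite /G /K (_ : - c * (N + (xi ^+ 2 + eta ^+ 2)) = - c * (N + eta ^+ 2) + - c * xi ^+ 2); last by ring.
    by rewrite expRD; ring.
  rewrite /gauss_form; congr (_ * _).
  rewrite mulr_sumr; apply: eq_bigr => v _.
  rewrite mulr_sumr; apply: eq_bigr => v' _.
  set X := cos _; set Y := cos _.
  have -> : X = Y by rewrite /X /Y; congr cos; ring.
  ring.
have IG : has_integral G1 (2 * pi * (C * expR (- c * N) * (2 * c)^-1 ^+ n.+1 * gauss_form n.+1 al)).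
  pose K := C * expR (- c * N) * (2 * c)^-1 ^+ n * q.
  have h : has_integral (fun eta => \sum_v \sum_v' M v * M v' * (expR (- (A n v - A n v') ^+ 2 / (4 * c)) * expR (- pair_sq n v v' / (4 * c))) * (expR (- c * eta ^+ 2) * cos (al v - al v' + (B n v - B n v') * eta)))
     (\sum_v \sum_v' M v * M v' * (expR (- (A n v - A n v') ^+ 2 / (4 * c)) * expR (- pair_sq n v v' / (4 * c))) * (q * expR (- (B n v - B n v') ^+ 2 / (4 * c)) * cos (al v - al v'))).
    apply: has_integral_sum => v; apply: has_integral_sum => v'.
    by apply: has_integralZ; exact: cos_gauss_fourier.
  rewrite (_ : 2 * pi * _ = K * (\sum_v \sum_v' M v * M v' * (expR (- (A n v - A n v') ^+ 2 / (4 * c)) * expR (- pair_sq n v v' / (4 * c))) * (q * expR (- (B n v - B n v') ^+ 2 / (4 * c)) * cos (al v - al v')))); last first.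
    rewrite (_ : 2 * pi * _ = C * expR (- c * N) * (2 * c)^-1 ^+ n * ((q * q) * gauss_form n.+1 al)); last first.
      by rewrite qq exprS; field; rewrite gt_eqF.
    rewrite /K -[RHS]mulrA; congr (_ * _); rewrite -mulrA; congr (_ * _).
    rewrite mulr_sumr; apply: eq_bigr => v _.
    rewrite mulr_sumr; apply: eq_bigr => v' _.
    rewrite pair_sqS.
    rewrite (_ : expR _ = expR (- pair_sq n v v' / (4 * c)) * (expR (- (A n v - A n v') ^+ 2 / (4 * c)) * expR (- (B n v - B n v') ^+ 2 / (4 * c)))); last first.
      by rewrite -!expRD; congr expR; ring.
    ring.
  apply: (has_integral_ext _ (has_integralZ K h)) => eta.
  rewrite /G1 /K mulrDr expRD.
  transitivity (C * expR (- c * N) * (2 * c)^-1 ^+ n * q * (expR (- c * eta ^+ 2) * (\sum_v \sum_v' M v * M v' * (cos (al v - al v' + (B n v - B n v') * eta) *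
     (expR (- (A n v - A n v') ^+ 2 / (4 * c)) * expR (- pair_sq n v v' / (4 * c))))))); last by ring.
  congr (_ * _).
  rewrite mulr_sumr; apply: eq_bigr => v _.
  rewrite mulr_sumr; apply: eq_bigr => v' _.
  ring.
have FG1 eta : `|F1 eta| <= G1 eta.
  exact: (has_integral_le_norm (IF1 eta) (IG1 eta) (FG eta)).
have := has_integral_le_norm IF IG FG1.
have p2 : 0 < 2 * pi :> R by rewrite mulr_gt0// pi_gt0.
by rewrite normrM (gtr0_norm p2) ler_pM2l.
Qed.

End FourierTransfer.

(** * Van der Corput estimates for exponential sums *)

Section VanDerCorput.
Variable R : realType.
Implicit Types (x a : nat -> R) (B : R).

(** All blocks inside [[m, n)] are bounded, not only the full sum, so that the property survives
    restriction and Abel summation. *)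
Definition sums_le x (m n : nat) B :=
  forall l1 l2 : nat, (m <= l1)%N -> (l1 <= l2)%N -> (l2 <= n)%N ->
    `|\sum_(l1 <= k < l2) x k| <= B.

(** Abel summation: in [H] each step is charged [a k - a k.+1] times [B], and the charges
    telescope. *)
Lemma sums_le_decr x a m n B C : sums_le x m n B -> 0 <= C ->
  (forall k, (m <= k < n)%N -> 0 <= a k <= C) ->
  (forall k, (m <= k)%N -> (k.+1 < n)%N -> a k.+1 <= a k) ->
  sums_le (fun k => a k * x k) m n (C * B).
Proof.
move=> xB C0 aC adecr l1 l2 ml1 l12 l2n.
have B0 : 0 <= B by apply: le_trans (xB m m _ _ _) => //; lia.
have H l : (l1 + l < l2)%N ->
    `|\sum_(l1 <= k < (l1 + l).+1) a k * x k -
      a (l1 + l)%N * \sum_(l1 <= k < (l1 + l).+1) x k| <= (a l1 - a (l1 + l)%N) * B.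
  elim: l => [|l IH] h.
    by rewrite addn0 !big_nat1 subrr normr0 subrr mul0r.
  have {}IH := IH ltac:(lia).
  rewrite addnS !(@big_nat_recr _ _ _ (l1 + l).+1) /=; [|lia|lia].
  set X := \sum_(_ <= _ < _) x _ in IH *; set Y := \sum_(_ <= _ < _) _ in IH *.
  have -> : Y + a (l1 + l).+1 * x (l1 + l).+1 - a (l1 + l).+1 * (X + x (l1 + l).+1) =
     (Y - a (l1 + l)%N * X) + (a (l1 + l)%N - a (l1 + l).+1) * X by ring.
  apply: le_trans (ler_normD _ _) _.
  have d0 : 0 <= a (l1 + l)%N - a (l1 + l).+1 by rewrite subr_ge0 adecr//; lia.
  rewrite normrM (ger0_norm d0).
  have hX : `|X| <= B by apply: xB; lia.
  have := ler_wpM2l d0 hX; lra.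
have [->|l1n] := eqVneq l1 l2.
  by rewrite big_geq// normr0 mulr_ge0.
have := H (l2 - l1.+1)%N ltac:(lia).
rewrite (_ : (l1 + (l2 - l1.+1)).+1 = l2); last by lia.
set l := (l1 + _)%N => hl.
have hX : `|\sum_(l1 <= k < l2) x k| <= B by apply: xB.
have /andP[al0 alC] : 0 <= a l <= C by apply: aC; lia.
have /andP[al10 al1C] : 0 <= a l1 <= C by apply: aC; lia.
move: hl hX; set X := \sum_(_ <= _ < _) x _; set Y := \sum_(_ <= _ < _) _ => hl hX.
have -> : Y = (Y - a l * X) + a l * X by ring.
apply: le_trans (ler_normD _ _) _; rewrite normrM (ger0_norm al0).
have := ler_wpM2l al0 hX; have := ler_wpM2r B0 al1C; lra.
Qed.

Lemma sums_leZ x m n B C : sums_le x m n B -> 0 <= C ->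
  sums_le (fun k => C * x k) m n (C * B).
Proof.
move=> xB C0 l1 l2 *; rewrite -mulr_sumr normrM (ger0_norm C0) ler_wpM2l//.
exact: xB.
Qed.

Lemma sums_leB x y m n B C : sums_le x m n B -> sums_le y m n C ->
  sums_le (fun k => x k - y k) m n (B + C).
Proof.
move=> xB yC l1 l2 h1 h2 h3; rewrite sumrB (le_trans (ler_normB _ _))//.
by rewrite lerD ?xB ?yC.
Qed.

Lemma sums_le_ext x y m n B : (forall k, (m <= k < n)%N -> x k = y k) ->
  sums_le x m n B -> sums_le y m n B.
Proof.
move=> xy xB l1 l2 h1 h2 h3; rewrite -(@eq_big_nat _ _ _ _ _ x).
  exact: xB.
by move=> k h; apply: xy; lia.
Qed.

Lemma sums_leW x m n B C : B <= C -> sums_le x m n B -> sums_le x m n C.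
Proof. by move=> BC xB l1 l2 *; apply: le_trans BC; exact: xB. Qed.

Lemma sums_le_sub x m n m' n' B : (m <= m')%N -> (n' <= n)%N ->
  sums_le x m n B -> sums_le x m' n' B.
Proof. by move=> mm nn xB l1 l2 *; apply: xB; lia. Qed.

(** [a] is the constant [C] minus the decreasing weight [C - a]; hence the factor 2. *)
Lemma sums_le_incr x a m n B C : sums_le x m n B -> 0 <= C ->
  (forall k, (m <= k < n)%N -> 0 <= a k <= C) ->
  (forall k, (m <= k)%N -> (k.+1 < n)%N -> a k <= a k.+1) ->
  sums_le (fun k => a k * x k) m n (2 * C * B).
Proof.
move=> xB C0 aC aincr.
have h1 : sums_le (fun k => (C - a k) * x k) m n (C * B).
  apply: sums_le_decr => // k.
    by move=> /aC; lra.
  by move=> h1 h2; have := aincr k h1 h2; lra.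
have := sums_leB (sums_leZ xB C0) h1.
rewrite (_ : C * B + C * B = 2 * C * B); last by ring.
by apply: sums_le_ext => k _; ring.
Qed.

Lemma sums_le_cat x m n l B C : (m <= l <= n)%N ->
  sums_le x m l B -> sums_le x l n C -> sums_le x m n (B + C).
Proof.
move=> /andP[ml ln] xB xC l1 l2 h1 h2 h3.
have B0 : 0 <= B by apply: le_trans (xB m m _ _ _) => //; lia.
have C0 : 0 <= C by apply: le_trans (xC l l _ _ _) => //; lia.
have [h|h] := leqP l2 l; first by have := xB l1 l2 h1 h2 h; lra.
have [h'|h'] := leqP l l1; first by have := xC l1 l2 h' h2 h3; lra.
rewrite (@big_cat_nat _ _ _ l)//=; try lia.
by apply: le_trans (ler_normD _ _) _; apply: lerD; [apply: xB|apply: xC]; lia.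
Qed.

Lemma sin_ge_cos1 (x : R) : 0 <= x <= 1 -> cos 1 * x <= sin x.
Proof.
move=> /andP[x0 x1]; move: x0; rewrite le_eqVlt => /predU1P[<-|x0].
  by rewrite mulr0 sin0.
have [c] := MVT x0 (fun y _ => is_derive_sin y)
  (continuous_subspaceT (fun y => @continuous_sin R y)).
rewrite in_itv/= sin0 !subr0 => /andP[c0 cx] ->.
have p2 := pi_ge2 R.
rewrite ler_wpM2r ?(ltW x0)// ltW// ltr_cos ?in_itv/=; lra.
Qed.

Definition cot_half (x : R) := cos (x / 2) / sin (x / 2).

(** With [u = w - dl] and [v = w + dl] this is the expansion of [cos (w - dl)]: the half differences
    are [sin w sin dl] and [cos w sin dl], and the cotangent turns the second one into
    [cos w cos dl]. *)
Lemma cos_cot_half (u v : R) : sin ((v - u) / 2) != 0 ->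
  cos u = 2^-1 * (cos u - cos v) + 2^-1 * (cot_half (v - u) * (sin v - sin u)).
Proof.
move=> h; rewrite /cot_half; set dl := (v - u) / 2 in h *; pose w := (u + v) / 2.
have -> : u = w - dl by rewrite /w /dl; lra.
have -> : v = w + dl by rewrite /w /dl; lra.
rewrite !sinD !cosD !sinN !cosN; field; exact: h.
Qed.

Lemma sin_half_gt0 (x : R) : 0 < x <= 1 -> 0 < sin (x / 2).
Proof.
move=> h; apply: lt_le_trans (sin_ge_cos1 _); last by lra.
by rewrite mulr_gt0 ?cos1_gt0//; lra.
Qed.

Lemma cos_half_ge0 (x : R) : 0 < x <= 1 -> 0 <= cos (x / 2).
Proof.
move=> h; apply: le_trans (ltW (cos1_gt0 R)) _.
have p2 := pi_ge2 R.
by rewrite ltW// ltr_cos ?in_itv/=; lra.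
Qed.

Lemma cot_half_anti (x y : R) : 0 < x -> x <= y -> y <= 1 ->
  cot_half y <= cot_half x.
Proof.
move=> x0 xy y1; have p2 := pi_ge2 R.
have sx : 0 < sin (x / 2) by apply: sin_half_gt0; lra.
have sy : 0 < sin (y / 2) by apply: sin_half_gt0; lra.
have cy : 0 <= cos (y / 2) by apply: cos_half_ge0; lra.
have cc : cos (y / 2) <= cos (x / 2).
  move: xy; rewrite le_eqVlt => /predU1P[->//|xy].
  by rewrite ltW// ltr_cos ?in_itv/=; lra.
have ss : sin (x / 2) <= sin (y / 2).
  move: xy; rewrite le_eqVlt => /predU1P[->//|xy].
  by rewrite ltW// ltr_sin ?in_itv/=; lra.
rewrite /cot_half ler_pM ?invr_ge0 ?(ltW sy)//.
by rewrite lef_pV2 ?posrE.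
Qed.

Lemma cot_half_le (x : R) : 0 < x <= 1 -> 0 <= cot_half x <= 2 / (cos 1 * x).
Proof.
move=> h; have c1 := cos1_gt0 R.
have sx := sin_half_gt0 h; have cx := cos_half_ge0 h.
rewrite /cot_half divr_ge0 ?(ltW sx)//=.
rewrite ler_pdivrMr//.
have := @sin_ge_cos1 (x / 2) ltac:(lra) => hs.
apply: le_trans (cos_le1 _) _.
rewrite mulrAC ler_pdivlMr ?mulr_gt0//; lra.
Qed.

Lemma sums_le_telescope x m n B : (forall k, `|x k| <= B) ->
  sums_le (fun k => x k.+1 - x k) m n (2 * B).
Proof.
move=> xB l1 l2 h1 h2 h3; rewrite telescope_sumr//.
apply: le_trans (ler_normB _ _) _; have := xB l1; have := xB l2; lra.
Qed.

(* [cos_cot_half] turns the sum into one of monotone weights times telescoping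
   differences. *)
Lemma kusmin_landau (phi : nat -> R) (m n : nat) (lam : R) :
  0 < lam ->
  (forall k, (m <= k < n)%N -> lam <= phi k.+1 - phi k <= 1) ->
  (forall k, (m <= k)%N -> (k.+1 < n)%N ->
     phi k.+1 - phi k <= phi k.+2 - phi k.+1) \/
  (forall k, (m <= k)%N -> (k.+1 < n)%N ->
     phi k.+2 - phi k.+1 <= phi k.+1 - phi k) ->
  sums_le (fun k => cos (phi k)) m n (5 / (cos 1 * lam)).
Proof.
move=> lam0 hphi mono; have c1 := cos1_gt0 R.
have c11 : cos 1 <= 1 :> R by exact: cos_le1.
have [nm|mn] := leqP n m.
  move=> l1 l2 *; rewrite big_geq ?normr0 ?divr_ge0 ?mulr_ge0 ?ltW//; lia.
have lam1 : lam <= 1 by have := hphi m ltac:(lia); lra.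
have Q0 : 0 <= 2 / (cos 1 * lam) by rewrite divr_ge0// ltW// mulr_gt0.
pose a k := cot_half (phi k.+1 - phi k).
have aQ k : (m <= k < n)%N -> 0 <= a k <= 2 / (cos 1 * lam).
  move=> /hphi h; have := @cot_half_le (phi k.+1 - phi k) ltac:(lra).
  move=> /andP[-> h2] /=; apply: le_trans h2 _.
  rewrite ler_wpM2l// lef_pV2 ?posrE ?mulr_gt0//; last by lra.
  by rewrite ler_wpM2l ?(ltW c1)//; lra.
have s1 : sums_le (fun k => sin (phi k.+1) - sin (phi k)) m n (2 * 1).
  by apply: (@sums_le_telescope (fun k => sin (phi k))) => k; exact: sin_max.
have s2 : sums_le (fun k => cos (phi k.+1) - cos (phi k)) m n (2 * 1).
  by apply: (@sums_le_telescope (fun k => cos (phi k))) => k; exact: cos_max.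
have s3 : sums_le (fun k => a k * (sin (phi k.+1) - sin (phi k))) m n
    (2 * (2 / (cos 1 * lam)) * (2 * 1)).
  case: mono => mono; last first.
    apply: sums_le_incr => // k h1 h2; apply: cot_half_anti; last 2 first.
    - exact: mono.
    - by have := hphi k ltac:(lia); lra.
    - by have := hphi k.+1 ltac:(lia); lra.
  apply: (@sums_leW _ _ _ (2 / (cos 1 * lam) * (2 * 1))); first by lra.
  apply: sums_le_decr => // k h1 h2; apply: cot_half_anti; last 2 first.
  - exact: mono.
  - by have := hphi k.+1 ltac:(lia); lra.
  - by have := hphi k ltac:(lia); lra.
have half : 0 <= 2^-1 :> R by [].
(* The weighted sine differences cost [4 / (cos 1 * lam)], the cosine differences cost
   [1 <= 1 / (cos 1 * lam)]; together 5. *)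
have := sums_leB (sums_leZ s3 half) (sums_leZ s2 half).
move=> /(@sums_le_ext _ (fun k => cos (phi k))) h.
apply: sums_leW (h _).
  have q1 : 1 <= 1 / (cos 1 * lam).
    rewrite ler_pdivlMr ?mulr_gt0// mul1r -[leRHS]mul1r; apply: ler_pM => //; exact: ltW.
  move: q1; set q := 1 / _; have -> : 2 / (cos 1 * lam) = 2 * q by rewrite /q mul1r.
  have -> : 5 / (cos 1 * lam) = 5 * q by rewrite /q mul1r.
  lra.
move=> k hk; rewrite [RHS](@cos_cot_half (phi k) (phi k.+1)).
  by rewrite -/(a k); ring.
by rewrite gt_eqF// sin_half_gt0//; have := hphi k hk; lra.
Qed.

Lemma increasing_cut (f : nat -> R) (m n : nat) (t : R) : (m <= n)%N ->
  (forall k, (m <= k)%N -> (k.+1 < n)%N -> f k <= f k.+1) ->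
  exists2 l, (m <= l <= n)%N & (forall k, (m <= k < l)%N -> f k < t) /\
    (forall k, (l <= k < n)%N -> t <= f k).
Proof.
move=> mn fm; elim: n mn fm => [|n IH] mn fm.
  by exists m; [lia|split => k; lia].
have [->|mn'] := eqVneq m n.+1.
  by exists n.+1; [lia|split => k; lia].
have [|l ml [h1 h2]] := IH ltac:(lia); first by move=> k *; apply: fm; lia.
have [ft|ft] := ltP (f n) t; last first.
  have [e|e] := eqVneq l n.
    exists n; first by lia.
    split => k hk; first by apply: h1; lia.
    by have -> : k = n by lia.
  exists l; first by lia.
  split => // k hk.
  have [->|kn] := eqVneq k n; first exact: ft.
  by apply: h2; lia.
exists n.+1; first by lia.
split => k hk; last by lia.
have [->//|kn] := eqVneq k n.
apply: le_lt_trans ft.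
have {kn} : (k < n)%N by lia.
move: hk => /andP[mk _] kn.
have -> : n = (k + (n - k))%N by lia.
have : (k + (n - k) <= n)%N by lia.
elim: (n - k)%N => [|j IHj] hj; first by rewrite addn0.
by rewrite addnS; apply: le_trans (IHj _) (fm _ _ _); lia.
Qed.

Lemma increasing_gap (f : nat -> R) (m n : nat) (sg : R) :
  (forall k, (m <= k)%N -> (k.+1 < n)%N -> sg <= f k.+1 - f k) ->
  forall j, (m + j < n)%N -> j%:R * sg <= f (m + j)%N - f m.
Proof.
move=> h; elim => [|j IH] hj; first by rewrite mul0r addn0 subrr.
have := IH ltac:(lia); have := h (m + j)%N ltac:(lia) ltac:(lia).
by rewrite addnS -natr1 mulrDl mul1r; lra.
Qed.

(** Where the increments are below [- lam] or at least [lam], Kusmin-Landau costs 5 on each side.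
    They grow by at least [sg] per step, so the block in between has at most [2 * lam / sg + 1]
    terms. The choice [lam ^ 2 = sg] balances the two costs: the block has at most [3 / lam] terms,
    and [13 = 5 + 3 + 5]. *)
Lemma van_der_corput_incr (phi : nat -> R) (m n : nat) (sg : R) :
  0 < sg <= 1 ->
  (forall k, (m <= k < n)%N -> `|phi k.+1 - phi k| <= 1) ->
  (forall k, (m <= k)%N -> (k.+1 < n)%N ->
     sg <= (phi k.+2 - phi k.+1) - (phi k.+1 - phi k)) ->
  sums_le (fun k => cos (phi k)) m n (13 / (cos 1 * Num.sqrt sg)).
Proof.
move=> /andP[sg0 sg1] hphi gap; have c1 := cos1_gt0 R.
have c11 : cos 1 <= 1 :> R by exact: cos_le1.
pose lam := Num.sqrt sg.
have lam0 : 0 < lam by rewrite sqrtr_gt0.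
have lamE : lam ^+ 2 = sg by rewrite sqr_sqrtr// ltW.
have lam1 : lam <= 1 by rewrite -(@sqrtr1 R) ler_wsqrtr.
have cl : 0 < cos 1 * lam by rewrite mulr_gt0.
have [nm|mn] := ltnP n m.
  by move=> l1 l2 *; rewrite big_geq ?normr0 ?divr_ge0 ?(ltW cl)//; lia.
pose D k := phi k.+1 - phi k.
have Dmono k : (m <= k)%N -> (k.+1 < n)%N -> D k <= D k.+1.
  by move=> h1 h2; have := gap k h1 h2; rewrite /D; lra.
have [i mi [i1 i2]] := increasing_cut (- lam) mn Dmono.
have Dmono' k : (i <= k)%N -> (k.+1 < n)%N -> D k <= D k.+1.
  by move=> h1 h2; apply: Dmono => //; lia.
have [j ij [j1 j2]] := increasing_cut lam (proj2 (andP mi)) Dmono'.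
have s1 : sums_le (fun k => cos (phi k)) m i (5 / (cos 1 * lam)).
  apply: (@sums_le_ext (fun k => cos (- phi k))); first by move=> k _; rewrite cosN.
  apply: kusmin_landau => //.
  - move=> k hk; have := i1 k hk; have := hphi k ltac:(lia).
    by rewrite ler_norml /D; lra.
  - right => k h1 h2; have := Dmono k h1 ltac:(lia); rewrite /D; lra.
have s3 : sums_le (fun k => cos (phi k)) j n (5 / (cos 1 * lam)).
  apply: kusmin_landau => //.
  - move=> k hk; have := j2 k hk; have := hphi k ltac:(lia).
    by rewrite ler_norml /D; lra.
  - left => k h1 h2; have := Dmono k ltac:(lia) h2; rewrite /D; lra.
have s2 : sums_le (fun k => cos (phi k)) i j (3 / (cos 1 * lam)).
  move=> l1 l2 h1 h2 h3.
  apply: le_trans (ler_norm_sum _ _ _) _.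
  apply: (@le_trans _ _ (\sum_(l1 <= k < l2) 1)).
    by apply: ler_sum => k _; exact: cos_max.
  rewrite sumr_const_nat.
  have lV : 1 <= lam^-1 by rewrite invf_ge1.
  apply: (@le_trans _ _ (3 * lam^-1)); last first.
    rewrite ler_wpM2l// lef_pV2 ?posrE//.
    by rewrite ler_piMl// ltW.
  have [e|ne] := eqVneq l1 l2; first by rewrite e subnn mulr0n; lra.
  have hg k : (l1 <= k)%N -> (k.+1 < n)%N -> sg <= D k.+1 - D k.
    by move=> l1k kn; apply: gap => //; clear -mi h1 l1k; lia.
  have g := increasing_gap hg (j := (l2.-1 - l1)%N) ltac:(clear -h2 h3 ij ne; lia).
  rewrite (_ : (l1 + (l2.-1 - l1))%N = l2.-1) in g; last by clear -h2 ne; lia.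
  have g1 := j1 l2.-1 ltac:(clear -h1 h2 h3 ne; lia).
  have g2 := i2 l1 ltac:(clear -h1 h2 h3 ij ne; lia).
  have -> : (l2 - l1)%N = (l2.-1 - l1).+1 by clear -h2 ne; lia.
  rewrite -natr1.
  set z : R := (l2.-1 - l1)%:R in g *.
  suff : z <= 2 * lam^-1 by lra.
  have zl : z * lam * lam <= 2 * lam by rewrite -mulrA -expr2 lamE; lra.
  rewrite ler_pdivlMr//.
  by rewrite -(ler_pM2r lam0).
have := sums_le_cat mi s1 (sums_le_cat ij s2 s3).
apply: sums_leW; rewrite -!mulrDl ler_wpM2r ?invr_ge0 ?(ltW cl)//; lra.
Qed.

Lemma van_der_corput (phi : nat -> R) (m n : nat) (sg : R) :
  0 < sg <= 1 ->
  (forall k, (m <= k < n)%N -> `|phi k.+1 - phi k| <= 1) ->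
  (forall k, (m <= k)%N -> (k.+1 < n)%N ->
     sg <= (phi k.+2 - phi k.+1) - (phi k.+1 - phi k)) \/
  (forall k, (m <= k)%N -> (k.+1 < n)%N ->
     (phi k.+2 - phi k.+1) - (phi k.+1 - phi k) <= - sg) ->
  sums_le (fun k => cos (phi k)) m n (13 / (cos 1 * Num.sqrt sg)).
Proof.
move=> sg01 hphi [gap|gap]; first exact: van_der_corput_incr.
apply: (@sums_le_ext (fun k => cos (- phi k))); first by move=> k _; rewrite cosN.
apply: van_der_corput_incr => //.
- by move=> k /hphi; rewrite -normrN opprD !opprK.
- by move=> k h1 h2; have := gap k h1 h2; lra.
Qed.

End VanDerCorput.

(** * Oscillation of the transformed chirp *)

Section ChirpCoefficient.
Variable R : realType.
Implicit Types (x h y p om N : R).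

(** Up to sign, [om * psi tau] is the phase of the transformed chirp at a frequency where the form
    takes the value [om]. *)
Definition psi x := x / (1 + x ^+ 2).

Lemma oneDsqr_gt0 x : 0 < 1 + x ^+ 2.
Proof. by rewrite ltr_wpDr// sqr_ge0. Qed.

Lemma psi_diff_le x h : 1 <= x -> 0 < h -> 0 <= psi x - psi (x + h) <= h / x ^+ 2.
Proof.
move=> x1 h0; set y := x + h.
have X0 := oneDsqr_gt0 x; have Y0 := oneDsqr_gt0 y.
have xy : x <= y by rewrite /y; lra.
have x2 : 0 < x ^+ 2 by rewrite exprn_gt0//; lra.
have -> : psi x - psi y = h * ((x * y - 1) / ((1 + x ^+ 2) * (1 + y ^+ 2))).
  have -> : h = y - x by rewrite /y; ring.
  by rewrite /psi; field; rewrite !gt_eqF.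
have xy1 : 1 <= x * y by rewrite -[1]mulr1 ler_pM//; lra.
apply/andP; split.
  by rewrite mulr_ge0 ?(ltW h0)// divr_ge0 ?subr_ge0// ltW// mulr_gt0.
rewrite ler_wpM2l ?(ltW h0)//.
rewrite ler_pdivrMr ?mulr_gt0// [leRHS]mulrC ler_pdivlMr//.
have : x * y * x ^+ 2 <= y ^+ 2 * x ^+ 2.
  by rewrite ler_wpM2r ?(ltW x2)// expr2 ler_wpM2r//; lra.
have := sqr_ge0 y.
set A := x ^+ 2 in x2 *; set B := y ^+ 2 => B0; nra.
Qed.

(** [psi] behaves like [1 / y], whose second derivative is [2 / y ^ 3]; the range [4 <= y] keeps
    clear of the inflection point at the square root of 3. *)
Lemma psi_second_diff_ge y h : 4 <= y -> 0 < h <= 1 ->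
  h ^+ 2 / (8 * y ^+ 3) <= psi (y - h) - 2 * psi y + psi (y + h).
Proof.
move=> y4 /andP[h0 h1].
have X0 := oneDsqr_gt0 (y - h); have Y0 := oneDsqr_gt0 y; have Z0 := oneDsqr_gt0 (y + h).
have y0 : 0 < y by lra.
have h2 : 0 < h ^+ 2 by rewrite exprn_gt0.
have h21 : h ^+ 2 <= 1 by rewrite expr_le1// ltW.
have y16 : 16 <= y ^+ 2 by have := ler_pM (ler0n R 4) (ler0n R 4) y4 y4; rewrite -expr2; lra.
have -> : psi (y - h) - 2 * psi y + psi (y + h) =
  h ^+ 2 * (2 * y * (y ^+ 2 - 3 - h ^+ 2) /
   ((1 + (y - h) ^+ 2) * (1 + (y + h) ^+ 2) * (1 + y ^+ 2))).
  by rewrite /psi; field; rewrite !gt_eqF.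
rewrite ler_wpM2l ?(ltW h2)//.
have P : (1 + (y - h) ^+ 2) * (1 + (y + h) ^+ 2) <= 2 * (y ^+ 2) ^+ 2.
  have -> : (1 + (y - h) ^+ 2) * (1 + (y + h) ^+ 2) =
    (1 + y ^+ 2 + h ^+ 2) ^+ 2 - 4 * y ^+ 2 * h ^+ 2 by ring.
  set A := y ^+ 2 in y16 *; set B := h ^+ 2 in h2 h21 *; nra.
have PQ : (1 + (y - h) ^+ 2) * (1 + (y + h) ^+ 2) * (1 + y ^+ 2) <= 2 * (y ^+ 2) ^+ 2 * (2 * y ^+ 2).
  apply: ler_pM => //; [exact/ltW/mulr_gt0|exact: ltW|lra].
rewrite ler_pdivlMr ?mulr_gt0// mulrC ler_pdivrMr; last by rewrite mulr_gt0// exprn_gt0.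
apply: le_trans PQ _.
have -> : 2 * y * (y ^+ 2 - 3 - h ^+ 2) * (8 * y ^+ 3) = 16 * (y ^+ 2) ^+ 2 * (y ^+ 2 - 3 - h ^+ 2) by ring.
have -> : 2 * (y ^+ 2) ^+ 2 * (2 * y ^+ 2) = 4 * (y ^+ 2) ^+ 2 * y ^+ 2 by ring.
have y40 : 0 <= (y ^+ 2) ^+ 2 by exact: sqr_ge0.
set A := y ^+ 2 in y16 y40 *; set Q := A ^+ 2 in y40 *.
have : 0 <= Q * (16 * (A - 3 - h ^+ 2) - 4 * A) by rewrite mulr_ge0//; lra.
lra.
Qed.

Definition phase (L p om : R) (k : nat) := p * (k%:R / L) + om * psi (k%:R / L).

Lemma phase_diff L p om k : 0 < L -> phase L p om k.+1 - phase L p om k =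
  p / L - om * (psi (k%:R / L) - psi (k%:R / L + L^-1)).
Proof.
move=> L0; rewrite /phase -natr1 mulrDl mul1r; ring.
Qed.

Lemma phase_diff2 L p om k : 0 < L ->
  (phase L p om k.+2 - phase L p om k.+1) - (phase L p om k.+1 - phase L p om k) =
  om * (psi (k.+1%:R / L - L^-1) - 2 * psi (k.+1%:R / L) + psi (k.+1%:R / L + L^-1)).
Proof.
move=> L0; rewrite !phase_diff//.
have -> : k.+1%:R / L - L^-1 = k%:R / L by rewrite -natr1 mulrDl mul1r addrK.
have -> : k%:R / L + L^-1 = k.+1%:R / L by rewrite -natr1 mulrDl mul1r.
ring.
Qed.

(** For [|om| <= p * T ^ 2 / 2] the linear term [p * tau] dominates the derivative of the phase, and
    Kusmin-Landau applies. For larger [om] the curvature of [om * psi] suffices for van der Corput,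
    with [|2 * om| <= L * T ^ 2] and [2 * p2 <= L] bounding the phase increments by 1. Both regimes
    use that [p] stays away from [0]. *)
Lemma chirp_sums_le p1 p2 : 0 < p1 -> exists2 C : R, 0 < C &
  forall p om (t L : nat), p1 <= p <= p2 -> (4 <= t)%N -> 2 * p2 <= L%:R ->
    (0 < L)%N -> `|2 * om| <= L%:R * t%:R ^+ 2 ->
    sums_le (fun k => cos (phase L%:R p om k)) (t * L) (4 * (t * L))
       (C * (L%:R * Num.sqrt t%:R)).
Proof.
move=> p10; have c1 := cos1_gt0 R.
have sp10 : 0 < Num.sqrt p1 by rewrite sqrtr_gt0.
exists (10 / (cos 1 * p1) + 13 * 32 / (cos 1 * Num.sqrt p1)).
  by rewrite addr_gt0// divr_gt0// mulr_gt0.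
move=> p om t Ln /andP[p1p pp2] t4 p2L L0 omL.
set L : R := Ln%:R in p2L omL *; set T : R := t%:R in omL *.
have {}L0 : 0 < L by rewrite ltr0n.
have L1 : 1 <= L by rewrite ler1n; move: L0; rewrite /L ltr0n.
have T4 : 4 <= T by rewrite ler_nat.
have T0 : 0 < T by lra.
have p0 : 0 < p by lra.
have h0 : 0 < L^-1 by rewrite invr_gt0.
have h1 : L^-1 <= 1 by rewrite invf_le1.
have T1 : 1 <= Num.sqrt T by rewrite -sqrtr1 ler_wsqrtr//; lra.
have sT0 : 0 < Num.sqrt T by lra.
have tauT k : (t * Ln <= k)%N -> T <= k%:R / L.
  by move=> h; rewrite ler_pdivlMr// -natrM ler_nat.
have tau4T k : (k <= 4 * (t * Ln))%N -> k%:R / L <= 4 * T.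
  by move=> h; rewrite ler_pdivrMr// -mulrA -!natrM ler_nat.
have psid k : (t * Ln <= k)%N -> 0 <= psi (k%:R / L) - psi (k%:R / L + L^-1) <= L^-1 / T ^+ 2.
  move=> /tauT h; have := @psi_diff_le (k%:R / L) L^-1 ltac:(lra) h0.
  move=> /andP[-> h2] /=; apply: le_trans h2 _.
  rewrite ler_wpM2l ?(ltW h0)// lef_pV2 ?posrE ?exprn_gt0//; last by lra.
  by rewrite ler_pXn2r ?nnegrE//; lra.
have T2 : 0 < T ^+ 2 by rewrite exprn_gt0.
have omd k : (t * Ln <= k)%N ->
    `|om * (psi (k%:R / L) - psi (k%:R / L + L^-1))| <= `|om| / T ^+ 2 * L^-1.
  move=> /psid/andP[h2 h3]; rewrite normrM (ger0_norm h2).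
  have -> : `|om| / T ^+ 2 * L^-1 = `|om| * (L^-1 / T ^+ 2) by ring.
  by rewrite ler_wpM2l.
have d2 k : (t * Ln <= k)%N -> (k.+1 < 4 * (t * Ln))%N -> L^-1 ^+ 2 / (512 * T ^+ 3) <=
    psi (k.+1%:R / L - L^-1) - 2 * psi (k.+1%:R / L) + psi (k.+1%:R / L + L^-1).
  move=> hk hk'.
  have t1 := tauT k.+1 (leqW hk); have t2 := tau4T k.+1 (ltnW hk').
  apply: le_trans (psi_second_diff_ge _ _); [|lra|by rewrite h0].
  set z := k.+1%:R / L in t1 t2 *.
  have z0 : 0 < z by lra.
  apply: ler_wpM2l; first exact: sqr_ge0.
  have z3 : 0 < 8 * z ^+ 3 by apply: mulr_gt0 => //; exact: exprn_gt0.
  have zT : 8 * z ^+ 3 <= 512 * T ^+ 3.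
    have : z ^+ 3 <= (4 * T) ^+ 3 by rewrite ler_pXn2r ?nnegrE//; lra.
    rewrite exprMn; lra.
  rewrite lef_pV2 ?posrE; [exact: zT|exact: lt_le_trans zT|exact: z3].
have q0 : 0 < L^-1 ^+ 2 / (512 * T ^+ 3).
  apply: divr_gt0; first by rewrite exprn_gt0.
  by apply: mulr_gt0; [rewrite ltr0n|rewrite exprn_gt0].
have d20 k (h : (t * Ln <= k)%N) (h' : (k.+1 < 4 * (t * Ln))%N) :=
  le_trans (ltW q0) (d2 k h h').
have hA : `|om| <= p * T ^+ 2 / 2 \/ p * T ^+ 2 / 2 < `|om|.
  by have [h|h] := leP `|om| (p * T ^+ 2 / 2); [left|right].
case: hA => hom.
  have omd' k : (t * Ln <= k)%N ->
    `|om * (psi (k%:R / L) - psi (k%:R / L + L^-1))| <= p / L / 2.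
    move=> /omd h; apply: le_trans h _.
    have : `|om| / T ^+ 2 <= p / 2 by rewrite ler_pdivrMr//; lra.
    by move=> /(ler_wpM2r (ltW h0)); lra.
  apply: (@sums_leW _ _ _ _ (5 / (cos 1 * (p1 / L / 2)))).
    have -> : 5 / (cos 1 * (p1 / L / 2)) = 10 / (cos 1 * p1) * L.
      by field; rewrite !gt_eqF.
    rewrite mulrDl.
    have a1 : 0 <= 10 / (cos 1 * p1) by apply: divr_ge0 => //; apply/ltW/mulr_gt0.
    have a2 : 0 <= 13 * 32 / (cos 1 * Num.sqrt p1).
      by apply: divr_ge0 => //; apply/ltW/mulr_gt0.
    have a3 : L <= L * Num.sqrt T by rewrite ler_peMr// ltW.
    have := ler_wpM2l a1 a3.
    have := mulr_ge0 a2 (ltW (lt_le_trans L0 a3)).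
    lra.
  apply: kusmin_landau.
  - by rewrite !divr_gt0.
  - move=> k /andP[hk _]; rewrite phase_diff//.
    have := omd' k hk; rewrite ler_norml.
    have : p1 / L <= p / L by rewrite ler_wpM2r// ltW.
    have : p / L <= 1 / 2 by rewrite ler_pdivrMr//; lra.
    have : 0 < p / L by rewrite divr_gt0.
    set z := p / L; set u := om * _; lra.
  - have [om0|om0] := leP 0 om; [left|right] => k k1 k2.
      rewrite -subr_ge0 phase_diff2//; exact: mulr_ge0 om0 (d20 k k1 k2).
    rewrite -subr_le0 phase_diff2//; exact: mulr_le0_ge0 (ltW om0) (d20 k k1 k2).
(* The product of [p1 * T ^+ 2 / 2 <= |om|] and the lower bound [d2] for the second difference of
   [psi], where [512 = 8 * 4 ^ 3] because [tau] may reach [4 * T]. *)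
pose sg := p1 * L^-1 ^+ 2 / (1024 * T).
have sg0 : 0 < sg.
  apply: divr_gt0; first by rewrite mulr_gt0 ?exprn_gt0.
  by apply: mulr_gt0; [rewrite ltr0n|].
have p1L : p1 * L^-1 <= 1 by rewrite ler_pdivrMr//; lra.
apply: (@sums_leW _ _ _ _ (13 / (cos 1 * Num.sqrt sg))).
  have -> : Num.sqrt sg = Num.sqrt p1 / (32 * L * Num.sqrt T).
    rewrite /sg (_ : p1 * L^-1 ^+ 2 / (1024 * T) = p1 * ((32 * L)^-1 ^+ 2 * T^-1)); last first.
      by field; rewrite !gt_eqF.
    rewrite sqrtrM ?(ltW p10)// sqrtrM ?sqr_ge0// sqrtr_sqr ger0_norm ?invr_ge0 ?mulr_ge0 ?(ltW L0)//.
    by rewrite sqrtrV ?(ltW T0)// -invfM.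
  have -> : 13 / (cos 1 * (Num.sqrt p1 / (32 * L * Num.sqrt T))) =
     13 * 32 / (cos 1 * Num.sqrt p1) * (L * Num.sqrt T).
    by field; rewrite !gt_eqF.
  have a1 : 0 <= 10 / (cos 1 * p1) by apply: divr_ge0 => //; apply/ltW/mulr_gt0.
  have := mulr_ge0 a1 (ltW (mulr_gt0 L0 sT0)).
  set u := L * _; set v := 10 / _; set w := 13 * 32 / _; lra.
apply: van_der_corput.
- rewrite sg0 /= /sg ler_pdivrMr; last by apply: mulr_gt0; [rewrite ltr0n|].
  rewrite mul1r.
  have : p1 * L^-1 * L^-1 <= 1 * 1 by apply: ler_pM => //; apply: ltW => //; exact: mulr_gt0.
  rewrite expr2 mulrA; lra.
- move=> k /andP[hk _]; rewrite phase_diff//.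
  apply: le_trans (ler_normB _ _) _.
  have p2L' : `|p / L| <= 1 / 2.
    rewrite gtr0_norm; last exact: divr_gt0.
    by rewrite ler_pdivrMr//; lra.
  have := omd k hk.
  have : `|om| / T ^+ 2 * L^-1 <= 1 / 2.
    rewrite ler_pdivrMr// ler_pdivrMr//; move: omL; rewrite normrM ger0_norm//; lra.
  lra.
- have omgap k : (t * Ln <= k)%N -> (k.+1 < 4 * (t * Ln))%N ->
    sg <= `|om| * (psi (k.+1%:R / L - L^-1) - 2 * psi (k.+1%:R / L) + psi (k.+1%:R / L + L^-1)).
    move=> k1 k2; have q := d2 k k1 k2.
    apply: (@le_trans _ _ (p1 * T ^+ 2 / 2 * (L^-1 ^+ 2 / (512 * T ^+ 3)))).
      rewrite le_eqVlt; apply/orP; left; apply/eqP; rewrite /sg; field.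
      by rewrite !gt_eqF.
    apply: ler_pM; [|exact: ltW| |exact: q].
      by rewrite divr_ge0// mulr_ge0 ?ltW.
    apply: le_trans (ltW hom).
    by rewrite ler_wpM2r// ler_wpM2r// ltW.
  have [om0|om0] := leP 0 om; [left|right] => k k1 k2; rewrite phase_diff2//.
    by have := omgap k k1 k2; rewrite ger0_norm.
  have := omgap k k1 k2; rewrite ltr0_norm//; lra.
Qed.

End ChirpCoefficient.

(** * Trapezoidal frequency sums *)

Section TrapezoidSum.
Variable R : realType.
Implicit Types (p om N : R).

(* Coefficients of [fejer (4 n) - 3 fejer (2 n) + 2 fejer n], supported in [n, 4 n]. *)
Definition hat (n k : nat) : nat :=
  if (k <= 2 * n)%N then (2 * (k - n))%N else (4 * n - k)%N.

(** The inverse power is the weight on the Fourier side; it cancels against the power of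
    [Num.sqrt (S k)] in [chirp_form] at [n = d]. *)
Definition hat_coeff (d t L k : nat) : R :=
  (hat (t * L) k)%:R / (t * L)%:R * (Num.sqrt (1 + (k%:R / L%:R) ^+ 2))^-1 ^+ d.

(* [1 + tau ^ 2 <= 17 t ^ 2] for [tau <= 4 t], so each summand has the factor
   [expR (- N / (34 t ^ 2))]; half of the exponent is spent on the range of [om] that
   van der Corput's test does not cover. *)
Lemma hat_coeff_sum_bound (d : nat) (p1 p2 : R) : 0 < p1 -> exists2 C : R, 0 < C &
  forall p om N (t L : nat), p1 <= p <= p2 -> (4 <= t)%N -> 2 * p2 <= L%:R ->
    (68 * t <= L)%N -> 0 <= N -> `|2 * om| <= N ->
    `|\sum_(k <- index_iota (t * L) (4 * (t * L)))
        hat_coeff d t L k * expR (- N / (2 * (1 + (k%:R / L%:R) ^+ 2))) *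
        cos (- (p * (k%:R / L%:R)) - om * (k%:R / L%:R) / (1 + (k%:R / L%:R) ^+ 2))|
    <= C * (L%:R * Num.sqrt t%:R) * t%:R^-1 ^+ d * expR (- (68 * t%:R ^+ 2)^-1 * N).
Proof.
move=> p10; have [C C0 hC] := @chirp_sums_le R p1 p2 p10.
(* The rising half of the trapezoid costs [8 * C], the falling half [4 * C]; the trivial bound for
   large [om] has [3 * n] terms with weight at most 2. *)
exists (12 * C + 6); first by lra.
move=> p om N t Ln pp t4 p2L tL N0 omN.
have Ln0 : (0 < Ln)%N by clear -t4 tL; lia.
pose L : R := Ln%:R; pose T : R := t%:R.
rewrite -/L -/T.
have T4 : 4 <= T by rewrite ler_nat.
have T0 : 0 < T by lra.
have L0 : 0 < L by rewrite ltr0n.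
have sT1 : 1 <= Num.sqrt T by rewrite -sqrtr1 ler_wsqrtr//; lra.
pose n := (t * Ln)%N.
have nE : n%:R = T * L by rewrite natrM.
have n0 : 0 < n%:R :> R by rewrite nE mulr_gt0.
have LN : 68 * T <= L.
  rewrite (_ : 68 * T = (68 * t)%:R); last by rewrite natrM.
  by rewrite ler_nat.
have tauT k : (n <= k)%N -> T <= k%:R / L.
  by move=> h; rewrite ler_pdivlMr// -natrM ler_nat.
have tau4T k : (k < 4 * n)%N -> k%:R / L <= 4 * T.
  by move=> h; rewrite ler_pdivrMr// -mulrA -!natrM ler_nat; exact: ltnW h.
have taumono k : k%:R / L <= k.+1%:R / L.
  by rewrite ler_wpM2r ?invr_ge0 ?(ltW L0)// ler_nat.
have tau0 k : 0 <= k%:R / L by rewrite divr_ge0// ltW.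
pose S k : R := 1 + (k%:R / L) ^+ 2.
have S0 k : 0 < S k by exact: oneDsqr_gt0.
have Smono k : S k <= S k.+1.
  by rewrite lerD2l; apply: lerXn2r; rewrite ?nnegrE.
have ST k : (n <= k)%N -> T ^+ 2 <= S k.
  move=> /tauT h; apply: (@le_trans _ _ ((k%:R / L) ^+ 2)); last by rewrite lerDr.
  by apply: lerXn2r; rewrite ?nnegrE ?(ltW T0).
have S17 k : (k < 4 * n)%N -> S k <= 17 * T ^+ 2.
  move=> /tau4T h.
  have : (k%:R / L) ^+ 2 <= (4 * T) ^+ 2 by apply: lerXn2r; rewrite ?nnegrE // ?mulr_ge0 ?(ltW T0).
  have : 1 ^+ 2 <= T ^+ 2 by apply: lerXn2r; rewrite ?nnegrE ?(ltW T0)//; lra.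
  rewrite /S exprMn; clear; lra.
pose a k : R := (Num.sqrt (S k))^-1 ^+ d.
have sS0 k : 0 < Num.sqrt (S k) by rewrite sqrtr_gt0.
have a0 k : 0 <= a k by rewrite exprn_ge0// invr_ge0 ltW.
have aT k : (n <= k)%N -> a k <= T^-1 ^+ d.
  move=> /ST h; apply: lerXn2r; rewrite ?nnegrE ?invr_ge0 ?(ltW T0) ?(ltW (sS0 k))//.
  rewrite lef_pV2 ?posrE//.
  by rewrite -(ger0_norm (ltW T0)) -sqrtr_sqr ler_wsqrtr.
have amono k : a k.+1 <= a k.
  apply: lerXn2r; rewrite ?nnegrE ?invr_ge0 ?(ltW (sS0 _))//.
  by rewrite lef_pV2 ?posrE// ler_wsqrtr.
pose e k := expR (- N / (2 * S k)).
pose c := (68 * T ^+ 2)^-1.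
have T20 : 0 < T ^+ 2 by rewrite exprn_gt0.
have c0 : 0 < c by rewrite invr_gt0 mulr_gt0.
pose e0 := expR (- (2 * c) * N).
have e0E : e0 = expR (- c * N) * expR (- c * N).
  by rewrite -expRD; congr expR; ring.
have eb k : (k < 4 * n)%N -> 0 <= e k <= e0.
  move=> /S17 h; rewrite expR_ge0/= /e ler_expR.
  rewrite mulNr (mulNr (2 * c)) lerN2 mulrC ler_wpM2l//.
  rewrite /c (_ : 2 * (68 * T ^+ 2)^-1 = (34 * T ^+ 2)^-1); last first.
    by field; rewrite gt_eqF.
  by rewrite lef_pV2 ?posrE ?mulr_gt0//; clear -h; lra.
have emono k : e k <= e k.+1.
  rewrite /e ler_expR !mulNr lerN2 ler_wpM2l// lef_pV2 ?posrE ?mulr_gt0//.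
  by rewrite ler_pM2l.
have Td0 : 0 <= T^-1 ^+ d by rewrite exprn_ge0// invr_ge0 ltW.
have e00 : 0 <= e0 by exact: expR_ge0.
have ec1 : expR (- c * N) <= 1 by rewrite -expR0 ler_expR mulNr oppr_le0 mulr_ge0// ltW.
have ecc : 0 <= expR (- c * N) by exact: expR_ge0.
pose h k : R := (hat n k)%:R / n%:R.
have h2 k : 0 <= h k <= 2.
  rewrite divr_ge0//= ler_pdivrMr// -natrM ler_nat /hat.
  by case: ifP; clear; lia.
pose X k := cos (phase L p om k).
have -> : \sum_(k <- index_iota n (4 * n)) hat_coeff d t Ln k *
    expR (- N / (2 * (1 + (k%:R / L) ^+ 2))) *
    cos (- (p * (k%:R / L)) - om * (k%:R / L) / (1 + (k%:R / L) ^+ 2)) =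
  \sum_(n <= k < 4 * n) h k * (a k * (e k * X k)).
  apply: eq_bigr => k _; rewrite /X /phase /psi -cosN.
  rewrite (_ : - (_ - _) = p * (k%:R / L) + om * (k%:R / L / (1 + (k%:R / L) ^+ 2))); last by ring.
  by rewrite /hat_coeff -/n -/(S k) -/(a k) -/(e k) -/(h k) !mulrA.
have [hom|hom] := leP `|2 * om| (L * T ^+ 2).
  have xB := hC p om t Ln pp t4 p2L Ln0 hom.
  set B := C * _ in xB.
  have B0 : 0 <= B by rewrite /B !mulr_ge0 ?(ltW C0)//.
  have x1 : sums_le (fun k => e k * X k) n (4 * n) (2 * e0 * B).
    by apply: sums_le_incr => // k /andP[_]; exact: eb.
  have x2 : sums_le (fun k => a k * (e k * X k)) n (4 * n) (T^-1 ^+ d * (2 * e0 * B)).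
    by apply: sums_le_decr => // k /andP[hk _]; rewrite a0 aT.
  have ni : 0 <= (n%:R)^-1 :> R by rewrite invr_ge0.
  have x3 : sums_le (fun k => h k * (a k * (e k * X k))) n (2 * n) (2 * 2 * (T^-1 ^+ d * (2 * e0 * B))).
    apply: sums_le_incr => //.
      by apply: sums_le_sub x2 => //; clear; lia.
    move=> k k1 k2; rewrite /h ler_wpM2r// ler_nat /hat !ifT; clear -k1 k2; lia.
  have x4 : sums_le (fun k => h k * (a k * (e k * X k))) (2 * n) (4 * n) (2 * (T^-1 ^+ d * (2 * e0 * B))).
    apply: sums_le_decr => //.
      by apply: sums_le_sub x2 => //; clear; lia.
    move=> k k1 k2; rewrite /h ler_wpM2r// ler_nat /hat.
    by case: ifP; case: ifP; clear -k1 k2; lia.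
  have n24 : (n <= 2 * n <= 4 * n)%N by clear; lia.
  have n4 : (n <= 4 * n)%N by clear; lia.
  have hS := sums_le_cat n24 x3 x4.
  have {hS} := hS n (4 * n)%N (leqnn n) n4 (leqnn (4 * n)%N).
  move=> hS; apply: le_trans hS _.
  have e0c : e0 <= expR (- c * N) by rewrite e0E ler_piMr.
  have P0 : 0 <= T^-1 ^+ d * B by rewrite mulr_ge0.
  have := ler_wpM2l P0 e0c.
  have Q0 : 0 <= T^-1 ^+ d * (L * Num.sqrt T) * expR (- c * N).
    by rewrite !mulr_ge0// ltW.
  rewrite /B -/c; move: Q0; clear; nra.
apply: le_trans (ler_norm_sum _ _ _) _.
have ubk k : (n <= k < 4 * n)%N -> `|h k * (a k * (e k * X k))| <= 2 * (T^-1 ^+ d * e0).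
  move=> /andP[k1 k2]; have /andP[hk0 hk2] := h2 k; have /andP[ek0 ek1] := eb k k2.
  rewrite normrM (ger0_norm hk0) normrM (ger0_norm (a0 k)) normrM (ger0_norm ek0).
  apply: ler_pM => //; first by rewrite !mulr_ge0.
  apply: ler_pM => //; [by rewrite mulr_ge0|exact: aT|].
  by rewrite -[leRHS]mulr1; apply: ler_pM => //; exact: cos_max.
apply: (@le_trans _ _ (\sum_(n <= k < 4 * n) 2 * (T^-1 ^+ d * e0))).
  by rewrite big_nat_cond [leRHS]big_nat_cond; apply: ler_sum => k /andP[hk _]; exact: ubk.
rewrite sumr_const_nat (_ : (4 * n - n = 3 * n)%N); last by clear; lia.
rewrite -[leLHS]mulr_natr natrM nE.
have cT : expR (- c * N) * T <= 1.
  rewrite mulNr expRN mulrC ler_pdivrMr ?expR_gt0// mul1r.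
  apply: le_trans (expR_ge1Dx _).
  have : L / 68 <= c * N.
    rewrite /c [leRHS]mulrC ler_pdivlMr; last by rewrite mulr_gt0.
    have := le_trans (ltW hom) omN; clear; lra.
  move: LN; clear; lra.
rewrite e0E -/c.
have K0 : 0 <= T^-1 ^+ d * L * expR (- c * N) by rewrite !mulr_ge0// ltW.
have k1 := ler_wpM2l K0 cT.
have k2 := ler_wpM2l K0 sT1.
have k3 : 0 <= C * (T^-1 ^+ d * L * expR (- c * N) * Num.sqrt T).
  by rewrite !mulr_ge0 ?sqrtr_ge0// ltW.
move: k1 k2 k3; clear; lra.
Qed.

End TrapezoidSum.

(** * Fejer kernels *)

Section FejerKernel.
Variable R : realType.
Implicit Types (x : R).

(** The squared modulus of [sum_(k < n) e^(i k x)], that is [n] times the usual Fejer kernel; its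
    coefficients are integers. *)
Definition fejer (n : nat) x : R :=
  (\sum_(k < n) cos (k%:R * x)) ^+ 2 + (\sum_(k < n) sin (k%:R * x)) ^+ 2.

Lemma fejer_ge0 n x : 0 <= fejer n x.
Proof. by rewrite addr_ge0 ?sqr_ge0. Qed.

Lemma sum_ord_rev_cos n x :
  \sum_(k < n) cos ((n - k)%:R * x) = \sum_(1 <= k < n.+1) cos (k%:R * x).
Proof.
rewrite -(big_mkord xpredT (fun k => cos ((n - k)%:R * x))) big_nat_rev /=.
rewrite big_add1 /=.
rewrite !big_nat; apply: eq_bigr => k /andP[_ kn]; congr (cos (_%:R * _)).
by clear -kn; lia.
Qed.

Lemma fejerS n x :
  fejer n.+1 x = fejer n x + 1 + 2 * \sum_(1 <= k < n.+1) cos (k%:R * x).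
Proof.
rewrite /fejer !big_ord_recr/= -sum_ord_rev_cos.
have -> : \sum_(k < n) cos ((n - k)%:R * x) =
   cos (n%:R * x) * (\sum_(k < n) cos (k%:R * x)) + sin (n%:R * x) * (\sum_(k < n) sin (k%:R * x)).
  rewrite !mulr_sumr -big_split/=; apply: eq_bigr => k _.
  by rewrite natrB ?(ltnW (ltn_ord k))// mulrBl cosB.
have := cos2Dsin2 (n%:R * x); set c := cos (n%:R * x); set s := sin (n%:R * x).
set C := \sum_(k < n) _; set S := \sum_(k < n) _ => h.
have -> : (C + c) ^+ 2 + (S + s) ^+ 2 = C ^+ 2 + S ^+ 2 + (c ^+ 2 + s ^+ 2) + 2 * (c * C + s * S) by ring.
by rewrite h.
Qed.

(** Truncated subtraction makes the coefficients vanish for [k >= n], so kernels of different orders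
    can share one range [N]. *)
Lemma fejerE n N x : (n <= N)%N ->
  fejer n x = n%:R + 2 * \sum_(1 <= k < N) (n - k)%:R * cos (k%:R * x).
Proof.
elim: n => [|n IH] nN.
  rewrite /fejer !big_ord0 expr0n/= addr0 big1_seq ?mulr0 ?addr0// => k _.
  by rewrite sub0n mul0r.
rewrite fejerS (IH (ltnW nN)) -(natr1 n).
rewrite [X in n%:R + 1 + 2 * X](_ : _ = \sum_(1 <= k < N) (n - k)%:R * cos (k%:R * x) + \sum_(1 <= k < n.+1) cos (k%:R * x)).
  by ring.
rewrite (@big_cat_nat _ _ _ n.+1)//= [in RHS](@big_cat_nat _ _ _ n.+1)//=.
rewrite [X in _ + X](_ : _ = 0); last first.
  rewrite big_nat big1// => k /andP[k1 k2].
  by rewrite (_ : (n.+1 - k = 0)%N) ?mul0r//; lia.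
rewrite [X in _ + X + _](_ : _ = 0); last first.
  rewrite big_nat big1// => k /andP[k1 k2].
  by rewrite (_ : (n - k = 0)%N) ?mul0r//; lia.
rewrite !addr0 -big_split/= !big_nat; apply: eq_bigr => k /andP[k1 k2].
by rewrite subSn// -(natr1 (n - k)%N) mulrDl mul1r.
Qed.

(** Low frequencies cancel: [(4 n - k) - 3 (2 n - k) + 2 (n - k) = 0] for [k <= n], and likewise for
    the constant terms. *)
Lemma fejer_second_diff n x : (0 < n)%N ->
  fejer (4 * n) x - 3 * fejer (2 * n) x + 2 * fejer n x =
  2 * \sum_(n <= k < 4 * n) (hat n k)%:R * cos (k%:R * x).
Proof.
move=> n0.
rewrite !(@fejerE _ (4 * n)); [|lia|lia|lia].
rewrite !natrM.
set S1 := \sum_(1 <= k < 4 * n) _; set S2 := \sum_(1 <= k < 4 * n) _.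
set S3 := \sum_(1 <= k < 4 * n) _.
have -> : 4 * n%:R + 2 * S1 - 3 * (2 * n%:R + 2 * S2) + 2 * (n%:R + 2 * S3) =
   2 * (S1 - 3 * S2 + 2 * S3) by ring.
congr (_ * _).
rewrite /S1 /S2 /S3 !mulr_sumr -sumrB -big_split/=.
rewrite (@big_cat_nat _ _ _ n)//=; last by lia.
rewrite [X in X + _](_ : _ = 0) ?add0r; last first.
  rewrite big_nat big1// => k /andP[k1 k2].
  rewrite !natrB ?natrM; try lia.
  by ring.
rewrite !big_nat; apply: eq_bigr => k /andP[k1 k2].
rewrite /hat (_ : (n - k = 0)%N); last by lia.
rewrite mul0r mulr0 addr0.
case: leqP => hk.
  by rewrite !natrM !natrB ?natrM//; [ring|lia].
by rewrite (_ : (2 * n - k = 0)%N) ?mul0r ?mulr0 ?subr0//; lia.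
Qed.

Lemma fejer_le n x : fejer n x <= n%:R ^+ 2.
Proof.
elim: n => [|n IH]; first by rewrite /fejer !big_ord0 expr0n/= addr0.
rewrite fejerS.
have : \sum_(1 <= k < n.+1) cos (k%:R * x) <= n%:R.
  apply: le_trans (ler_sum _ (fun k _ => cos_le1 _)) _.
  by rewrite sumr_const_nat subn1.
by rewrite -(natr1 n); move: IH; clear; nra.
Qed.

(** The geometric sum in real form: both trigonometric sums telescope after multiplication by
    [2 * sin (x / 2)]. The bound does not grow with [n]. *)
Lemma fejer_sin n x : fejer n x * (sin (x / 2) ^+ 2 * 4) <= 4.
Proof.
have hs : (\sum_(k < n) sin (k%:R * x)) * (2 * sin (x / 2)) =
    cos (x / 2) - cos (n%:R * x - x / 2).
  elim: n => [|n IH]; first by rewrite big_ord0 mul0r mul0r add0r cosN subrr.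
  rewrite big_ord_recr/= mulrDl IH -(natr1 n).
  have -> : (n%:R + 1) * x - x / 2 = n%:R * x + x / 2 by field.
  by rewrite [in RHS]cosD cosB; ring.
have hc : (\sum_(k < n) cos (k%:R * x)) * (2 * sin (x / 2)) =
    sin (n%:R * x - x / 2) + sin (x / 2).
  elim: n {hs} => [|n IH]; first by rewrite big_ord0 mul0r mul0r add0r sinN addNr.
  rewrite big_ord_recr/= mulrDl IH -(natr1 n).
  have -> : (n%:R + 1) * x - x / 2 = n%:R * x + x / 2 by field.
  by rewrite [in RHS]sinD sinB; ring.
have -> : fejer n x * (sin (x / 2) ^+ 2 * 4) =
    ((\sum_(k < n) cos (k%:R * x)) * (2 * sin (x / 2))) ^+ 2 +
    ((\sum_(k < n) sin (k%:R * x)) * (2 * sin (x / 2))) ^+ 2.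
  by rewrite /fejer; ring.
rewrite hs hc.
set u := n%:R * x - x / 2; set v := x / 2.
have e1 := cos2Dsin2 u; have e2 := cos2Dsin2 v.
have -> : (sin u + sin v) ^+ 2 + (cos v - cos u) ^+ 2 =
  (cos u ^+ 2 + sin u ^+ 2) + (cos v ^+ 2 + sin v ^+ 2) - 2 * (cos u * cos v - sin u * sin v) by ring.
by rewrite e1 e2 -cosD; have := cos_geN1 (u + v); lra.
Qed.

Lemma fejer_le_inv n x : 0 < `|x| <= 2 -> fejer n x <= 4 / (cos 1 ^+ 2 * x ^+ 2).
Proof.
move=> hx; have c1 := cos1_gt0 R.
have x2 : 0 < x ^+ 2 by rewrite -real_normK ?num_real// exprn_gt0//; lra.
rewrite ler_pdivlMr; last by rewrite mulr_gt0// exprn_gt0.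
apply: le_trans (fejer_sin n x); rewrite ler_wpM2l ?fejer_ge0//.
have h := @sin_ge_cos1 _ (`|x| / 2) ltac:(lra).
have s2 : sin (x / 2) ^+ 2 = sin (`|x| / 2) ^+ 2.
  by case: (ger0P x) => _; rewrite // mulNr sinN sqrrN.
rewrite s2 -(real_normK (num_real x)).
have : (cos 1 * (`|x| / 2)) ^+ 2 <= sin (`|x| / 2) ^+ 2.
  have h0 : 0 <= cos 1 * (`|x| / 2) by rewrite mulr_ge0 ?(ltW c1)//; lra.
  by rewrite ler_pXn2r ?nnegrE// (le_trans h0 h).
by clear; nra.
Qed.

Lemma fejer_ge n x : `|n%:R * x| <= 1 -> (n%:R * cos 1) ^+ 2 <= fejer n x.
Proof.
move=> hx; have c1 := cos1_gt0 R.
have h : n%:R * cos 1 <= \sum_(k < n) cos (k%:R * x).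
  have -> : n%:R * cos 1 = \sum_(k < n) cos 1 :> R by rewrite sumr_const card_ord mulr_natl.
  apply: ler_sum => k _.
  rewrite -(cos_norm (k%:R * x)).
  have hk : `|k%:R * x| <= 1.
    apply: le_trans hx; rewrite !normrM !normr_nat ler_wpM2r//.
    by rewrite ler_nat ltnW.
  move: hk; rewrite le_eqVlt => /predU1P[->//|hk].
  have p2 := pi_ge2 R; have := normr_ge0 (k%:R * x) => hk0.
  by rewrite ltW// ltr_cos ?in_itv/=; lra.
rewrite /fejer ler_wpDr ?sqr_ge0//.
have h0 : 0 <= n%:R * cos 1 :> R by rewrite mulr_ge0// ltW.
by rewrite ler_pXn2r ?nnegrE// (le_trans h0 h).
Qed.

End FejerKernel.

(** * Recurrence across dyadic scales *)

Lemma bootstrap_bound (R : realType) (U : nat -> R) (K r eps : R) (j0 J : nat) :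
  0 <= K -> 1 < 2 * r -> r < 1 ->
  (forall j, 0 <= U j) ->
  (forall j, (j0 <= j <= J)%N ->
     `|U j.+2 - 3 * U j.+1 + 2 * U j| <= K * 2 ^+ j * r ^+ j) ->
  U J.+2 <= eps * 2 ^+ J.+1 ->
  forall j, (j0 <= j <= J)%N ->
    U j <= U j0 + eps * 2 ^+ j + K / (1 - r) / (2 * r - 1) * (2 * r) ^+ j.
Proof.
move=> K0 r2 r1 U0 UK UJ.
have r0 : 0 < r by lra.
(* [w j] plays the role of the density: the second difference is [2 ^ j.+1 * (w j.+1 - w j)].
   Descending from [w J.+1 <= eps] costs a geometric tail; then [2 ^ j * w j] is summed upwards,
   where [1 < 2 * r] lets the last term control the geometric sum. *)
pose w j := (U j.+1 - U j) / 2 ^+ j.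
have p2 j : 0 < 2 ^+ j :> R by rewrite exprn_gt0.
have rj j : 0 <= r ^+ j by rewrite exprn_ge0// ltW.
have wd j : (j0 <= j <= J)%N -> w j - w j.+1 <= K * r ^+ j / 2.
  move=> /UK; rewrite ler_norml => /andP[h _].
  have -> : w j - w j.+1 = - (U j.+2 - 3 * U j.+1 + 2 * U j) / 2 ^+ j / 2.
    by rewrite /w exprS; field; rewrite gt_eqF.
  rewrite ler_wpM2r// ler_pdivrMr//.
  by move: h; set z := r ^+ j; set y := 2 ^+ j; clear; lra.
have wb i : (j0 <= J.+1 - i)%N -> w (J.+1 - i)%N <= eps + K / (1 - r) * r ^+ (J.+1 - i).
  elim: i => [|i IH] hi.
    rewrite subn0 ler_wpDr ?mulr_ge0 ?invr_ge0//; first by rewrite subr_ge0 ltW.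
    by rewrite /w ler_pdivrMr// (le_trans _ UJ)// gerBl.
  have [iJ|iJ] := leqP J.+1 i; last first.
    have e : (J.+1 - i = (J.+1 - i.+1).+1)%N by lia.
    have := wd (J.+1 - i.+1)%N ltac:(lia); rewrite -e.
    have := IH ltac:(lia); rewrite [in r ^+ _]e exprS.
    set k := (J.+1 - i.+1)%N.
    have kr : K / (1 - r) * r ^+ k = K / (1 - r) * (r * r ^+ k) + K * r ^+ k.
      by field; rewrite subr_eq0 gt_eqF.
    have := mulr_ge0 K0 (rj k).
    rewrite kr; clear; lra.
  have e : (J.+1 - i.+1 = J.+1 - i)%N by lia.
  by rewrite e; apply: IH; rewrite -e.
have wb' j : (j0 <= j <= J)%N -> w j <= eps + K / (1 - r) * r ^+ j.
  by move=> hj; have := wb (J.+1 - j)%N; rewrite subKn; [apply; lia|lia].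
have Kr : 0 <= K / (1 - r) by rewrite divr_ge0// subr_ge0 ltW.
have eps0 : 0 <= eps.
  by rewrite -(pmulr_lge0 _ (p2 J.+1)); exact: le_trans UJ.
elim => [|j IH] hj.
  have -> : j0 = 0%N by lia.
  rewrite -addrA ler_wpDr// addr_ge0//; first by rewrite mulr_ge0.
  by rewrite expr0 mulr1 divr_ge0//; lra.
have [->|jj0] := eqVneq j0 j.+1.
  rewrite -addrA ler_wpDr// addr_ge0//; first by rewrite mulr_ge0// ltW.
  by rewrite mulr_ge0 ?exprn_ge0//; [rewrite divr_ge0//; lra|lra].
have := IH ltac:(lia); have := wb' j ltac:(lia).
rewrite {1}/w ler_pdivrMr// (mulrDl eps) -mulrA -exprMn (mulrC r) (exprS 2).
set Q := K / (1 - r) in Kr *; rewrite (exprS (2 * r)).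
set y := (2 * r) ^+ j.
have -> : Q / (2 * r - 1) * (2 * r * y) = Q / (2 * r - 1) * y + Q * y.
  by field; rewrite subr_eq0 gt_eqF.
clear; lra.
Qed.

(** * The energy of a discrete measure *)

Section Energy.
Variable R : realType.
Variables (I : finType) (mu : I -> R) (x : nat -> I -> R) (d : nat).

Definition sqdist (i i' : I) : R := \sum_(k < d) (x k i - x k i') ^+ 2.

Definition within (m : nat) (i i' : I) : bool :=
  [forall k : 'I_d, `|x k i - x k i'| <= 2^-1 ^+ m].

(* A point [X = (x, z)] of the product is a pair of indices. *)
Let M (v : I * I) := mu v.1 * mu v.2.
Let A k (v : I * I) := x k v.1.
Let B k (v : I * I) := x k v.2.

Definition quad (v v' : I * I) : R := pair_prod A B d v v'.
Definition cutoff (v v' : I * I) : R := expR (- pair_sq A B d v v' / 2).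

(** A Riemann sum of step [1 / L] in frequency: at [n = 2 ^ j * L] it models [2 ^ j] times the
    density of [quad] at [p], smoothed at scale [2 ^ -j] and weighted by [cutoff]. *)
Definition fejer_energy (p L : R) (n : nat) : R :=
  \sum_v \sum_v' M v * M v' * cutoff v v' * (fejer n ((quad v v' - p) / L) / L ^+ 2).

(** Measure and Gaussian both factor, so the energy of the product measure is the square of that of
    [mu]; this is why [rho] enters the threshold squared. *)
Lemma gauss_form_prod (c : R) :
  gauss_form M A B c d (fun=> 0) =
  (\sum_i \sum_i' mu i * mu i' * expR (- sqdist i i' / (4 * c))) ^+ 2.
Proof.
set F := fun i i' => mu i * mu i' * expR (- sqdist i i' / (4 * c)).
transitivity (\sum_(v : I * I) \sum_(v' : I * I) F v.1 v'.1 * F v.2 v'.2).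
  apply: eq_bigr => v _; apply: eq_bigr => v' _.
  rewrite subrr cos0 mul1r /F /M.
  have -> : pair_sq A B d v v' = sqdist v.1 v'.1 + sqdist v.2 v'.2.
    by rewrite /pair_sq big_split.
  rewrite opprD mulrDl expRD; ring.
rewrite -(pair_bigA _ (fun i j => \sum_(v' : I * I) F i v'.1 * F j v'.2))/=.
rewrite expr2 mulr_suml; apply: eq_bigr => i _.
rewrite mulr_sumr; apply: eq_bigr => j _.
rewrite -(pair_bigA _ (fun i' j' => F i i' * F j j'))/=.
rewrite mulr_suml; apply: eq_bigr => i' _.
by rewrite mulr_sumr.
Qed.

Hypothesis mu0 : forall i, 0 <= mu i.
Hypothesis mu1 : \sum_i mu i = 1.

(** The [q]-th power of [y / q <= expR (y / q)], inverted. *)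
Lemma expRN_le_pow (q : nat) (y : R) : 0 < y -> expR (- y) <= (q%:R / y) ^+ q.
Proof.
move=> y0; case: q => [|q].
  by rewrite expr0 -expR0 ler_expR oppr_le0 ltW.
have q0 : 0 < q.+1%:R :> R by [].
have -> : - y = q.+1%:R * - (y / q.+1%:R) by field; rewrite gt_eqF.
rewrite expRM_natl; apply: lerXn2r; rewrite ?nnegrE ?expR_ge0 ?divr_ge0 ?(ltW y0)//.
rewrite expRN -[leRHS]invf_div lef_pV2 ?posrE ?expR_gt0 ?divr_gt0//.
by apply: le_trans (expR_ge1Dx _); rewrite lerDr.
Qed.

(** Dyadic shells around each point. At distance above [2 ^ (m - j)] the Gaussian is at most a
    constant times [4 ^ (- m (d + 1))], hence times [rho ^ (2 m)] by the lower bound on [rho]. One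
    factor [rho ^ m] turns the Frostman bound at a level near [j - m] into [rho ^ j]; the other
    makes the sum over shells converge. *)
Lemma gauss_sum_le (rho C : R) (n j : nat) :
  2^-1 ^+ d.+1 <= rho -> rho < 1 -> 0 <= C ->
  (forall m i, (m <= n)%N -> \sum_(i' | within m i i') mu i' <= C * rho ^+ m) ->
  (j <= n)%N ->
  \sum_i \sum_i' mu i * mu i' * expR (- sqdist i i' * (17 * (2 ^+ j) ^+ 2)) <=
  (C * (1 + d.+1%:R ^+ d.+1 / rho / (1 - rho)) + d.+1%:R ^+ d.+1) * rho ^+ j.
Proof.
move=> rhod rho1 C0 frost jn.
set q := d.+1%:R ^+ d.+1 : R.
have q0 : 0 <= q by rewrite exprn_ge0.
have rho0 : 0 < rho by apply: lt_le_trans rhod; rewrite exprn_gt0// invr_gt0.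
have rr : 0 < 1 - rho by rewrite subr_gt0.
pose e i i' := expR (- sqdist i i' * (17 * (2 ^+ j) ^+ 2)).
have e1 i i' : e i i' <= 1.
  rewrite -expR0 ler_expR mulNr oppr_le0; apply: mulr_ge0.
    by apply: sumr_ge0 => k _; exact: sqr_ge0.
  by apply: mulr_ge0; [rewrite ler0n|exact: sqr_ge0].
have e0 i i' : 0 <= e i i' by exact: expR_ge0.
have efar m i i' : (m <= j)%N -> ~~ within (j - m) i i' -> e i i' <= q * rho ^+ (2 * m).
  move=> mj /forallPn[k]; rewrite -ltNge => hk.
  have s1 : (2^-1 ^+ (j - m)) ^+ 2 <= sqdist i i'.
    rewrite /sqdist (bigD1 k)//= -[leLHS]addr0 lerD//.
      rewrite -[leRHS]real_normK ?num_real//.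
      by apply: lerXn2r; rewrite ?nnegrE ?exprn_ge0 ?invr_ge0// ltW.
    by apply: sumr_ge0 => *; exact: sqr_ge0.
  have y0 : 0 < (2 ^+ m) ^+ 2 :> R by rewrite !exprn_gt0.
  have s2 : (2 ^+ m) ^+ 2 <= sqdist i i' * (17 * (2 ^+ j) ^+ 2).
    have e2 : 2 ^+ m = 2^-1 ^+ (j - m) * 2 ^+ j :> R.
      by rewrite -{2}(subnK mj) exprD exprVn mulKf// expf_neq0.
    have p0 : 0 <= (2 ^+ j) ^+ 2 :> R by exact: sqr_ge0.
    have h := ler_wpM2r p0 s1.
    rewrite e2 exprMn; apply: le_trans h _.
    have := mulr_ge0 (le_trans (sqr_ge0 _) s1) p0.
    set z := sqdist i i'; set w := (2 ^+ j) ^+ 2; clear; lra.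
  apply: (@le_trans _ _ (expR (- (2 ^+ m) ^+ 2))).
    by rewrite /e ler_expR mulNr lerN2.
  apply: le_trans (expRN_le_pow d.+1 y0) _.
  rewrite expr_div_n ler_wpM2l//.
  have -> : (((2 ^+ m) ^+ 2) ^+ d.+1)^-1 = (2^-1 ^+ d.+1) ^+ (2 * m) :> R.
    by rewrite -!exprM -exprVn; congr (_ ^+ _); clear; lia.
  by apply: lerXn2r; rewrite ?nnegrE ?exprn_ge0 ?invr_ge0 ?(ltW rho0).
have S m i : (m <= j)%N -> \sum_(i' | within (j - m) i i') mu i' * e i i' <=
    C * rho ^+ j * (1 + q / rho * \sum_(l < m) rho ^+ l).
  elim: m => [|m IH] mj.
    rewrite subn0 big_ord0 mulr0 addr0 mulr1.
    apply: le_trans (frost j i jn); apply: ler_sum => i' _.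
    by rewrite ler_piMr.
  rewrite (bigID (within (j - m) i))/=.
  apply: (@le_trans _ _ (\sum_(i' | within (j - m) i i') mu i' * e i i' +
       q * rho ^+ (2 * m) * \sum_(i' | within (j - m.+1) i i') mu i')).
    apply: lerD.
      apply: (@le_trans _ _ (\sum_(i' | (within (j - m.+1) i i' && within (j - m) i i')) mu i' * e i i')); first by [].
      rewrite [leRHS](bigID (within (j - m.+1) i))/= [X in _ <= X + _](eq_bigl (fun i' => within (j - m.+1) i i' && within (j - m) i i')); last first.
        by move=> i'; rewrite andbC.
      by rewrite lerDl sumr_ge0// => i' _; rewrite mulr_ge0.
    rewrite mulr_sumr [leRHS](bigID (within (j - m) i))/=.
    rewrite -[leLHS]add0r lerD//.
      by apply: sumr_ge0 => i' _; rewrite !mulr_ge0 ?exprn_ge0 ?(ltW rho0).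
    apply: ler_sum => i' /andP[_ h]; rewrite mulrC ler_wpM2r//.
    by apply: efar => //; exact: ltnW.
  have h1 := IH (ltnW mj).
  have h2 := frost (j - m.+1)%N i (leq_trans (leq_subr _ _) jn).
  have qm : 0 <= q * rho ^+ (2 * m) by rewrite mulr_ge0// exprn_ge0 ?ltW.
  have h3 := ler_wpM2l qm h2.
  apply: le_trans (lerD h1 h3) _.
  rewrite big_ord_recr/= le_eqVlt; apply/orP; left; apply/eqP.
  have -> : rho ^+ j = rho ^+ (j - m.+1) * rho ^+ m * rho.
    by rewrite -mulrA -exprSr -exprD subnK.
  have -> : rho ^+ (2 * m) = rho ^+ m * rho ^+ m by rewrite mul2n -addnn exprD.
  by field; rewrite gt_eqF.
have geom m : \sum_(l < m) rho ^+ l <= (1 - rho)^-1.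
  rewrite -[leRHS]mul1r ler_pdivlMr// mulrC -opprB mulNr -subrX1 opprB.
  by rewrite gerBl exprn_ge0// ltW.
have tot i : \sum_i' mu i' * e i i' <= (C * (1 + q / rho / (1 - rho)) + q) * rho ^+ j.
  rewrite (bigID (within 0 i))/= mulrDl; apply: lerD.
    have := S j i (leqnn j); rewrite subnn => h; apply: le_trans h _.
    rewrite mulrAC ler_wpM2r ?exprn_ge0 ?(ltW rho0)// ler_wpM2l// lerD2l.
    by rewrite ler_wpM2l ?divr_ge0 ?(ltW rho0).
  apply: (@le_trans _ _ (\sum_(i' | ~~ within 0 i i') mu i' * (q * rho ^+ j))).
    apply: ler_sum => i' h; rewrite ler_wpM2l//.
    have := @efar j i i' (leqnn j); rewrite subnn => /(_ h) h'; apply: le_trans h' _.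
    rewrite ler_wpM2l// mul2n -addnn exprD ler_piMl ?exprn_ge0 ?exprn_ile1 ?(ltW rho0) ?(ltW rho1)//.
  rewrite -mulr_suml ler_piMl ?mulr_ge0 ?exprn_ge0 ?(ltW rho0)//.
  rewrite -mu1 [leRHS](bigID (within 0 i))/= lerDr sumr_ge0//.
apply: (@le_trans _ _ (\sum_i mu i * ((C * (1 + q / rho / (1 - rho)) + q) * rho ^+ j))).
  apply: ler_sum => i _; apply: le_trans (ler_wpM2l (mu0 i) (tot i)).
  by rewrite mulr_sumr; under eq_bigr do rewrite -mulrA.
by rewrite -mulr_suml mu1 mul1r.
Qed.

(** [chirp_form_le] with nothing transformed yet, the phases [th] carrying the shift by [p]. For
    [c = (68 * t ^ 2)^-1] one has [1 / (4 c) = 17 t ^ 2] and [1 / (2 c) = 34 t ^ 2]; the factor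
    [t^-1 ^+ d] of the multiplier then leaves [(34 * t) ^ d]. *)
Lemma fejer_energy_second_diff (C p : R) (t L : nat) : (0 < t)%N -> (0 < L)%N ->
  (forall N om, 0 <= N -> `|2 * om| <= N ->
    `|\sum_(k <- index_iota (t * L) (4 * (t * L)))
        hat_coeff R d t L k * expR (- N / (2 * (1 + (k%:R / L%:R) ^+ 2))) *
        cos (- (p * (k%:R / L%:R)) - om * (k%:R / L%:R) / (1 + (k%:R / L%:R) ^+ 2))|
    <= C * (L%:R * Num.sqrt t%:R) * t%:R^-1 ^+ d * expR (- (68 * t%:R ^+ 2)^-1 * N)) ->
  `|fejer_energy p L%:R (4 * (t * L)) - 3 * fejer_energy p L%:R (2 * (t * L)) +
     2 * fejer_energy p L%:R (t * L)| <=
  2 * C * t%:R * Num.sqrt t%:R * (34 * t%:R) ^+ d *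
  (\sum_i \sum_i' mu i * mu i' * expR (- sqdist i i' * (17 * t%:R ^+ 2))) ^+ 2.
Proof.
move=> t0 L0 hC.
set n := (t * L)%N in hC *.
have n0 : (0 < n)%N by rewrite muln_gt0 t0.
have T0 : 0 < t%:R :> R by rewrite ltr0n.
have LR0 : 0 < L%:R :> R by rewrite ltr0n.
have nR0 : 0 < n%:R :> R by rewrite ltr0n.
pose c : R := (68 * t%:R ^+ 2)^-1.
have T20 : 0 < t%:R ^+ 2 :> R by rewrite exprn_gt0.
have c0 : 0 < c by rewrite invr_gt0; apply: mulr_gt0; [rewrite ltr0n|].
pose s := index_iota n (4 * n).
have := @chirp_form_le R _ M A B _ s (hat_coeff R d t L) (fun k => - (p * (k%:R / L%:R)))
  (fun k => k%:R / L%:R) c (C * (L%:R * Num.sqrt t%:R) * t%:R^-1 ^+ d) c0 hC d (fun=> 0) 0 0 (lexx 0).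
rewrite mulr0 normr0 => /(_ (lexx 0)).
rewrite mulr0 expR0 mulr1 gauss_form_prod.
have e4c (u : R) : u / (4 * c) = u * (17 * t%:R ^+ 2).
  by rewrite /c; field; rewrite gt_eqF.
under eq_bigr do under eq_bigr do rewrite e4c.
set G := (\sum_i _) ^+ 2.
set F := chirp_form _ _ _ _ _ _ _ _ _ _ _ => hF.
have -> : fejer_energy p L%:R (4 * n) - 3 * fejer_energy p L%:R (2 * n) +
     2 * fejer_energy p L%:R n = 2 * t%:R / L%:R * F.
  rewrite /fejer_energy !mulr_sumr -sumrB -big_split/=; apply: eq_bigr => v _.
  rewrite !mulr_sumr -sumrB -big_split/=; apply: eq_bigr => v' _.
  have -> : M v * M v' * cutoff v v' * (fejer (4 * n) ((quad v v' - p) / L%:R) / L%:R ^+ 2) -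
     3 * (M v * M v' * cutoff v v' * (fejer (2 * n) ((quad v v' - p) / L%:R) / L%:R ^+ 2)) +
     2 * (M v * M v' * cutoff v v' * (fejer n ((quad v v' - p) / L%:R) / L%:R ^+ 2)) =
     M v * M v' * cutoff v v' * ((fejer (4 * n) ((quad v v' - p) / L%:R)
        - 3 * fejer (2 * n) ((quad v v' - p) / L%:R) + 2 * fejer n ((quad v v' - p) / L%:R)) / L%:R ^+ 2).
    by ring.
  rewrite fejer_second_diff// [in RHS]mulrCA -!mulrA; congr (_ * (_ * _)).
  rewrite !mulr_sumr !mulr_suml !mulr_sumr; apply: eq_bigr => k _.
  rewrite subrr add0r oppr0 !mul0r expR0 mulr1 subr0 -/(cutoff v v').
  rewrite (_ : - (p * (k%:R / L%:R)) + k%:R / L%:R * pair_prod A B d v v' =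
     k%:R * ((quad v v' - p) / L%:R)); last by rewrite /quad; ring.
  rewrite /hat_coeff -/n -[_ * _ * Num.sqrt _ ^+ d]mulrA -exprMn mulVf ?expr1n ?mulr1; last first.
    by rewrite gt_eqF// sqrtr_gt0 oneDsqr_gt0.
  have -> : n%:R = t%:R * L%:R :> R by rewrite natrM.
  set u := cos _; set w := cutoff _ _; field.
  by rewrite !gt_eqF.
rewrite normrM ger0_norm; last by rewrite !mulr_ge0 ?invr_ge0 ?ltW.
have k0 : 0 <= 2 * t%:R / L%:R :> R by rewrite !mulr_ge0 ?invr_ge0 ?ltW.
apply: le_trans (ler_wpM2l k0 hF) _.
have -> : (2 * c)^-1 = 34 * t%:R ^+ 2.
  by rewrite /c; field; rewrite gt_eqF.
rewrite le_eqVlt; apply/orP; left; apply/eqP.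
have -> : (34 * t%:R ^+ 2) ^+ d = t%:R ^+ d * (34 * t%:R) ^+ d :> R.
  by rewrite -exprMn; congr (_ ^+ _); ring.
rewrite exprVn; set u := Num.sqrt _; set w := t%:R ^+ d; set z := (34 * _) ^+ d.
by field; rewrite !gt_eqF// /w exprn_gt0.
Qed.

Lemma cutoff_le1 v v' : cutoff v v' <= 1.
Proof.
rewrite -expR0 ler_expR mulNr oppr_le0 mulr_ge0 ?invr_ge0// sumr_ge0// => k _.
by rewrite addr_ge0 ?sqr_ge0.
Qed.

Lemma product_mass : \sum_v \sum_v' M v * M v' = 1.
Proof.
have e : \sum_v M v = 1.
  rewrite -(pair_bigA _ (fun i j => mu i * mu j))/=.
  under eq_bigr do rewrite -mulr_sumr mu1 mulr1.
  exact: mu1.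
under eq_bigr do rewrite -mulr_sumr e mulr1.
exact: e.
Qed.

Lemma product_weight_ge0 v v' : 0 <= M v * M v'.
Proof. by rewrite !mulr_ge0. Qed.

Lemma fejer_energy_ge0 p L n : 0 <= fejer_energy p L n.
Proof.
apply: sumr_ge0 => v _; apply: sumr_ge0 => v' _.
by rewrite !mulr_ge0 ?product_weight_ge0 ?expR_ge0 ?invr_ge0 ?sqr_ge0 ?fejer_ge0.
Qed.

Lemma fejer_energy_le p L n b :
  (forall v v', fejer n ((quad v v' - p) / L) / L ^+ 2 <= b) ->
  fejer_energy p L n <= b.
Proof.
move=> h; have b0 v v' : 0 <= fejer n ((quad v v' - p) / L) / L ^+ 2.
  by rewrite divr_ge0 ?fejer_ge0 ?sqr_ge0.
rewrite -[leRHS]mul1r -product_mass mulr_suml; apply: ler_sum => v _.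
rewrite mulr_suml; apply: ler_sum => v' _.
rewrite -mulrA ler_wpM2l ?product_weight_ge0//.
apply: le_trans (h v v'); rewrite ler_piMl// cutoff_le1//.
Qed.

Lemma near_mass_le_fejer_energy p L (j n : nat) : 0 < L -> n%:R = 2 ^+ j * L ->
  (\sum_v \sum_(v' | `|quad v v' - p| <= 2^-1 ^+ j) M v * M v' * cutoff v v') *
     (4 ^+ j * cos 1 ^+ 2) <= fejer_energy p L n.
Proof.
move=> L0 nE; rewrite mulr_suml; apply: ler_sum => v _.
rewrite mulr_suml [leRHS](bigID (fun v' => `|quad v v' - p| <= 2^-1 ^+ j))/=.
rewrite -[leLHS]addr0; apply: lerD; last first.
  apply: sumr_ge0 => v' _.
  by rewrite !mulr_ge0 ?product_weight_ge0 ?expR_ge0 ?invr_ge0 ?sqr_ge0 ?fejer_ge0.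
apply: ler_sum => v' hv; rewrite ler_wpM2l ?mulr_ge0 ?product_weight_ge0 ?expR_ge0//.
rewrite ler_pdivlMr ?exprn_gt0//.
have h : `|n%:R * ((quad v v' - p) / L)| <= 1.
  have -> : n%:R * ((quad v v' - p) / L) = 2 ^+ j * (quad v v' - p).
    by rewrite nE; field; rewrite gt_eqF.
  rewrite normrM ger0_norm ?exprn_ge0// mulrC -ler_pdivlMr ?exprn_gt0//.
  by rewrite mul1r -exprVn.
apply: le_trans (fejer_ge h).
have -> : 4 ^+ j = (2 ^+ j) ^+ 2 :> R.
  by rewrite -exprM mulnC exprM; congr (_ ^+ _); ring.
by rewrite nE -!exprMn le_eqVlt; apply/orP; left; apply/eqP; ring.
Qed.

End Energy.

Lemma exists_nat_ge (R : realType) (y : R) : exists m : nat, y <= m%:R.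
Proof. by exists (Num.truncn y).+1; rewrite ltW// truncnS_gt. Qed.

Lemma exists_exp2_ge (R : realType) (y : R) : exists m : nat, y <= 2 ^+ m.
Proof.
have [m ym] := exists_nat_ge y; exists m; apply: le_trans ym _.
by rewrite -natrX ler_nat ltnW// ltn_expl.
Qed.

Lemma sqrt_exp2 (R : realType) (i : nat) :
  Num.sqrt (2 ^+ i) = Num.sqrt 2 ^+ i :> R.
Proof. by elim: i => [|i IH]; rewrite ?sqrtr1// !exprS sqrtrM// IH. Qed.

(** At [t = 2 ^ i] the second difference is of order [t * Num.sqrt t * t ^ d * rho ^ (2 i)], which
    is [2 ^ i * r' ^ i]. The final bound is an interval length [2 ^ -j] times a small density
    [r ^ j]. The scale [n] is chosen before the measure, since the measure is built at that
    scale. *)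
Lemma energy_bound (R : realType) (d : nat) (p1 p2 rho CF : R) :
  0 < p1 -> 2^-1 ^+ d.+1 <= rho -> rho < 1 -> 0 <= CF ->
  Num.sqrt 2 * 2 ^+ d * rho ^+ 2 < 1 ->
  exists K r : R, [/\ 0 < K, 1 < 2 * r, r < 1 &
    forall (j : nat) (delta Bd : R), (2 <= j)%N -> 0 < delta -> exists n : nat,
    forall (I : finType) (mu : I -> R) (x : nat -> I -> R),
      (forall i, 0 <= mu i) -> \sum_i mu i = 1 ->
      (forall m i, (m <= n)%N ->
         \sum_(i' | within x d m i i') mu i' <= CF * rho ^+ m) ->
    forall p, p1 <= p <= p2 ->
      (forall v v', delta <= `|quad x d v v' - p| <= Bd) ->
      \sum_v \sum_(v' | `|quad x d v v' - p| <= 2^-1 ^+ j)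
         mu v.1 * mu v.2 * (mu v'.1 * mu v'.2) * cutoff x d v v'
      <= K * (r / 2) ^+ j].
Proof.
move=> p10 rhod rho1 CF0 r1.
have [C C0 hC] := @hat_coeff_sum_bound R d p1 p2 p10.
have c1 := cos1_gt0 R; have c1' : 0 < cos 1 ^+ 2 :> R by rewrite exprn_gt0.
have rho0 : 0 < rho by apply: lt_le_trans rhod; rewrite exprn_gt0// invr_gt0.
set r' := Num.sqrt 2 * 2 ^+ d * rho ^+ 2 in r1.
have r'0 : 0 <= r' by rewrite /r' !mulr_ge0 ?exprn_ge0 ?(ltW rho0).
(* The maximum with [3 / 4] secures [1 < 2 * r]. *)
pose r := Num.max r' (3 / 4).
have rr : r < 1 by rewrite /r gt_max r1/=; lra.
have r2 : 1 < 2 * r by have : 3 / 4 <= r by [rewrite /r le_max lexx orbT]; lra.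
have r'r : r' <= r by rewrite /r le_max lexx.
pose G1 := CF * (1 + d.+1%:R ^+ d.+1 / rho / (1 - rho)) + d.+1%:R ^+ d.+1.
pose K0 := 2 * C * 34 ^+ d * G1 ^+ 2.
have K00 : 0 <= K0.
  by rewrite /K0 mulr_ge0 ?sqr_ge0// mulr_ge0 ?exprn_ge0 ?ler0n// mulr_ge0// ltW.
pose K1 := K0 / (1 - r) / (2 * r - 1).
have K10 : 0 <= K1 by rewrite /K1 !divr_ge0//; lra.
(* [17] is [16] from [U 2 <= 4 ^ 2] plus [1] from [eps * 2 ^ j] with [eps = 2 ^ -j]; [cos 1 ^+ 2]
   comes from the lower bound for Fejer kernels. *)
exists ((17 + K1) / cos 1 ^+ 2), r; split => //.
  by rewrite divr_gt0//; lra.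
move=> j delta Bd j2 delta0.
(* Makes [2 ^ J] so large that the bound for Fejer kernels at distance [delta], which does not
   depend on the order, is at most [2 ^ -j * 2 ^ J.+1]. *)
have [m0 hm0] := exists_exp2_ge (4 / (cos 1 ^+ 2 * delta ^+ 2) * 2 ^+ j).
pose J := (j + m0)%N.
exists J => I mu x mu0 mu1 frost p pp hq.
have [l hl] := exists_nat_ge (Num.max (2 * p2) Bd).
(* [L] dominates [2 * p2] and [68 * t] at every scale used, as the multiplier bound requires, and
   also [Bd], so that [(quad - p) / L] stays well within one period of the kernel. *)
pose L := (l + 68 * 2 ^ J)%N.
have L0 : (0 < L)%N by rewrite /L addn_gt0 muln_gt0 expn_gt0 orbT.
have LR0 : 0 < L%:R :> R by rewrite ltr0n.
have lL : l%:R <= L%:R :> R by rewrite ler_nat leq_addr.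
have p2L : 2 * p2 <= L%:R by apply: le_trans lL; apply: le_trans hl; rewrite le_max lexx.
have BL : Bd <= L%:R by apply: le_trans lL; apply: le_trans hl; rewrite le_max lexx orbT.
pose U i := fejer_energy mu x d p L%:R (2 ^ i * L).
have U0 i : 0 <= U i by exact: fejer_energy_ge0.
have expS i : (2 ^ i.+1 * L = 2 * (2 ^ i * L))%N by rewrite expnS mulnA.
have UD i : (2 <= i <= J)%N -> `|U i.+2 - 3 * U i.+1 + 2 * U i| <= K0 * 2 ^+ i * r ^+ i.
  move=> /andP[i2 iJ].
  have t4 : (4 <= 2 ^ i)%N by rewrite (_ : 4 = 2 ^ 2)%N// leq_exp2l.
  have tL : (68 * 2 ^ i <= L)%N.
    by apply: leq_trans (leq_addl _ _); rewrite leq_mul2l leq_exp2l.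
  have hh N om (N0 : 0 <= N) (hN : `|2 * om| <= N) := hC p om N (2 ^ i)%N L pp t4 p2L tL N0 hN.
  have t0 : (0 < 2 ^ i)%N by rewrite expn_gt0.
  have := fejer_energy_second_diff mu x t0 L0 hh.
  rewrite /U !expS (mulnA 2 2) => h; apply: le_trans h _.
  have tE : (2 ^ i)%:R = 2 ^+ i :> R by rewrite natrX.
  rewrite tE.
  have hG := gauss_sum_le mu0 mu1 rhod rho1 CF0 frost iJ.
  rewrite -/G1 in hG; move: hG; set S := \sum_i _ => hS.
  have S0 : 0 <= S.
    by apply: sumr_ge0 => a _; apply: sumr_ge0 => b _; rewrite !mulr_ge0 ?expR_ge0.
  have hS2 : S ^+ 2 <= (G1 * rho ^+ i) ^+ 2.
    by apply: lerXn2r; rewrite ?nnegrE// (le_trans S0).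
  have c00 : 0 <= 2 * C * 2 ^+ i * Num.sqrt (2 ^+ i) * (34 * 2 ^+ i) ^+ d.
    by rewrite !mulr_ge0 ?(ltW C0) ?exprn_ge0 ?sqrtr_ge0// mulr_ge0 ?ler0n ?exprn_ge0.
  apply: le_trans (ler_wpM2l c00 hS2) _.
  have -> : 2 * C * 2 ^+ i * Num.sqrt (2 ^+ i) * (34 * 2 ^+ i) ^+ d * (G1 * rho ^+ i) ^+ 2 =
     K0 * 2 ^+ i * r' ^+ i.
    rewrite /K0 /r' sqrt_exp2 !exprMn (_ : (2 ^+ i) ^+ d = (2 ^+ d) ^+ i); last first.
      by rewrite -!exprM mulnC.
    move: (34 ^+ d) ((2 ^+ d) ^+ i) (rho ^+ i) (Num.sqrt 2 ^+ i) (2 ^+ i).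
    by clear=> *; ring.
  apply: ler_wpM2l; first by rewrite mulr_ge0 ?exprn_ge0.
  by apply: lerXn2r; rewrite ?nnegrE// (le_trans r'0).
have UJ : U J.+2 <= 2^-1 ^+ j * 2 ^+ J.+1.
  apply: (@le_trans _ _ (4 / (cos 1 ^+ 2 * delta ^+ 2))); last first.
    rewrite exprVn [leRHS]mulrC ler_pdivlMr ?exprn_gt0//; apply: le_trans hm0 _.
    by rewrite ler_eXn2l ?ltr1n// /J; clear; lia.
  apply: fejer_energy_le => // v v'; have /andP[h1 h2] := hq v v'.
  set z := quad x d v v' - p in h1 h2 *.
  have z0 : 0 < `|z / L%:R| <= 2.
    have zd := lt_le_trans delta0 h1.
    rewrite normrM normfV (ger0_norm (ltW LR0)) divr_gt0//=.
    by rewrite ler_pdivrMr//; move: h2 BL LR0; clear; lra.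
  have := fejer_le_inv (2 ^ J.+2 * L) z0.
  move=> h; rewrite ler_pdivrMr ?exprn_gt0//; apply: le_trans h _.
  have zz : 0 < z ^+ 2 by rewrite -(real_normK (num_real z)) exprn_gt0// (lt_le_trans delta0 h1).
  rewrite (_ : 4 / (cos 1 ^+ 2 * (z / L%:R) ^+ 2) = 4 / (cos 1 ^+ 2 * z ^+ 2) * L%:R ^+ 2); last first.
    have zn : z != 0 by move: zz; case: eqP => // ->; rewrite expr0n ltxx.
    by field; rewrite zn !gt_eqF.
  rewrite ler_wpM2r ?sqr_ge0// ler_wpM2l// lef_pV2 ?posrE; first last.
  - by rewrite mulr_gt0// exprn_gt0.
  - by rewrite mulr_gt0.
  rewrite ler_wpM2l ?(ltW c1')// -(real_normK (num_real z)).
  by apply: lerXn2r; rewrite ?nnegrE ?(ltW delta0).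
have hj : (2 <= j <= J)%N by rewrite j2 leq_addr.
have := bootstrap_bound K00 r2 rr U0 UD UJ hj.
rewrite -/K1 (_ : 2^-1 ^+ j * 2 ^+ j = 1); last by rewrite exprVn mulVf// expf_neq0.
have U2 : U 2 <= 16.
  apply: fejer_energy_le => // v v'; rewrite ler_pdivrMr ?exprn_gt0//.
  apply: le_trans (fejer_le _ _) _.
  by rewrite natrM exprMn (_ : (2 ^ 2)%:R ^+ 2 = 16 :> R)// -natrX.
have nE : (2 ^ j * L)%:R = 2 ^+ j * L%:R :> R by rewrite natrM natrX.
have := @near_mass_le_fejer_energy _ _ mu x d mu0 p _ j _ LR0 nE.
rewrite -/(U j); set S := \sum_v _ => hS hU.
have y1 : 1 <= (2 * r) ^+ j by rewrite exprn_ege1// ltW.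
have hU' : U j <= (17 + K1) * (2 * r) ^+ j.
  by rewrite mulrDl; move: hU U2 y1; set y := (2 * r) ^+ j; set z := K1 * y; clear; lra.
have := le_trans hS hU'.
have -> : (2 * r) ^+ j = (r / 2) ^+ j * 4 ^+ j.
  by rewrite -exprMn; congr (_ ^+ _); field.
move=> h.
rewrite mulrAC ler_pdivlMr// -(@ler_pM2r _ (4 ^+ j)) ?exprn_gt0//.
by apply: (le_trans _ (le_trans h _)); rewrite le_eqVlt; apply/orP; left; apply/eqP; ring.
Qed.

(** * A discrete Frostman lemma *)

Section FrostmanTree.
Variables (R : realType) (V : finType) (K : eqType) (cell : nat -> V -> K) (c : nat -> R).
Hypothesis cell_refine : forall k x y, cell k.+1 x = cell k.+1 y -> cell k x = cell k y.
Hypothesis c_gt0 : forall k, 0 < c k.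

Lemma cell_coarsen k l x y : (k <= l)%N -> cell l x = cell l y -> cell k x = cell k y.
Proof.
move=> kl; rewrite -(subnKC kl); elim: (l - k)%N => [|i IH]; first by rewrite addn0.
by rewrite addnS => /cell_refine.
Qed.

Definition cell_mass (mu : V -> R) k x := \sum_(y | cell k y == cell k x) mu y.

(** [l x] is the level of a cell around [x] carrying the full permitted mass. By the fourth clause
    these cells partition [V]; they will be the cover whose Hausdorff sum bounds the total mass from
    below. *)
Definition saturated m n (mu : V -> R) (l : V -> nat) :=
  [/\ forall x, 0 <= mu x,
      forall k x, (m <= k <= n)%N -> cell_mass mu k x <= c k,
      forall x, (m <= l x <= n)%N,
      forall x y, cell (l x) y = cell (l x) x -> l y = l x &
      forall x, cell_mass mu (l x) x = c (l x)].

Lemma cell_mass_eq mu k x y : cell k x = cell k y -> cell_mass mu k x = cell_mass mu k y.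
Proof. by move=> e; rewrite /cell_mass e. Qed.

(* One step down the tree: the cells of level [m] that are too heavy are
   rescaled, and become the saturated cells of their points. *)
Lemma saturated_step m n mu l : (m < n)%N ->
  saturated m.+1 n mu l -> exists mu' l', saturated m n mu' l'.
Proof.
move=> mn [mu0 muc lmn lcell lsat].
pose heavy x := c m < cell_mass mu m x.
have heavyE x y : cell m x = cell m y -> heavy x = heavy y.
  by move=> e; rewrite /heavy (cell_mass_eq _ e).
pose f x := if heavy x then c m / cell_mass mu m x else 1.
have fE x y : cell m x = cell m y -> f x = f y.
  by move=> e; rewrite /f (heavyE _ _ e) (cell_mass_eq _ e).
have f01 x : 0 <= f x <= 1.
  rewrite /f; case: ifP => [h|_]; last by rewrite lexx ler01.
  have h0 : 0 < cell_mass mu m x by apply: lt_trans h.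
  by rewrite divr_ge0 ?(ltW h0) ?(ltW (c_gt0 m))//= ler_pdivrMr// mul1r ltW.
have massE k x : (m <= k)%N ->
    cell_mass (fun y => f y * mu y) k x = f x * cell_mass mu k x.
  move=> mk; rewrite /cell_mass mulr_sumr; apply: eq_bigr => y /eqP e.
  by rewrite (fE y x)//; exact: cell_coarsen e.
have mass0 k x : 0 <= cell_mass mu k x by exact: sumr_ge0.
exists (fun x => f x * mu x), (fun x => if heavy x then m else l x).
split.
- by move=> x; rewrite mulr_ge0//; have /andP[] := f01 x.
- move=> k x /andP[mk kn]; rewrite massE//; have /andP[f0 f1] := f01 x.
  have [->|ne] := eqVneq k m.
    rewrite /f; case: ifPn => [h|]; last by rewrite /heavy -leNgt mul1r.
    by rewrite divfK// gt_eqF//; apply: lt_trans h.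
  have := muc k x ltac:(clear -mk kn ne; lia).
  by apply: le_trans; rewrite ler_piMl.
- by move=> x; have := lmn x; case: ifP => _; clear -mn; lia.
- move=> x y; case: ifP => [h|h] e; first by rewrite (heavyE y x) ?h.
  have lx := lmn x.
  rewrite (heavyE y x) ?h; first exact: lcell.
  by apply: cell_coarsen e; clear -lx; lia.
- move=> x; have lx := lmn x; case: ifP => h.
    rewrite massE// /f h divfK// gt_eqF//; exact: lt_trans h.
  by rewrite massE ?lsat /f ?h ?mul1r//; clear -lx; lia.
Qed.

(** At level [n] the cells are singletons, and mass [c n] on each saturates them; [saturated_step]
    then runs to the coarsest level [m]. *)
Lemma saturated_exists m n : (m <= n)%N ->
  (forall x y, cell n x = cell n y -> x = y) ->
  exists mu l, saturated m n mu l.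
Proof.
move=> mn inj.
have : saturated n n (fun=> c n) (fun=> n).
  have one x : cell_mass (fun=> c n) n x = c n.
    rewrite /cell_mass (big_pred1 x)// => y.
    by apply/eqP/eqP => [/inj|->].
  split => // [x|k x h|x]; first exact: ltW; last by rewrite leqnn.
  by rewrite (_ : k = n) ?one//; clear -h; lia.
move=> h0; have : forall i, (i <= n - m)%N -> exists mu l, saturated (n - i) n mu l.
  elim=> [|i IH] hi; first by exists (fun=> c n), (fun=> n); rewrite subn0.
  have [mu [l]] := IH (ltnW hi).
  have -> : (n - i = (n - i.+1).+1)%N by clear -hi mn; lia.
  by apply: saturated_step; clear -hi mn; lia.
by move=> /(_ (n - m)%N (leqnn _)); rewrite subKn.
Qed.

(** A canonical point of the saturated cell of [x]. [pick] always succeeds, as [x] qualifies, so its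
    result depends on the cell alone. *)
Definition cell_rep (l : V -> nat) x := odflt x [pick y | cell (l x) y == cell (l x) x].

Lemma cell_repP l x : cell (l x) (cell_rep l x) = cell (l x) x.
Proof.
rewrite /cell_rep; case: pickP => [y /eqP//|/(_ x)].
by rewrite eqxx.
Qed.

Lemma cell_rep_eq (l : V -> nat) x y :
  (forall x y, cell (l x) y = cell (l x) x -> l y = l x) ->
  cell (l x) y = cell (l x) x -> cell_rep l y = cell_rep l x.
Proof.
move=> lcell e; rewrite /cell_rep (lcell _ _ e) e; case: pickP => //= /(_ x).
by rewrite eqxx.
Qed.

(** The saturated cells are the fibres of [cell_rep], indexed by its fixed points. *)
Lemma saturated_total m n mu l : saturated m n mu l ->
  \sum_x mu x = \sum_(r | cell_rep l r == r) c (l r).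
Proof.
move=> [mu0 muc lmn lcell lsat].
have repE x y : cell (l x) y = cell (l x) x -> cell_rep l y = cell_rep l x.
  exact: cell_rep_eq.
have repK x : cell_rep l (cell_rep l x) = cell_rep l x.
  by apply: repE; exact: cell_repP.
rewrite (partition_big (cell_rep l) (fun r => cell_rep l r == r))/=; last first.
  by move=> x _; rewrite repK.
apply: eq_bigr => r /eqP rr; rewrite -lsat; apply: eq_bigl => x.
apply/eqP/eqP => [<-|e]; last by rewrite (repE r x).
by rewrite (lcell x) ?cell_repP//.
Qed.

End FrostmanTree.

(** * Dyadic cubes *)

Lemma coord_norm_le (R : realType) (d : nat) (x : 'rV[R]_d) (i : 'I_d) :
  `|x ord0 i| <= `|x|.
Proof.
by rewrite [leRHS]mx_normE -[leLHS]nngE num_le; exact: (le_bigmax _ _ (ord0, i)).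
Qed.

Section DyadicCells.
Variables (R : realType) (d : nat) (B : R).
Implicit Types e f : 'rV[R]_d.

(* Translating by [B] makes the coordinates nonnegative, so that [truncn] is the floor. *)
Definition dyadic_cell (k : nat) e : {ffun 'I_d -> nat} :=
  [ffun i => Num.truncn (2 ^+ k * (e ord0 i + B))].

Definition in_box e := forall i : 'I_d, `|e ord0 i| <= B.

Lemma shift_ge0 k e i : in_box e -> 0 <= 2 ^+ k * (e ord0 i + B).
Proof.
move=> /(_ i); rewrite ler_norml => /andP[h _].
by rewrite mulr_ge0 ?exprn_ge0//; lra.
Qed.

Lemma truncn_double (a : R) : 0 <= a -> Num.truncn a = (Num.truncn (2 * a))./2.
Proof.
move=> a0; apply: truncn_def.
have /andP[h1 h2] := truncn_itv (mulr_ge0 (ler0n R 2) a0).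
set n := Num.truncn _ in h1 h2 *.
have e : n%:R = (odd n)%:R + 2 * n./2%:R :> R.
  by rewrite -{1}(odd_double_half n) natrD -mul2n natrM.
move: h1 h2; rewrite -!(natr1 n) e -(natr1 n./2).
by case: (odd n) => /=; set z := n./2%:R; lra.
Qed.

Lemma dyadic_cell_refine k e f : in_box e -> in_box f ->
  dyadic_cell k.+1 e = dyadic_cell k.+1 f -> dyadic_cell k e = dyadic_cell k f.
Proof.
move=> be bf /ffunP h; apply/ffunP => i; move: (h i); rewrite !ffunE.
rewrite exprS -!mulrA => h'.
by rewrite (truncn_double (shift_ge0 k i be)) (truncn_double (shift_ge0 k i bf)) h'.
Qed.

Lemma dyadic_cell_close k e f : in_box e -> in_box f ->
  dyadic_cell k e = dyadic_cell k f -> forall i, `|e ord0 i - f ord0 i| <= 2^-1 ^+ k.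
Proof.
move=> be bf /ffunP h i; move: (h i); rewrite !ffunE => {}h.
have /andP[h1 h2] := truncn_itv (shift_ge0 k i be).
have /andP[h3 h4] := truncn_itv (shift_ge0 k i bf).
rewrite h in h1 h2; set n := Num.truncn _ in h1 h2 h3 h4.
have p : 0 < 2 ^+ k :> R by rewrite exprn_gt0.
rewrite exprVn -[leRHS]mul1r ler_pdivlMr// -(ger0_norm (ltW p)) -normrM.
move: h1 h2 h3 h4; rewrite -(natr1 n) ler_norml.
set y := 2 ^+ k; clear; nra.
Qed.

(** Coordinates of the two cells differ by at most 1. The shift by one stores the difference in
    [{0, 1, 2}], avoiding subtraction, and makes the [3 ^ d] neighbours a finite type. *)
Lemma dyadic_cell_near k e f : in_box e -> in_box f ->
  (forall i, `|e ord0 i - f ord0 i| <= 2^-1 ^+ k) ->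
  exists g : {ffun 'I_d -> 'I_3}, forall i,
    ((dyadic_cell k f i).+1 = dyadic_cell k e i + g i)%N.
Proof.
move=> be bf h.
suff H i : exists g : 'I_3, ((dyadic_cell k f i).+1 = dyadic_cell k e i + g)%N.
  have [g hg] := boolp.choice H.
  by exists [ffun i => g i] => i; rewrite hg [[ffun i0 => g i0] i]ffunE.
rewrite !ffunE.
have /andP[h1 h2] := truncn_itv (shift_ge0 k i be).
have /andP[h3 h4] := truncn_itv (shift_ge0 k i bf).
set n := Num.truncn _ in h1 h2 *; set m := Num.truncn _ in h3 h4 *.
have p : 0 < 2 ^+ k :> R by rewrite exprn_gt0.
have := h i; rewrite exprVn -[leRHS]mul1r ler_pdivlMr// -(ger0_norm (ltW p)) -normrM.
rewrite ler_norml => /andP[a1 a2].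
have b1 : n%:R < m.+2%:R :> R.
  by rewrite -(natr1 m.+1); move: h1 h4 a2; set y := 2 ^+ k; clear; nra.
have b2 : m%:R < n.+2%:R :> R.
  by rewrite -(natr1 n.+1); move: h2 h3 a1; set y := 2 ^+ k; clear; nra.
rewrite !ltr_nat in b1 b2.
have hg : (m.+1 - n < 3)%N by clear -b1 b2; lia.
by exists (Ordinal hg) => /=; clear -b1 b2; lia.
Qed.

Lemma edist_le k e f : (forall i, `|e ord0 i - f ord0 i| <= 2^-1 ^+ k) ->
  Defs.edist e f <= Num.sqrt d%:R * 2^-1 ^+ k.
Proof.
move=> h; have p : 0 <= 2^-1 ^+ k :> R by rewrite exprn_ge0.
rewrite -[X in _ * X](ger0_norm p) -sqrtr_sqr -sqrtrM// ler_wsqrtr//.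
apply: (@le_trans _ _ (\sum_(i < d) (2^-1 ^+ k) ^+ 2)).
  apply: ler_sum => i _; rewrite !mxE -expr2 -[leLHS]real_normK ?num_real//.
  by apply: lerXn2r; rewrite ?nnegrE.
by rewrite sumr_const card_ord mulr_natl.
Qed.

End DyadicCells.

(** * Hausdorff sums of finite covers *)

Section HausdorffCover.
Variables (R : realType) (d : nat).
Implicit Types (U E : set 'rV[R]_d) (s delta : R).
Local Open Scope ereal_scope.

Lemma edist_ge0 (x y : 'rV[R]_d) : (0 <= Defs.edist x y)%R.
Proof. exact: sqrtr_ge0. Qed.

Lemma ediam_ge0 U : U !=set0 -> 0 <= ediam U.
Proof.
move=> [x Ux]; apply: (@le_trans _ _ (Defs.edist x x)%:E).
  by rewrite lee_fin edist_ge0.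
by apply: ereal_sup_ubound; exists x => //; exists x.
Qed.

Lemma ediam_le U (D : R) : (forall x y, U x -> U y -> (Defs.edist x y <= D)%R) -> ediam U <= D%:E.
Proof.
by move=> h; apply: ge_ereal_sup => _ [x Ux [y Uy <-]]; rewrite lee_fin h.
Qed.

Lemma hcontrib_ge0 s U : 0 <= hcontrib s U.
Proof. by rewrite /hcontrib; case: asbool => //; rewrite lee_fin powR_ge0. Qed.

Lemma hcontrib_le s U (D : R) : (0 <= s)%R -> (0 <= D)%R -> ediam U <= D%:E ->
  hcontrib s U <= (D `^ s)%:E.
Proof.
move=> s0 D0 UD; rewrite /hcontrib; case: asboolP => [_|U0].
  by rewrite lee_fin powR_ge0.
have /set0P/ediam_ge0 d0 : U != set0 by apply/eqP.
have dfin : ediam U \is a fin_num by rewrite ge0_fin_numE// (le_lt_trans UD)// ltry.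
rewrite lee_fin ge0_ler_powR ?nnegrE ?fine_ge0//.
by rewrite -lee_fin fineK.
Qed.

Lemma hausdorff_delta_ge0 s delta E : 0 <= hausdorff_delta s delta E.
Proof.
apply: le_ereal_inf_tmp => _ [U _ <-].
by apply: nneseries_ge0 => i _ _; exact: hcontrib_ge0.
Qed.

Lemma hausdorff_delta_gt0 s E : hausdorff s E != 0 ->
  exists delta, [/\ (0 < delta)%R & 0 < hausdorff_delta s delta E].
Proof.
move=> h; apply: contrapT => hn; move/eqP: h; apply.
apply/eqP; rewrite eq_le; apply/andP; split.
  apply: ge_ereal_sup => _ [delta /= d0 <-].
  by rewrite leNgt; apply/negP => h; apply: hn; exists delta.
apply: le_trans (hausdorff_delta_ge0 s 1 E) _.
by apply: ereal_sup_ubound; exists 1%R => /=.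
Qed.

Lemma hausdorff_delta_finite_cover s delta E (V : finType) (P : pred V)
    (U : V -> set 'rV[R]_d) (D : V -> R) :
  (0 <= s)%R ->
  (forall x, E x -> exists r, P r /\ U r x) ->
  (forall r, (0 <= D r <= delta)%R) -> (forall r, ediam (U r) <= (D r)%:E) ->
  hausdorff_delta s delta E <= (\sum_(r | P r) D r `^ s)%:E.
Proof.
move=> s0 cov Dd UD.
(* The finite cover becomes a sequence by padding with the empty set, of diameter [-oo] and
   contribution [0]. *)
pose L := [seq U r | r <- enum P].
pose W i := nth set0 L i.
apply: (@le_trans _ _ (\sum_(0 <= i <oo) hcontrib s (W i))).
  apply: ereal_inf_lbound; exists W => //; split.
    move=> x /cov[r [Pr Ur]]; exists (index r (enum P)) => //.
    rewrite /W /L (nth_map r) ?index_mem ?mem_enum// nth_index ?mem_enum//.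
  move=> i; rewrite /W; have [iL|iL] := ltnP i (size L).
    have /mapP[r _ ->] := mem_nth set0 iL.
    by apply: le_trans (UD r) _; rewrite lee_fin; have /andP[] := Dd r.
  by rewrite nth_default// /ediam (_ : [set _ | _ in _ & _ in _] = set0) ?ereal_sup0 ?leNye// -subset0 => y [].
rewrite (nneseries_split 0%N (size L)); last by move=> *; exact: hcontrib_ge0.
rewrite eseries0 ?adde0; last first.
  move=> i iL _; rewrite /W nth_default// /hcontrib; case: asboolP => //.
rewrite add0n -(big_nth set0 xpredT (hcontrib s)) /L big_map big_enum/=.
rewrite -sumEFin; apply: lee_sum => r Pr.
by apply: hcontrib_le => //; have /andP[] := Dd r.
Qed.

End HausdorffCover.

(** * Frostman measures on a compact set *)

Lemma dyadic_cell_coarsen (R : realType) (d : nat) (B : R) (k l : nat) (e f : 'rV[R]_d) :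
  in_box B e -> in_box B f -> (k <= l)%N ->
  dyadic_cell B l e = dyadic_cell B l f -> dyadic_cell B k e = dyadic_cell B k f.
Proof.
move=> be bf kl; rewrite -(subnKC kl).
elim: (l - k)%N => [|i IH]; first by rewrite addn0.
by rewrite addnS => /(dyadic_cell_refine be bf).
Qed.

(* Junk value [0] for [k >= d]. *)
Definition coordinate (R : realType) (d : nat) (x : 'rV[R]_d) (k : nat) : R :=
  if insub k is Some i then x ord0 i else 0.

Lemma coordinateE (R : realType) (d : nat) (x : 'rV[R]_d) (i : 'I_d) :
  coordinate x i = x ord0 i.
Proof. by rewrite /coordinate valK. Qed.

Lemma compact_in_box (R : realType) (d : nat) (E : set 'rV[R]_d) : compact E ->
  exists2 B : R, 0 <= B & forall e, E e -> in_box B e.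
Proof.
move=> /compact_bounded [M [_ hM]].
exists (`|M| + 1); first by rewrite addr_ge0.
move=> e Ee i; apply: le_trans (coord_norm_le e i) _.
by apply: hM Ee; rewrite (le_lt_trans (ler_norm _))// ltrDl.
Qed.

Lemma exprn_powR (R : realType) (a s : R) (k : nat) : 0 <= a ->
  (a ^+ k) `^ s = (a `^ s) ^+ k.
Proof. by move=> a0; rewrite -powR_mulrn// powRAC powR_mulrn// powR_ge0. Qed.

(** The total mass of the saturated measure is, up to the factor [kap], the Hausdorff sum of the
    cover by saturated cells. It is thus bounded below uniformly in [n], and normalising it costs a
    constant. A ball of [within] is covered by [3 ^ d] dyadic cells. *)
Lemma frostman (R : realType) (d : nat) (E : set 'rV[R]_d) (s : R) :
  compact E -> 0 <= s -> hausdorff s E != 0%E ->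
  exists2 CF : R, 0 <= CF & forall n : nat,
    exists (I : finType) (mu : I -> R) (P : I -> 'rV[R]_d),
      [/\ forall i, E (P i), forall i, 0 <= mu i, \sum_i mu i = 1 &
        forall m i, (m <= n)%N ->
          \sum_(i' | within (fun k j => coordinate (P j) k) d m i i') mu i' <=
            CF * (2^-1 `^ s) ^+ m].
Proof.
move=> cE s0 hE.
have [B B0 EB] := compact_in_box cE.
have [delta [delta0 hd]] := hausdorff_delta_gt0 hE.
(* A real lower bound is extracted because the infimum may be [+oo]. *)
have [eta eta0 etah] : exists2 eta : R, 0 < eta & (eta%:E <= hausdorff_delta s delta E)%E.
  case: (hausdorff_delta s delta E) hd => [r r0|_|//]; first by exists r.
  by exists 1 => //; rewrite leey.
(* From level [m0] on, cells have Euclidean diameter at most [delta] and are admissible in the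
   cover. *)
have [m0 hm0] := exists_exp2_ge (Num.sqrt d%:R / delta).
set rho : R := 2^-1 `^ s.
have rho0 : 0 < rho by apply: powR_gt0.
have rho1 : rho <= 1.
  have e1 : 1 `^ s = 1 :> R by rewrite powR1.
  by rewrite /rho -[leRHS]e1 ge0_ler_powR ?nnegrE// invf_le1// ler1n.
pose kap := (Num.sqrt d%:R : R) `^ s.
have kap0 : 0 <= kap by exact: powR_ge0.
pose theta := eta / (kap + 1).
have theta0 : 0 < theta by rewrite divr_gt0//; lra.
(* The first term normalises the bound at levels from [m0] on, [theta] being a lower bound for the
   total mass; below [m0] the total mass [1] suffices, through the second term. *)
pose C1 := theta^-1 + (rho ^+ m0)^-1.
have rm0 : 0 < rho ^+ m0 by rewrite exprn_gt0.
have C10 : 0 <= C1 by rewrite addr_ge0 ?invr_ge0 ?ltW.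
exists ((3 ^ d)%:R * C1); first by rewrite mulr_ge0.
move=> n0; pose n := maxn n0 m0.
have m0n : (m0 <= n)%N by rewrite leq_maxr.
pose N := (Num.truncn (2 ^+ n * (B + B))).+1.
pose T := {ffun 'I_d -> 'I_N}.
(* The points of the tree are the cells of level [n] that meet [E], each represented by a point of
   [E]. *)
pose good (f : T) := `[< exists e, E e /\ forall i, dyadic_cell B n e i = f i >].
pose V := {f : T | good f}.
have HP (v : V) : exists e, E e /\ forall i, dyadic_cell B n e i = val v i.
  by case: v => f hf; apply/asboolP.
have [P hP] := boolp.choice HP.
have EP v : E (P v) by have [] := hP v.
have PB v : in_box B (P v) by apply: EB.
pose cell k v := dyadic_cell B k (P v).
have cell_ref k x y : cell k.+1 x = cell k.+1 y -> cell k x = cell k y.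
  exact: dyadic_cell_refine.
have cell_inj x y : cell n x = cell n y -> x = y.
  move=> /ffunP h; apply: val_inj; apply/ffunP => i; apply: val_inj.
  have [_ hx] := hP x; have [_ hy] := hP y.
  by rewrite /= -[LHS]hx -[RHS]hy; exact: h.
have cov e : E e -> exists v : V, cell n v = dyadic_cell B n e.
  move=> Ee; have be := EB e Ee.
  have hN i : (dyadic_cell B n e i < N)%N.
    rewrite ffunE ltnS le_truncn// ler_wpM2l ?exprn_ge0// lerD2r.
    by have := be i; rewrite ler_norml => /andP[].
  pose f : T := [ffun i => Ordinal (hN i)].
  have gf : good f by apply/asboolP; exists e; split => // i; rewrite [f i]ffunE.
  exists (exist _ f gf); apply/ffunP => i.
  have [_ ->] := hP (exist _ f gf).
  by rewrite /= [f i]ffunE.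
have c0 k : 0 < rho ^+ k by rewrite exprn_gt0.
have [mu [l sat]] := saturated_exists cell_ref c0 m0n cell_inj.
have [mu0 muc lmn lcell lsat] := sat.
have tot := saturated_total sat.
set tau := \sum_x mu x in tot.
have tau_ge : eta <= kap * tau.
  have := @hausdorff_delta_finite_cover R d s delta E V (fun r => cell_rep cell l r == r)
    (fun r => [set e | E e /\ dyadic_cell B (l r) e = cell (l r) r])
    (fun r => Num.sqrt d%:R * 2^-1 ^+ l r) s0.
  move=> hcov; rewrite -lee_fin; apply: le_trans etah (le_trans (hcov _ _ _) _).
  - move=> e Ee; have [v hv] := cov e Ee.
    exists (cell_rep cell l v).
    have hr := cell_repP cell l v; have lr := lcell _ _ hr.
    split.
      by apply/eqP; exact: cell_rep_eq lcell hr.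
    split => //; rewrite lr hr.
    apply: (@dyadic_cell_coarsen _ _ _ _ n) => //; first exact: EB.
    by have /andP[] := lmn v.
  - move=> r; rewrite mulr_ge0 ?sqrtr_ge0 ?exprn_ge0//=.
    have /andP[h _] := lmn r.
    have h2 : 0 < 2 ^+ m0 :> R by rewrite exprn_gt0.
    apply: (@le_trans _ _ (Num.sqrt d%:R * 2^-1 ^+ m0)).
      by rewrite ler_wpM2l ?sqrtr_ge0// ler_wiXn2l ?invf_le1 ?ler1n.
    rewrite exprVn ler_pdivrMr// mulrC -ler_pdivrMr//.
  - move=> r; apply: ediam_le => x y [Ex hx] [Ey hy].
    apply: edist_le; apply: (dyadic_cell_close (EB x Ex) (EB y Ey)).
    by rewrite hx hy.
  rewrite lee_fin tot mulr_sumr; apply: ler_sum => r _.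
  by rewrite powRM ?sqrtr_ge0 ?exprn_ge0// exprn_powR.
have tau_theta : theta <= tau.
  have tau0 : 0 <= tau by exact: sumr_ge0.
  by rewrite ler_pdivrMr; lra.
have tau0 : 0 < tau by apply: lt_le_trans tau_theta.
exists V, (fun v => mu v / tau), P.
have mu0' v : 0 <= mu v / tau by rewrite divr_ge0 ?(ltW tau0).
have mu1 : \sum_v mu v / tau = 1 by rewrite -mulr_suml mulfV// gt_eqF.
split => // m i mn.
have cellb k x : (k <= n)%N -> \sum_(y | cell k y == cell k x) mu y / tau <= C1 * rho ^+ k.
  move=> kn; have [mk|mk] := leqP m0 k.
    rewrite -mulr_suml ler_pdivrMr//.
    apply: le_trans (muc k x _) _; first by rewrite mk.
    rewrite mulrAC ler_peMl ?(ltW (c0 _))//.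
    apply: le_trans (ler_wpM2l C10 tau_theta).
    rewrite /C1 mulrDl mulVf ?gt_eqF// lerDl.
    by rewrite mulr_ge0 ?invr_ge0 ?ltW.
  apply: (@le_trans _ _ 1).
    rewrite -mu1 [leRHS](bigID (fun y => cell k y == cell k x))/= lerDl sumr_ge0//.
  rewrite /C1 mulrDl -[leLHS]add0r lerD//.
    by rewrite mulr_ge0 ?invr_ge0 ?ltW.
  rewrite mulrC ler_pdivlMr// mul1r; apply: ler_wiXn2l; [exact: ltW|exact: rho1|exact: ltnW].
have {}mn : (m <= n)%N by apply: leq_trans mn (leq_maxl _ _).
pose near_by (g : {ffun 'I_d -> 'I_3}) i' :=
  [forall c, ((cell m i' c).+1 == cell m i c + g c)%N].
apply: (@le_trans _ _ (\sum_(g : {ffun 'I_d -> 'I_3}) \sum_(i' | near_by g i') mu i' / tau)).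
  rewrite (exchange_big_dep xpredT)//= [leRHS](bigID (within (fun k j => coordinate (P j) k) d m i))/=.
  rewrite -[leLHS]addr0 lerD//; last first.
    by apply: sumr_ge0 => i' _; apply: sumr_ge0.
  apply: ler_sum => i' /forallP h.
  have [g hg] : exists g : {ffun 'I_d -> 'I_3}, forall c, ((cell m i' c).+1 = cell m i c + g c)%N.
    apply: dyadic_cell_near => // c; have := h c.
    by rewrite !coordinateE.
  rewrite (bigD1 g)/=; last by apply/forallP => c; rewrite hg.
  by rewrite lerDl sumr_ge0.
have -> : (3 ^ d)%:R * C1 * rho ^+ m = \sum_(g : {ffun 'I_d -> 'I_3}) C1 * rho ^+ m.
  by rewrite sumr_const card_ffun !card_ord -mulrA mulr_natl.
apply: ler_sum => g _.
have [i0 /forallP h0|no] := pickP (near_by g); last first.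
  by rewrite big_pred0// mulr_ge0// ltW.
apply: le_trans (cellb m i0 mn).
rewrite [leRHS](bigID (near_by g))/= -[leLHS]addr0 lerD//; last exact: sumr_ge0.
rewrite le_eqVlt; apply/orP; left; apply/eqP; apply: eq_bigl => i'.
case hi' : (near_by g i'); rewrite ?andbT ?andbF//; apply/esym/eqP/ffunP => c.
move: hi' => /forallP/(_ c)/eqP h1; have /eqP h2 := h0 c.
by apply: succn_inj; rewrite h1 h2.
Qed.

(** * Quadruples with a large inner product *)

Lemma exists_expr_le (R : realType) (r eps : R) : 0 <= r < 1 -> 0 < eps ->
  exists N : nat, forall j, (N <= j)%N -> r ^+ j <= eps.
Proof.
move=> /andP[r0 r1] eps0.
have /cvgrPdist_le/(_ eps eps0) : r ^+ n @[n --> \oo] --> (0 : R).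
  by apply: cvg_expr; rewrite ger0_norm.
move=> [N _ hN]; exists N => j Nj; have := hN j Nj.
by rewrite /= sub0r normrN ger0_norm ?exprn_ge0.
Qed.

Lemma mul_perturb (R : realType) (h b D u v : R) : 0 <= h -> h <= 1 -> `|D| <= 2 * b ->
  `|u - D| <= 2 * h -> `|v - D| <= 2 * h -> D ^+ 2 - h * (8 * b + 4) <= u * v.
Proof.
move=> h0 h1 D1 u1 v1.
have -> : u * v = D ^+ 2 + D * ((u - D) + (v - D)) + (u - D) * (v - D) by ring.
have t1 : `|D * ((u - D) + (v - D))| <= 2 * b * (4 * h).
  rewrite normrM; apply: ler_pM => //; apply: le_trans (ler_normD _ _) _.
  by move: u1 v1; clear; lra.
have t2 : `|(u - D) * (v - D)| <= 2 * h * (2 * h) by rewrite normrM; apply: ler_pM.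
have hh : h * h <= h by rewrite ler_piMl.
move: t1 t2; rewrite !ler_norml.
set p := D * _; set q := (u - D) * _; set z := D ^+ 2; move: hh; clear; lra.
Qed.

Section Spread.
Variables (R : realType) (d : nat) (B : R) (I : finType) (mu : I -> R) (P : I -> 'rV[R]_d).
Hypothesis mu0 : forall i, 0 <= mu i.
Hypothesis PB : forall i, in_box B (P i).
Let x k i := coordinate (P i) k.

Lemma quadE v v' : quad x d v v' = edot (P v.1 - P v'.1) (P v.2 - P v'.2).
Proof.
apply: eq_bigr => k _; rewrite !mxE /x.
by rewrite !coordinateE.
Qed.

Lemma coord_diff_le (k : 'I_d) i i' : `|x k i - x k i'| <= 2 * B.
Proof.
rewrite /x !coordinateE (le_trans (ler_normB _ _))//.
by have := PB i k; have := PB i' k; lra.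
Qed.

Lemma quad_le v v' : `|quad x d v v'| <= d%:R * (2 * B) ^+ 2.
Proof.
apply: le_trans (ler_norm_sum _ _ _) _.
apply: (@le_trans _ _ (\sum_(k < d) (2 * B) ^+ 2)).
  apply: ler_sum => k _; rewrite normrM expr2.
  by apply: ler_pM => //; exact: coord_diff_le.
by rewrite sumr_const card_ord -[leLHS]mulr_natl.
Qed.

Lemma cutoff_ge v v' : expR (- (d%:R * (2 * B) ^+ 2)) <= cutoff x d v v'.
Proof.
rewrite ler_expR mulNr lerN2 ler_pdivrMr//.
apply: (@le_trans _ _ (\sum_(k < d) 2 * (2 * B) ^+ 2)).
  apply: ler_sum => k _.
  have sq i i' : (x k i - x k i') ^+ 2 <= (2 * B) ^+ 2.
    rewrite -[leLHS]real_normK ?num_real//; apply: lerXn2r; rewrite ?nnegrE//.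
      exact: le_trans (coord_diff_le k i i').
    exact: coord_diff_le.
  have := sq v.1 v'.1; have := sq v.2 v'.2; lra.
by rewrite sumr_const card_ord -[leLHS]mulr_natl; lra.
Qed.

(* Near a far away pair [(i0, i0')] the form is close to the squared distance. *)
Lemma quad_ge (j0 j1 : nat) (i0 i0' : I) v v' :
  ~~ within x d j0 i0 i0' ->
  dyadic_cell B j1 (P v.1) = dyadic_cell B j1 (P i0) ->
  dyadic_cell B j1 (P v.2) = dyadic_cell B j1 (P i0) ->
  dyadic_cell B j1 (P v'.1) = dyadic_cell B j1 (P i0') ->
  dyadic_cell B j1 (P v'.2) = dyadic_cell B j1 (P i0') ->
  (2^-1 ^+ j0) ^+ 2 - d%:R * (2^-1 ^+ j1 * (8 * B + 4)) <= quad x d v v'.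
Proof.
move=> far c1 c2 c3 c4; set h : R := 2^-1 ^+ j1.
have h0 : 0 <= h by rewrite exprn_ge0.
have h1 : h <= 1 by rewrite exprn_ile1// invf_le1// ler1n.
have near a b : dyadic_cell B j1 (P a) = dyadic_cell B j1 (P b) ->
    forall k : 'I_d, `|x k a - x k b| <= h.
  move=> e k; rewrite /x !coordinateE.
  exact: dyadic_cell_close (PB a) (PB b) e k.
have s1 : (2^-1 ^+ j0) ^+ 2 <= \sum_(k < d) (x k i0 - x k i0') ^+ 2.
  have /forallPn[k] := far; rewrite -ltNge => hk.
  rewrite (bigD1 k)//= -[leLHS]addr0 lerD//.
    rewrite -[leRHS]real_normK ?num_real//.
    by apply: lerXn2r; rewrite ?nnegrE ?exprn_ge0 ?invr_ge0// ltW.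
  by apply: sumr_ge0 => *; exact: sqr_ge0.
have -> : d%:R * (h * (8 * B + 4)) = \sum_(k < d) h * (8 * B + 4).
  by rewrite sumr_const card_ord -[RHS]mulr_natl.
apply: le_trans (lerB s1 (lexx _)) _.
rewrite -sumrB; apply: ler_sum => k _.
have close i i' a b : `|x k a - x k i| <= h -> `|x k b - x k i'| <= h ->
    `|(x k a - x k b) - (x k i - x k i')| <= 2 * h.
  move=> ha hb; have -> : (x k a - x k b) - (x k i - x k i') = (x k a - x k i) - (x k b - x k i') by ring.
  by apply: le_trans (ler_normB _ _) _; move: ha hb; clear; lra.
apply: mul_perturb => //; first exact: coord_diff_le.
- exact: close (near _ _ c1 k) (near _ _ c3 k).
- exact: close (near _ _ c2 k) (near _ _ c4 k).
Qed.

End Spread.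

(** Pigeonhole over pairs of cells of level [j1], whose number depends only on [d], [B] and [j0]:
    separated pairs have mass at least [1 / 2], so some pair of cells carries at least [thr] of it.
    Taking [x, z] in the first cell and [y, w] in the second gives mass [thr ^ 2], and [quad_ge]
    applies to all these quadruples. *)
Lemma good_mass (R : realType) (d : nat) (B : R) (j0 : nat) : 0 <= B ->
  exists2 c0 : R, 0 < c0 & forall (I : finType) (mu : I -> R) (P : I -> 'rV[R]_d),
    (forall i, 0 <= mu i) -> \sum_i mu i = 1 -> (forall i, in_box B (P i)) ->
    (forall i, \sum_(i' | within (fun k i => coordinate (P i) k) d j0 i i') mu i' <= 1 / 2) ->
    c0 <= \sum_v \sum_(v' | (2^-1 ^+ j0) ^+ 2 / 2 <= quad (fun k i => coordinate (P i) k) d v v')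
       mu v.1 * mu v.2 * (mu v'.1 * mu v'.2).
Proof.
move=> B0.
have q0 : 0 < (2^-1 ^+ j0) ^+ 2 / 2 :> R by rewrite divr_gt0// !exprn_gt0// invr_gt0.
have dB : 0 < d%:R * (8 * B + 4) + 1 by rewrite ltr_wpDl// mulr_ge0//; lra.
(* Cells of level [j1] are so small that the error term in [quad_ge] is at most half of
   [(2^-1 ^+ j0) ^+ 2]. *)
have [j1 hj1] := @exists_expr_le R 2^-1 ((2^-1 ^+ j0) ^+ 2 / 2 / (d%:R * (8 * B + 4) + 1))
  ltac:(lra) (divr_gt0 q0 dB).
have {}hj1 := hj1 j1 (leqnn _).
pose N := (Num.truncn (2 ^+ j1 * (B + B))).+1.
pose T := {ffun 'I_d -> 'I_N}.
pose thr : R := (4 * (#|{: T * T}|%:R + 1))^-1.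
have thr0 : 0 < thr by rewrite invr_gt0 mulr_gt0// ltr_wpDl.
exists (thr ^+ 2); first by rewrite exprn_gt0.
move=> I mu P mu0 mu1 PB sep.
set x := fun k i => _ in sep *.
have hN i c : (dyadic_cell B j1 (P i) c < N)%N.
  rewrite ffunE ltnS le_truncn// ler_wpM2l ?exprn_ge0// lerD2r.
  by have := PB i c; rewrite ler_norml => /andP[].
pose g i : T := [ffun c => Ordinal (hN i c)].
have gE i i' : g i = g i' -> dyadic_cell B j1 (P i) = dyadic_cell B j1 (P i').
  move=> /ffunP h; apply/ffunP => c; have := congr1 val (h c).
  by rewrite [g i c]ffunE [g i' c]ffunE.
pose S (t : T * T) := \sum_i \sum_i'
   if [&& g i == t.1, g i' == t.2 & ~~ within x d j0 i i'] then mu i * mu i' else 0.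
have [t ht] : exists t, thr <= S t.
  apply: contrapT => no.
  have hS t : S t <= thr by rewrite leNgt; apply/negP => h; apply: no; exists t; exact: ltW.
  have tot : 1 / 2 <= \sum_t S t.
    have -> : \sum_t S t = \sum_i \sum_(i' | ~~ within x d j0 i i') mu i * mu i'.
      rewrite /S exchange_big /=; apply: eq_bigr => i _.
      rewrite exchange_big /= [RHS]big_mkcond/=; apply: eq_bigr => i' _.
      rewrite (bigD1 (g i, g i'))//= !eqxx/= big1 ?addr0// => -[t1 t2] ne.
      case: ifP => // /and3P[/eqP e1 /eqP e2 _]; move: ne.
      by rewrite e1 e2 eqxx.
    have -> : 1 / 2 = \sum_i mu i * (1 / 2) by rewrite -mulr_suml mu1 [RHS]mul1r.
    apply: ler_sum => i _; rewrite -mulr_sumr ler_wpM2l//.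
    have := mu1; rewrite (bigID (within x d j0 i))/=; have := sep i; lra.
  have : \sum_t S t <= 1 / 4.
    apply: le_trans (ler_sum _ (fun t _ => hS t)) _.
    rewrite sumr_const -[leLHS]mulr_natr /thr -mulrC ler_pdivrMr ?mulr_gt0 ?ltr_wpDl//.
    by set z := (_ : nat)%:R; lra.
  lra.
pose a i := if g i == t.1 then mu i else 0.
pose b i := if g i == t.2 then mu i else 0.
have a0 i : 0 <= a i by rewrite /a; case: ifP.
have b0 i : 0 <= b i by rewrite /b; case: ifP.
have [[i0 i0'] /= /and3P[/eqP e0 /eqP e0' far]] : exists p : I * I,
    [&& g p.1 == t.1, g p.2 == t.2 & ~~ within x d j0 p.1 p.2].
  apply: contrapT => no; move: ht; rewrite leNgt => /negP; apply.
  rewrite /S big1// => i _; rewrite big1// => i' _; case: ifP => // h.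
  by exfalso; apply: no; exists (i, i').
have ab : thr <= (\sum_i a i) * (\sum_i b i).
  apply: le_trans ht _; rewrite /S mulr_suml; apply: ler_sum => i _.
  rewrite mulr_sumr; apply: ler_sum => i' _; rewrite /a /b.
  case: (g i == t.1); case: (g i' == t.2) => //=; rewrite ?mul0r ?mulr0//.
  by case: ifP => // _; rewrite mulr_ge0.
apply: (@le_trans _ _ (((\sum_i a i) * (\sum_i b i)) ^+ 2)).
  by apply: lerXn2r; rewrite ?nnegrE ?(ltW thr0) ?mulr_ge0 ?sumr_ge0.
have -> : ((\sum_i a i) * (\sum_i b i)) ^+ 2 =
   \sum_(v : I * I) \sum_(v' : I * I) a v.1 * a v.2 * (b v'.1 * b v'.2).
  have sq (f : I -> R) : (\sum_i f i) ^+ 2 = \sum_(v : I * I) f v.1 * f v.2.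
    rewrite -(pair_bigA _ (fun i j => f i * f j))/= expr2 mulr_suml.
    by apply: eq_bigr => i _; rewrite mulr_sumr.
  rewrite exprMn !sq mulr_suml; apply: eq_bigr => v _.
  by rewrite mulr_sumr.
apply: ler_sum => v _; rewrite [leRHS]big_mkcond/=; apply: ler_sum => v' _.
case: ifPn => [_|hq].
  have aM i : a i <= mu i by rewrite /a; case: ifP.
  have bM i : b i <= mu i by rewrite /b; case: ifP.
  by apply: ler_pM; rewrite ?mulr_ge0//; apply: ler_pM.
rewrite /a /b.
case: eqP => [h1|_]; last by rewrite !mul0r.
case: eqP => [h2|_]; last by rewrite mulr0 !mul0r.
case: eqP => [h3|_]; last by rewrite mul0r !mulr0.
case: eqP => [h4|_]; last by rewrite !mulr0.
exfalso; move/negP: hq; apply.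
apply: le_trans (quad_ge PB far (gE _ _ _) (gE _ _ _) (gE _ _ _) (gE _ _ _)); rewrite ?e0 ?e0' //.
have : 2^-1 ^+ j1 * (d%:R * (8 * B + 4) + 1) <= (2^-1 ^+ j0) ^+ 2 / 2 by rewrite -ler_pdivlMr.
have : 0 <= 2^-1 ^+ j1 :> R by rewrite exprn_ge0.
set y := 2^-1 ^+ j1; set z := (2^-1 ^+ j0) ^+ 2; clear; lra.
Qed.

(** * The theorem *)

(** For [rho = 2 ^ -s] the last inequality compares exponents of 2: [1 / 2 + d < 2 * s], which is
    exactly the threshold of the theorem. *)
Lemma half_powR_bounds (R : realType) (d : nat) (s : R) :
  d%:R / 2 + 1 / 4 < s -> s <= d.+1%:R ->
  [/\ 2^-1 ^+ d.+1 <= 2^-1 `^ s, 2^-1 `^ s < 1 &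
      Num.sqrt 2 * 2 ^+ d * (2^-1 `^ s) ^+ 2 < 1].
Proof.
move=> ds sd; have L0 : 0 < ln (2 : R) by rewrite ln_gt0// ltr1n.
have d0 : 0 <= d%:R :> R by [].
have E2 : expR (ln 2) = 2 :> R by rewrite lnK// posrE.
have rhoE : 2^-1 `^ s = expR (- (s * ln 2)).
  by rewrite /powR gt_eqF ?invr_gt0// lnV ?posrE// mulrN.
split.
- rewrite -powR_mulrn ?invr_ge0//; apply: ger_powR => //.
  by rewrite invr_gt0 ltr0n/= invf_le1// ler1n.
- by rewrite rhoE expR_lt1 oppr_lt0 mulr_gt0//; lra.
- have -> : Num.sqrt 2 = expR (ln 2 / 2) :> R.
    rewrite -powR12_sqrt// /powR gt_eqF// mulrC//.
  have -> : 2 ^+ d = expR (d%:R * ln 2) :> R by rewrite expRM_natl E2.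
  rewrite rhoE expr2 -!expRD expR_lt1.
  have -> : ln 2 / 2 + d%:R * ln 2 + (- (s * ln 2) + - (s * ln 2)) =
     - ((2 * s - d%:R - 1 / 2) * ln 2) :> R by ring.
  by rewrite oppr_lt0 mulr_gt0//; lra.
Qed.

(** Any [s] strictly between [a] and the infimum [dimH E] works. The cap [b] will provide
    [2^-1 ^+ d.+1 <= rho]. *)
Lemma exists_hausdorff_neq0 (R : realType) (d : nat) (E : set 'rV[R]_d) (a b : R) :
  0 <= a -> a < b -> (a%:E < dimH E)%E ->
  exists s, [/\ a < s, s <= b & hausdorff s E != 0%E].
Proof.
move=> a0 ab aE.
have [s [sa sb sE]] : exists s, [/\ a < s, s <= b & (s%:E < dimH E)%E].
  case: (dimH E) aE => [r ar|_|//].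
    exists (Num.min ((a + r) / 2) b); move: ar; rewrite lte_fin => ar; split.
    - by rewrite lt_min ab andbT; lra.
    - by rewrite ge_min lexx orbT.
    - by rewrite lte_fin gt_min; apply/orP; left; lra.
  by exists b; split => //; rewrite ltry.
exists s; split => //; apply/eqP => h; move: sE; rewrite ltNge => /negP; apply.
by apply: ereal_inf_lbound; exists s => //; split => //; lra.
Qed.

Definition dot_differences (R : realType) (d : nat) (E : set 'rV[R]_d) : set R :=
  [set t : R | exists x y z w, [/\ E x, E y, E z, E w & t = edot (x - y) (z - w)]].

Lemma continuous_sum_ord (R : realType) (X : topologicalType) (n : nat)
    (f : 'I_n -> X -> R) :
  (forall i, continuous (f i)) -> continuous (fun x => \sum_(i < n) f i x).
Proof.
elim: n f => [|n IH] f fc.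
  rewrite (_ : (fun x => _) = (fun=> 0)); first exact: cst_continuous.
  by apply/funext => x; rewrite big_ord0.
rewrite (_ : (fun x => _) =
    (fun x => \sum_(i < n) f (widen_ord (leqnSn n) i) x + f ord_max x)).
  by move=> x; apply: cvgD; [apply: IH => i; exact: fc|exact: fc].
by apply/funext => x; rewrite big_ord_recr.
Qed.

Lemma closed_dot_differences (R : realType) (d : nat) (E : set 'rV[R]_d) :
  compact E -> closed (dot_differences E).
Proof.
move=> cE.
pose X := (('rV[R]_d * 'rV[R]_d) * ('rV[R]_d * 'rV[R]_d))%type.
pose F (u : X) : R := edot (u.1.1 - u.1.2) (u.2.1 - u.2.2).
have -> : dot_differences E = F @` ((E `*` E) `*` (E `*` E)).
  apply/seteqP; split => [t [x [y [z [w [Ex Ey Ez Ew ->]]]]]|t].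
    by exists ((x, y), (z, w)).
  by move=> [[[x y] [z w]] /= [[Ex Ey] [Ez Ew]] <-]; exists x, y, z, w.
apply: compact_closed; first exact: Rhausdorff.
apply: continuous_compact; last by do !apply: compact_setX.
apply: continuous_subspaceT.
rewrite /F /edot.
have coord (g : X -> 'rV[R]_d) (i : 'I_d) : continuous g -> continuous (fun u => g u ord0 i).
  move=> gc u; apply: (@continuous_comp _ _ _ g (fun y : 'rV[R]_d => y ord0 i)).
    exact: gc.
  exact: coord_continuous.
apply: continuous_sum_ord => i u.
have c11 : continuous (fun u : X => u.1.1) by move=> v; apply: continuous_comp; exact: cvg_fst.
have c12 : continuous (fun u : X => u.1.2).
  by move=> v; apply: continuous_comp; [exact: cvg_fst|exact: cvg_snd].
have c21 : continuous (fun u : X => u.2.1).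
  by move=> v; apply: continuous_comp; [exact: cvg_snd|exact: cvg_fst].
have c22 : continuous (fun u : X => u.2.2) by move=> v; apply: continuous_comp; exact: cvg_snd.
under eq_fun do rewrite !mxE.
apply: cvgM; apply: cvgB.
- exact: (coord (fun u => u.1.1) i c11 u).
- exact: (coord (fun u => u.1.2) i c12 u).
- exact: (coord (fun u => u.2.1) i c21 u).
- exact: (coord (fun u => u.2.2) i c22 u).
Qed.

Lemma exists_uniform_gap (R : realType) (T : set R) (p : nat -> R) :
  closed T -> (forall i, ~ T (p i)) ->
  forall N : nat, exists2 delta : R, 0 < delta &
    forall i, (i < N)%N -> forall q, T q -> delta <= `|q - p i|.
Proof.
move=> Tc pT; elim => [|N [e e0 he]]; first by exists 1.
have [e' e'0 he'] : exists2 e' : R, 0 < e' & forall q, T q -> e' <= `|q - p N|.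
  have oT : open (~` T) by rewrite openC.
  have := open_nbhs_nbhs (conj oT (pT N)).
  move=> /nbhs_ballP[e' /= e'0 he']; exists e' => // q Tq.
  rewrite leNgt; apply/negP => h; apply: (he' q) => //.
  by rewrite /ball/= distrC.
exists (Num.min e e'); first by rewrite lt_min e0.
move=> i; rewrite ltnS leq_eqVlt => /orP[/eqP ->|iN] q Tq; rewrite ge_min.
  by rewrite he' ?orbT.
by rewrite he.
Qed.

Unset Implicit Arguments.

Theorem theorem1p6 (R : realType) (d : nat) (E : set 'rV[R]_d) :
  (0 < d)%N ->
  compact E ->
  ((d%:R / 2 + 1 / 4 : R)%:E < dimH E)%E ->
  interior [set t : R | exists x y z w, [/\ E x, E y, E z, E w &
                          t = edot (x - y) (z - w)]] !=set0.
Proof.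
move=> _ cE dimE; rewrite -/(dot_differences E).
apply: contrapT => noint.
set T := dot_differences E in noint.
have Tc : closed T by exact: closed_dot_differences.
have avoid (a b : R) : a < b -> exists p, [/\ a < p, p < b & ~ T p].
  move=> ab; apply: contrapT => no; apply: noint; exists ((a + b) / 2).
  have : nbhs ((a + b) / 2) (`]a, b[%classic : set R).
    by apply: near_in_itvoo; rewrite in_itv/=; lra.
  apply: filterS => p /=; rewrite in_itv/= => /andP[ap pb].
  by apply: contrapT => Tp; apply: no; exists p.
have dR : 0 <= d%:R :> R by [].
have a0 : 0 <= d%:R / 2 + 1 / 4 :> R by lra.
have ab : d%:R / 2 + 1 / 4 < d.+1%:R :> R by rewrite -(natr1 d); lra.
have [s [ds sd hs]] := exists_hausdorff_neq0 a0 ab dimE.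
have [rhod rho1 rhos] := half_powR_bounds ds sd.
have s0 : 0 <= s by lra.
have [CF CF0 hF] := frostman cE s0 hs.
have [B B0 EB] := compact_in_box cE.
set rho := 2^-1 `^ s in rhod rho1 rhos hF.
have rho0 : 0 <= rho by exact: powR_ge0.
(* Balls of radius [2 ^ -j0] have mass at most [1 / 2], which is the separation hypothesis of
   [good_mass]. *)
have [j0 hj0] := @exists_expr_le R rho (1 / (2 * (CF + 1))) ltac:(lra)
  ltac:(apply: divr_gt0 => //; lra).
have {}hj0 := hj0 j0 (leqnn _).
have CFj0 : CF * rho ^+ j0 <= 1 / 2.
  move: hj0; rewrite ler_pdivlMr; last lra.
  by have : 0 <= rho ^+ j0 by [exact: exprn_ge0]; set z := rho ^+ j0; clear; lra.
have [c0 c00 hc0] := @good_mass R d B j0 B0.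
pose q1 : R := (2^-1 ^+ j0) ^+ 2 / 2.
have q10 : 0 < q1 by rewrite divr_gt0// !exprn_gt0// invr_gt0.
pose q2 : R := d%:R * (2 * B) ^+ 2.
have q20 : 0 <= q2 by rewrite mulr_ge0// sqr_ge0.
pose p2 : R := q1 + q2 + 2.
have [K [r [K0 r2 r1 hK]]] := energy_bound p2 q10 rhod rho1 CF0 rhos.
pose c2 : R := expR (- q2).
have c20 : 0 < c2 by exact: expR_gt0.
(* Chosen so that the total over all intervals, at most [(q2 + 1) * (c2^-1 * K * r ^ j)], does not
   exceed [c0 / 2]. *)
have eps0 : 0 < c0 * c2 / (2 * (q2 + 1) * K).
  by rewrite divr_gt0 ?mulr_gt0//; lra.
have r01 : 0 <= r < 1 by lra.
have [j1 hj1] := exists_expr_le r01 eps0.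
pose j := maxn 2 j1.
have {}hj1 : r ^+ j <= c0 * c2 / (2 * (q2 + 1) * K) by apply: hj1; exact: leq_maxr.
have j2 : (2 <= j)%N by exact: leq_maxl.
pose h : R := 2^-1 ^+ j.
have h0 : 0 < h by rewrite exprn_gt0// invr_gt0.
have h1 : h <= 1 by rewrite exprn_ile1// invf_le1// ler1n.
(* One avoided point in each interval of length [h] from [q1] on. A value of [quad] that is at least
   [q1] lies in one of the first [N] intervals, hence within [h] of its [p i]. *)
have hp i : exists p, [/\ q1 + i%:R * h < p, p < q1 + i.+1%:R * h & ~ T p].
  by apply: avoid; rewrite -(natr1 i) mulrDl mul1r; lra.
have [p pP] := boolp.choice hp.
pose N := (Num.truncn (q2 / h)).+1.
have Nle : N%:R * h <= q2 + 1.
  have : (Num.truncn (q2 / h))%:R <= q2 / h by rewrite truncn_le divr_ge0// ltW.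
  by rewrite ler_pdivlMr// /N -(natr1 (Num.truncn (q2 / h))) mulrDl mul1r; lra.
have pN i : (i < N)%N -> q1 <= p i <= p2.
  move=> iN; have [a1 a2 _] := pP i.
  have : i.+1%:R * h <= N%:R * h by rewrite ler_wpM2r ?ler_nat// ltW.
  have : 0 <= i%:R * h by rewrite mulr_ge0// ltW.
  rewrite /p2; lra.
have [delta delta0 hdelta] := @exists_uniform_gap R T p Tc (fun i => let: And3 _ _ t := pP i in t) N.
have [n hn] := hK j delta (q2 + p2) j2 delta0.
(* The measure comes last. Level [j0] is included because [good_mass] uses the Frostman bound
   there. *)
have [I [mu [P [EP mu0 mu1 fr]]]] := hF (maxn n j0).
set x := (fun (k : nat) j => coordinate (P j) k) in fr.
have PB i : in_box B (P i) by apply: EB.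
have good := hc0 I mu P mu0 mu1 PB.
have {good} : c0 <= \sum_v \sum_(v' | q1 <= quad x d v v') mu v.1 * mu v.2 * (mu v'.1 * mu v'.2).
  apply: good => i; apply: le_trans CFj0; apply: fr; exact: leq_maxr.
apply/negP; rewrite -ltNge.
have quadT v v' : T (quad x d v v').
  by rewrite quadE; exists (P v.1), (P v'.1), (P v.2), (P v'.2).
have bound i : (i < N)%N ->
    \sum_v \sum_(v' | `|quad x d v v' - p i| <= h)
         mu v.1 * mu v.2 * (mu v'.1 * mu v'.2) * cutoff x d v v' <= K * (r / 2) ^+ j.
  move=> iN; apply: hn => //; last 2 first.
  - exact: pN.
  - move=> v v'; rewrite hdelta//=.
    apply: le_trans (ler_normB _ _) _; have := quad_le PB v v'.
    have /andP[b1 b2] := pN i iN.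
    by rewrite (ger0_norm (le_trans (ltW q10) b1)) -/q2; move: b2; clear; lra.
  by move=> m i' mn; apply: fr; rewrite leq_max mn.
have mm0 v v' : 0 <= mu v.1 * mu v.2 * (mu v'.1 * mu v'.2) by rewrite !mulr_ge0.
(* The mass of the quadruples with value at least [q1] is at least [c0], yet it is covered by [N]
   intervals of small mass; [c2^-1] removes the Gaussian cutoff. *)
apply: (@le_lt_trans _ _ (\sum_(i < N) c2^-1 * (K * (r / 2) ^+ j))); last first.
  rewrite sumr_const card_ord -[ltLHS]mulr_natl.
  have -> : N%:R * (c2^-1 * (K * (r / 2) ^+ j)) = (N%:R * h) * (c2^-1 * K * r ^+ j).
    by rewrite /h exprMn; ring.
  have rj0 : 0 <= r ^+ j by rewrite exprn_ge0//; lra.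
  have ic2 : 0 <= c2^-1 by rewrite invr_ge0 ltW.
  have k0 : 0 <= c2^-1 * K * r ^+ j by rewrite !mulr_ge0 ?(ltW K0).
  apply: le_lt_trans (ler_wpM2r k0 Nle) _.
  have k1 : 0 <= (q2 + 1) * (c2^-1 * K) by rewrite !mulr_ge0 ?(ltW K0)//; lra.
  have := ler_wpM2l k1 hj1.
  have -> : (q2 + 1) * (c2^-1 * K) * (c0 * c2 / (2 * (q2 + 1) * K)) = c0 / 2.
    by field; rewrite !gt_eqF//; lra.
  by rewrite !mulrA; move: c00; clear; lra.
apply: (@le_trans _ _ (\sum_(i < N) \sum_v \sum_(v' | `|quad x d v v' - p i| <= h)
         mu v.1 * mu v.2 * (mu v'.1 * mu v'.2))).
  rewrite exchange_big /=; apply: ler_sum => v _.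
  rewrite (exchange_big_dep xpredT)//= [leLHS]big_mkcond/=; apply: ler_sum => v' _.
  case: ifPn => [qv|_]; last exact: sumr_ge0.
  pose i := Num.truncn ((quad x d v v' - q1) / h).
  have /andP[i1 i2] : i%:R <= (quad x d v v' - q1) / h < i.+1%:R.
    by apply: truncn_itv; rewrite divr_ge0 ?subr_ge0// ltW.
  rewrite ler_pdivlMr// in i1; rewrite ltr_pdivrMr// in i2.
  have iN : (i < N)%N.
    rewrite ltnS; apply: le_truncn; rewrite ler_wpM2r ?invr_ge0 ?(ltW h0)//.
    have := quad_le PB v v'; rewrite ler_norml -/q2 => /andP[_]; lra.
  rewrite (bigD1 (Ordinal iN))/=; last first.
    have [b1 b2 _] := pP i.
    rewrite ler_norml; move: i1 i2 b1 b2; rewrite -(natr1 i) mulrDl mul1r.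
    by set z := i%:R * h; clear; lra.
  by rewrite lerDl sumr_ge0.
apply: ler_sum => i _; rewrite ler_pdivlMl//.
apply: le_trans (bound i (ltn_ord i)).
rewrite mulr_sumr; apply: ler_sum => v _; rewrite mulr_sumr; apply: ler_sum => v' _.
rewrite mulrC ler_wpM2l//; exact: cutoff_ge.
Qed.
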